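(* Let $0<q<1$, $X\in\{B,C\}$, $N\ge1$, and let $\omega\in\Omega$ be such that $\Psi_\omega(q^{c(X)_i})>0$ for $i=1,\dots,N$ and the Taylor expansion $\Phi_\omega(x)=\sum_{n\ge0}\varphi_\omega(n)x^n$ converges in an annulus (centered at $0$) containing $q^X_1,\dots,q^X_N$, where $q^X_i=(q^{c(X)_i}+q^{-c(X)_i})/2$. Then there exists a Markov semigroup on $\mathbb{S}_N^+$ with generator $\mathbb{L}_{\chi_{\omega,N}}$ given by $$\mathbb{L}_{\chi_{\omega,N}}(\lambda,\mu)=\frac{f^{X_N}_\mu(q^{c(X)_1},\dots,q^{c(X)_N})}{f^{X_N}_\lambda(q^{c(X)_1},\dots,q^{c(X)_N})}\cdot\frac{\det\Big[\oint_{|z|=1}\Psi_\omega(z)(z^{l_i}-z^{-l_i})\overline{(z^{m_j}-z^{-m_j})}\frac{dz}{2\pi\mathrm{i}z}\Big]_{i,j=1}^N}{2^N\prod_{j=1}^N\Psi_\omega(q^{c(X)_j})}-\delta_{\lambda,\mu}$$ for all $\lambda,\mu\in\mathbb{S}_N^+$, where $l_i=\lambda_i+c(X)_{N-i+1}$ and $m_i=\mu_i+c(X)_{N-i+1}$ for $i=1,\dots,N$.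
   Context: $\epsilon(B)=1/2$, $\epsilon(C)=1$, $c(X)_i=i-1+\epsilon(X)$ for $i\ge1$. $\mathbb{S}_N^+=\{\lambda\in\mathbb{Z}^N:\lambda_1\ge\dots\ge\lambda_N\ge0\}$ (it labels the unitary dual of $SO_q(2N+1)$ for $X=B$ and of $Sp_q(N)$ for $X=C$). For $\lambda\in\mathbb{S}_N^+$, $f^{X_N}_\lambda$ is the Laurent polynomial $$f^{X_N}_\lambda(z_1,\dots,z_N)=\frac{\det\Big[\frac{z_j^{\lambda_i+c(X)_{N-i+1}}-z_j^{-\lambda_i-c(X)_{N-i+1}}}{z_j^{\epsilon(X)}-z_j^{-\epsilon(X)}}\Big]_{i,j=1}^N}{\prod_{1\le i<j\le N}(z_i+z_i^{-1}-z_j-z_j^{-1})}.$$ $\Omega$ is the set of $\omega=(\alpha,\beta,\gamma)\in\mathbb{R}_{\ge0}^\infty\times\mathbb{R}_{\ge0}^\infty\times\mathbb{R}_{\ge0}$ with $\alpha_1\ge\alpha_2\ge\cdots$, $\beta_1\ge\beta_2\ge\cdots$, $\beta_1\le1$, $\gamma\ge0$ and $\sum_i(\alpha_i+\beta_i)<\infty$. For $\omega\in\Omega$, $$\Phi_\omega(x)=e^{\gamma(x-1)}\prod_{i=1}^\infty\frac{1+\beta_i(1-\frac{\beta_i}{2})(x-1)}{1-\alpha_i(1+\frac{\alpha_i}{2})(x-1)},\qquad\Psi_\omega(z)=\Phi_\omega\Big(\frac{z+z^{-1}}2\Big).$$ For $X=B$ the exponents $l_i,m_j$ are half-integers; the products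 $(z^{l_i}-z^{-l_i})\overline{(z^{m_j}-z^{-m_j})}$ on $|z|=1$ involve only integer powers of $z$ (same branch of the square root in both factors). A Markov semigroup on a countable set $S$ is a family $(Q_t)_{t\ge0}$ of stochastic matrices on $S$ with $Q_0=I$, $Q_sQ_t=Q_{s+t}$ and $Q_t(\lambda,\mu)\to\delta_{\lambda,\mu}$ as $t\to0$; its generator is the matrix $\frac{d}{dt}\big|_{t=0}Q_t(\lambda,\mu)$. *)

(* Defs.v *)
From HB Require Import structures.
From mathcomp Require Import all_boot all_order all_algebra.
From mathcomp Require Import complex.
From mathcomp Require Import all_classical all_reals all_analysis.

Set Implicit Arguments.
Unset Strict Implicit.
Unset Printing Implicit Defensive.

Import Order.TTheory GRing.Theory Num.Theory.
Import numFieldNormedType.Exports.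

Local Open Scope classical_set_scope.
Local Open Scope ring_scope.
Local Open Scope complex_scope.

(* R[i] with the topology of its norm; used only where limits are taken. *)
Definition Cplx (R : realType) : numFieldType := R[i].

Inductive lie_series := SeriesB | SeriesC.

Definition eps (R : realType) (X : lie_series) : R :=
  match X with SeriesB => 2^-1 | SeriesC => 1 end.

(* Indexed as on paper: only cX X k with 1 <= k is meaningful. *)
Definition cX (R : realType) (X : lie_series) (k : nat) : R :=
  k%:R - 1 + eps R X.

Definition is_signature (N : nat) (l : {ffun 'I_N -> int}) : bool :=
  [forall i : 'I_N, forall j : 'I_N, (i <= j)%N ==> (l j <= l i)]
  && [forall i : 'I_N, 0 <= l i].

Definition Splus (N : nat) := {l : {ffun 'I_N -> int} | is_signature l}.

(* lambda_i + c(X)_{N-i+1}; the 0-based i : 'I_N stands for the index i + 1,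
   so that N - i + 1 becomes N - i. *)
Definition shifted (R : realType) (X : lie_series) (N : nat) (la : Splus N)
    (i : 'I_N) : R :=
  (val la i)%:~R + cX R X (N - i).

(* The value of the Laurent polynomial f^{X_N}_lambda at a point with positive
   coordinates where z_i + z_i^-1 are distinct and z_i != 1, i.e. where no
   denominator vanishes; z^a is the positive branch of the power. *)
Definition fX (R : realType) (X : lie_series) (N : nat) (la : Splus N)
    (z : 'I_N -> R) : R :=
  \det (\matrix_(i < N, j < N)
     ((z j `^ shifted R X la i - z j `^ (- shifted R X la i))
        / (z j `^ eps R X - z j `^ (- eps R X))))
  / \prod_(i < N) \prod_(j < N | (i < j)%N)
      (z i + (z i)^-1 - z j - (z j)^-1).

Record params (R : realType) := Params {
  alpha : nat -> R;
  beta : nat -> R;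
  gamma : R
}.

Definition in_Omega (R : realType) (w : params R) : Prop :=
  [/\ (forall i, 0 <= alpha w i),
      (forall i, 0 <= beta w i)
    & 0 <= gamma w] /\
  [/\ (forall i, alpha w i.+1 <= alpha w i),
      (forall i, beta w i.+1 <= beta w i),
      beta w 0%N <= 1
    & cvgn (series (fun i => alpha w i + beta w i))].

Definition cis (R : realType) (t : R) : R[i] := cos t +i* sin t.

Definition cexp (R : realType) (z : R[i]) : R[i] :=
  (expR (complex.Re z))%:C * cis (complex.Im z).

Definition Phi (R : realType) (w : params R) (x : R[i]) : R[i] :=
  cexp ((gamma w)%:C * (x - 1)) *
  limn (fun n : nat => (\prod_(i < n)
    ((1 + (beta w i * (1 - beta w i / 2))%:C * (x - 1))
       / (1 - (alpha w i * (1 + alpha w i / 2))%:C * (x - 1)))) : Cplx R).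

Definition Psi (R : realType) (w : params R) (z : R[i]) : R[i] :=
  Phi w ((z + z^-1) / 2).

Definition phi (R : realType) (w : params R) (n : nat) : R[i] :=
  derive1n n (Phi w : Cplx R -> (Cplx R)^o) 0 / n`!%:R.

Definition qX (R : realType) (X : lie_series) (q : R) (k : nat) : R :=
  (q `^ cX R X k + q `^ (- cX R X k)) / 2.

Definition Taylor_cvg_annulus (R : realType) (w : params R) (N : nat)
    (x : 'I_N -> R) : Prop :=
  exists r1 r2 : R,
    [/\ 0 <= r1,
        (forall i, r1 < x i < r2)
      & (forall z : R[i], r1%:C < `|z| < r2%:C ->
           series (fun n => phi w n * z ^+ n) @ \oo --> (Phi w z : Cplx R))].

(* The integral of g(z) dz / (2 pi i z) over |z| = 1, where h t = g(e^{it}). *)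
Definition circle_int (R : realType) (h : R -> R[i]) : R[i] :=
  (Rintegral (@lebesgue_measure R) `[0, 2 * pi] (fun t => complex.Re (h t))
   +i* Rintegral (@lebesgue_measure R) `[0, 2 * pi]
         (fun t => complex.Im (h t)))
  / (2 * pi)%:C.

(* On z = e^{it}, 0 <= t <= 2 pi, the power z^a is e^{ita}; for half-integers
   a this uses one and the same branch of the square root throughout. *)
Definition circle_entry (R : realType) (w : params R) (l m : R) : R[i] :=
  circle_int (fun t => Psi w (cis t)
    * (cis (l * t) - cis (- l * t))
    * (cis (m * t) - cis (- m * t))^*).

Definition generator_formula (R : realType) (X : lie_series) (N : nat) (q : R)
    (w : params R) (la mu : Splus N) : R[i] :=
  let z (i : 'I_N) := q `^ cX R X i.+1 in
  (fX X mu z / fX X la z)%:C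
  * (\det (\matrix_(i < N, j < N)
        circle_entry w (shifted R X la i) (shifted R X mu j))
     / (2 ^+ N * \prod_(j < N) Psi w (z j)%:C))
  - (la == mu)%:R.

Section Markov.
Variables (R : realType) (S : countType).

Definition stochastic (P : S -> S -> R) : Prop :=
  (forall x y, 0 <= P x y) /\
  (forall x, \esum_(y in [set: S]) (P x y)%:E = 1%E).

Definition Markov_semigroup (Q : R -> S -> S -> R) : Prop :=
  [/\ (forall t, 0 <= t -> stochastic (Q t)),
      (forall x y, Q 0 x y = (x == y)%:R),
      (forall s t, 0 <= s -> 0 <= t -> forall x y,
         \esum_(u in [set: S]) (Q s x u * Q t u y)%:E = (Q (s + t) x y)%:E)
    & (forall x y, Q t x y @[t --> 0^'+] --> ((x == y)%:R : R))].

Definition is_generator (Q : R -> S -> S -> R) (L : S -> S -> R) : Prop :=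
  forall x y, t^-1 * (Q t x y - Q 0 x y) @[t --> 0^'+] --> L x y.

End Markov.

(* Main.v *)
Require Import Defs.
From HB Require Import structures.
From mathcomp Require Import all_boot all_order all_algebra fingroup perm.
From mathcomp Require Import complex.
From mathcomp Require Import all_classical all_reals all_analysis measurable_realfun.
From mathcomp Require Import ring lra zify.
Import Order.TTheory GRing.Theory Num.Theory.
Import numFieldNormedType.Exports.
Local Open Scope classical_set_scope.
Local Open Scope ring_scope.
Local Open Scope complex_scope.

(** Let P la mu be the quotient of the two values of f times the normalized
    determinant, so that the claimed generator is P - 1.  The theorem amounts to P
    being a stochastic matrix, because then the sum over n of
    exp (- t) t ^ n / n! P ^ n is a Markov semigroup with generator P - 1
    ([poissonized_Markov], [poissonized_generator]).

    Let k_i = la_i + N - i be the positions of N particles, so that l_i = k_i + eps.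
    On the unit circle the integrand of an entry of the determinant is
    4 Phi (cos t) sin (l t) sin (m t); hence the entry is twice the matrix element
    [sine_kernel] of multiplication by Phi (cos t) in the orthonormal system
    sin ((k + eps) t), and the factors 2 cancel 2 ^ N.  In this system cos t acts as
    a Jacobi matrix with off-diagonal entries 1 / 2, whose only diagonal entry is
    at the wall.

    Nonnegativity of P.  On [-1, 1] the function Phi is a limit of products of
    factors 1 + b (x - 1) and 1 / (1 - a (x - 1)) with values in [0, 1].  For the
    coefficients b and a that occur, 1 + b (x - 1) acts as a product of two
    bidiagonal kernels with nonnegative entries, and 1 - a (x - 1) as a product of
    two bidiagonal kernels whose off-diagonal entries are nonpositive.  The former
    and the inverses of the latter have nonnegative minors; by Cauchy-Binet so do
    their products and the limit ([TNN_beta_factor], [TNN_alpha_factor],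
    [TNN_PhiR]).  The quotient of the values of f is positive because at the points
    q ^ c the numerator of f is a Vandermonde determinant ([detS_product]).

    Row sums of P.  For fixed z the sequence z ^ (k + eps) - z ^ (- k - eps) is an
    eigenvector of the Jacobi matrix, with eigenvalue (z + 1 / z) / 2, hence of the
    kernel of Phi, with eigenvalue Phi ((z + 1 / z) / 2), as soon as the sums involved
    converge ([sine_kernel_row_sum]).  They do if Phi equals its Taylor series on
    [-1, 1] and the coefficients decay fast enough.  The hypothesis gives the
    equality on an annulus only.  Cauchy's formula on a circle inside the annulus
    carries it to [-1, 1], after multiplication by the polynomial that cancels the
    poles inside the circle ([Phi_Taylor]).  Cauchy-Binet turns the one-particle
    equation into the summation over signatures ([transition_weight_sum_cvg]). *)

(** * Strictly decreasing families and the Cauchy-Binet formula *)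

Definition strictly_decr N (f : 'I_N -> nat) : bool :=
  [forall i : 'I_N, forall j : 'I_N, (i < j)%N ==> (f j < f i)%N].

Lemma strictly_decrP N (f : 'I_N -> nat) :
  reflect (forall i j : 'I_N, (i < j)%N -> (f j < f i)%N) (strictly_decr N f).
Proof.
apply: (iffP forallP) => [H i j ij|H i].
  by move: (H i) => /forallP /(_ j) /implyP; apply.
by apply/forallP => j; apply/implyP; exact: H.
Qed.

Lemma strictly_decr_sorted N (f : 'I_N -> nat) :
  strictly_decr N f -> sorted gtn [seq f i | i <- enum 'I_N].
Proof.
move=> /strictly_decrP H.
apply: (@homo_sorted _ _ f (relpre val ltn) gtn) => [i j /=|]; first exact: H.
by rewrite -sorted_map val_enum_ord iota_ltn_sorted.
Qed.

Lemma strictly_decr_inj N (f : 'I_N -> nat) : strictly_decr N f -> injective f.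
Proof.
move=> /strictly_decrP H i j eqf; apply/eqP; rewrite -val_eqE /=.
by case: ltngtP => // /H; rewrite eqf ltnn.
Qed.

(** The decreasing enumeration of a finite set is unique, and two families of N
    distinct values, one set containing the other, have the same values. *)
Lemma strictly_decr_eq N (f g : 'I_N -> nat) :
  strictly_decr N f -> strictly_decr N g -> (forall i, exists j, f i = g j) -> f =1 g.
Proof.
move=> sf sg fg.
have uf : uniq [seq f i | i <- enum 'I_N].
  by rewrite map_inj_uniq ?enum_uniq //; exact: strictly_decr_inj.
have sub : {subset [seq f i | i <- enum 'I_N] <= [seq g i | i <- enum 'I_N]}.
  move=> _ /mapP [i _ ->]; have [j ->] := fg i.
  by apply: map_f; rewrite mem_enum.
have eqs : [seq f i | i <- enum 'I_N] = [seq g i | i <- enum 'I_N].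
  apply: (irr_sorted_eq (leT := gtn)) => //.
  - by move=> a b c /= ba ac; exact: ltn_trans ac ba.
  - by move=> a; rewrite /= ltnn.
  - exact: strictly_decr_sorted.
  - exact: strictly_decr_sorted.
  - by apply: (uniq_min_size uf sub _).2; rewrite !size_map.
by move=> i; have /eq_in_map -> := eqs; rewrite ?mem_enum.
Qed.

Section CauchyBinet.
Variable R : comNzRingType.

(** Multilinearity of the determinant in the rows of A *m B, before the maps h with a
    repeated value are discarded; the bidiagonal kernels need this form. *)
Lemma det_mulmx_expand N n (A : 'M[R]_(N, n)) (B : 'M[R]_(n, N)) :
  \det (A *m B) = \sum_(h : {ffun 'I_N -> 'I_n})
    (\prod_i A i (h i)) * \det (\matrix_(i, j) B (h i) j).
Proof.
rewrite /determinant.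
under eq_bigr => s _.
  under eq_bigr => i _ do rewrite mxE.
  rewrite bigA_distr_bigA /= mulr_sumr.
  over.
rewrite exchange_big /=; apply: eq_bigr => h _.
rewrite mulr_sumr; apply: eq_bigr => s _.
rewrite mulrCA big_split /=; congr (_ * (_ * _)).
by apply: eq_bigr => i _; rewrite mxE.
Qed.

Lemma det_row_eq0 N n (B : 'M[R]_(n, N)) (h : 'I_N -> 'I_n) :
  ~~ injectiveb h -> \det (\matrix_(i, j) B (h i) j) = 0.
Proof.
move=> /injectivePn [i [j ij hij]].
by apply: (determinant_alternate ij) => k; rewrite !mxE hij.
Qed.

Lemma sorting_perm N n (h : 'I_N -> 'I_n) : injective h ->
  exists s : 'S_N, strictly_decr N (fun i => h (s i)).
Proof.
move=> hinj.
pose t : N.-tuple nat := [tuple val (h i) | i < N].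
have : perm_eq (sort_tuple geq t) t by rewrite /= perm_sort.
move=> /tuple_permP [s es]; exists s.
have ts i : tnth (sort_tuple geq t) i = h (s i).
  rewrite (tnth_nth 0%N) es -tnth_nth !tnth_mktuple //.
apply/strictly_decrP => i j ij.
rewrite ltn_neqAle; apply/andP; split.
  rewrite val_eqE (inj_eq hinj) (inj_eq perm_inj).
  by apply: contraTneq ij => ->; rewrite ltnn.
rewrite -!ts !(tnth_nth 0%N).
have tr : transitive geq by move=> a b c /= ba ac; exact: leq_trans ac ba.
have rf : reflexive geq by move=> a /=.
have st : sorted geq (sort geq t).
  by apply: sort_sorted => a b; rewrite /= leq_total.
apply: (sorted_leq_nth tr rf 0%N st); last exact: ltnW.
  by rewrite inE size_sort size_tuple.
by rewrite inE size_sort size_tuple.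
Qed.

(** With [sorting_perm], an injective map is a strictly decreasing one composed with
    exactly one permutation; this is how the sum over maps becomes a sum over
    strictly decreasing maps. *)
Lemma sorting_perm_uniq N n (h : 'I_N -> 'I_n) (s1 s2 : 'S_N) :
  injective h -> strictly_decr N (fun i => h (s1 i)) -> strictly_decr N (fun i => h (s2 i)) ->
  s1 = s2.
Proof.
move=> hinj d1 d2; apply/permP => i; apply: hinj; apply: val_inj.
apply: (strictly_decr_eq N _ _ d1 d2) => j.
by exists ((s2^-1)%g (s1 j)); rewrite permKV.
Qed.

(** Group the maps h of [det_mulmx_expand] by the permutation that sorts them.  The
    maps with a repeated value contribute zero, and those with the same sorted map
    rebuild the determinant of a block of columns of A. *)
Lemma Cauchy_Binet N n (A : 'M[R]_(N, n)) (B : 'M[R]_(n, N)) :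
  \det (A *m B) = \sum_(h : {ffun 'I_N -> 'I_n} | strictly_decr N (fun i => h i))
    \det (\matrix_(i, j) A i (h j)) * \det (\matrix_(i, j) B (h i) j).
Proof.
rewrite det_mulmx_expand.
pose F (h : {ffun 'I_N -> 'I_n}) :=
  (\prod_i A i (h i)) * \det (\matrix_(i, j) B (h i) j).
transitivity (\sum_(h : {ffun 'I_N -> 'I_n})
    \sum_(s : 'S_N | strictly_decr N (fun i => h (s i))) F h).
  apply: eq_bigr => h _.
  have [/injectiveP hinj|hn] := boolP (injectiveb h); last first.
    by rewrite det_row_eq0 // mulr0 big1 // => s _; rewrite /F det_row_eq0 // mulr0.
  have [s0 ds0] := sorting_perm N n h hinj.
  rewrite (big_pred1 s0) // => s /=.
  apply/idP/eqP => [ds|->//]; exact: (sorting_perm_uniq N n h _ _ hinj ds ds0).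
rewrite (exchange_big_dep xpredT) //=.
transitivity (\sum_(s : 'S_N) \sum_(g : {ffun 'I_N -> 'I_n} | strictly_decr N (fun i => g i))
    F [ffun i => g ((s^-1)%g i)]).
  apply: eq_bigr => s _.
  rewrite (reindex (fun g : {ffun 'I_N -> 'I_n} => [ffun i => g ((s^-1)%g i)])) /=.
    apply: eq_bigl => g.
    have E : (fun i => val ([ffun i0 => g ((s^-1)%g i0)] (s i))) =1 (fun i => val (g i)).
      by move=> i; rewrite ffunE permK.
    by apply/strictly_decrP/strictly_decrP => H i j ij; have := H i j ij; rewrite !E.
  exists (fun g : {ffun 'I_N -> 'I_n} => [ffun i => g (s i)]) => g _;
    by apply/ffunP => i; rewrite !ffunE ?permK ?permKV.
rewrite exchange_big /=; apply: eq_bigr => g _.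
rewrite [X in _ = X * _]/determinant mulr_suml (reindex_inj invg_inj) /=.
apply: eq_bigr => s _; rewrite /F invgK.
have -> : \matrix_(i, j) B ([ffun i0 => g (s i0)] i) j =
  row_perm s (\matrix_(i, j) B (g i) j).
  by apply/matrixP => i j; rewrite !mxE ffunE.
rewrite row_permE det_mulmx det_perm mulrA; congr (_ * _).
rewrite mulrC; congr (_ * _); apply: eq_bigr => i _; by rewrite mxE ffunE.
Qed.

End CauchyBinet.


(** * Limits of determinants and elementary bounds *)

Section BigCvg.
Variable R : realType.

Lemma cvgr_sum I (r : seq I) (P : pred I) (T : Type) (F : set_system T)
    (u : I -> T -> R) (l : I -> R) : Filter F ->
  (forall i, P i -> u i x @[x --> F] --> l i) ->
  (\sum_(i <- r | P i) u i x) @[x --> F] --> \sum_(i <- r | P i) l i.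
Proof. by move=> FF; apply: cvg_big; exact: add_continuous. Qed.

Lemma cvgr_prod I (r : seq I) (P : pred I) (T : Type) (F : set_system T)
    (u : I -> T -> R) (l : I -> R) : Filter F ->
  (forall i, P i -> u i x @[x --> F] --> l i) ->
  (\prod_(i <- r | P i) u i x) @[x --> F] --> \prod_(i <- r | P i) l i.
Proof. by move=> FF; apply: cvg_big; exact: mul_continuous. Qed.

Lemma cvgr_det n (T : Type) (F : set_system T)
    (A : T -> 'M[R]_n) (B : 'M[R]_n) : Filter F ->
  (forall i j, A x i j @[x --> F] --> B i j) ->
  \det (A x) @[x --> F] --> \det B.
Proof.
move=> FF H; apply: cvgr_sum => s _; apply: cvgM; first exact: cvg_cst.
by apply: cvgr_prod => i _; exact: H.
Qed.

End BigCvg.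

Section ElementaryBounds.
Variable R : realFieldType.

Lemma geometric_sum_le (x : R) n : 0 <= x -> x < 1 ->
  \sum_(0 <= i < n) x ^+ i <= (1 - x)^-1.
Proof.
move=> x0 x1; rewrite -[leRHS]mul1r ler_pdivlMr ?subr_gt0 //.
have -> : (\sum_(0 <= i < n) x ^+ i) * (1 - x) = 1 - x ^+ n.
  elim: n => [|n IH]; first by rewrite big_geq // expr0 subrr mul0r.
  by rewrite big_nat_recr //= mulrDl IH exprS; ring.
by rewrite lerBlDr lerDl exprn_ge0.
Qed.

Lemma half_add_inv_ge1 (z : R) : 0 < z -> 1 <= (z + z^-1) / 2.
Proof.
move=> z0; rewrite ler_pdivlMr // mul1r -subr_ge0.
have -> : z + z^-1 - 2 = (z - 1) ^+ 2 / z by field; rewrite gt_eqF.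
by rewrite divr_ge0 ?sqr_ge0 // ltW.
Qed.

End ElementaryBounds.

(** * Kernels with nonnegative minors *)

Section TNN.
Variables (R : realType) (N : nat).
Implicit Types K X Y : nat -> nat -> R.

(** Total nonnegativity, restricted to the size N of the minors in use. *)
Definition TNN K := forall f g : 'I_N -> nat, strictly_decr N f -> strictly_decr N g ->
  0 <= \det (\matrix_(i < N, j < N) K (f i) (g j)).

Lemma TNN_tr K : TNN K -> TNN (fun i j => K j i).
Proof.
move=> H f g sf sg; rewrite -det_tr.
rewrite (_ : _^T = \matrix_(i, j) K (g i) (f j)); first exact: H.
by apply/matrixP => i j; rewrite !mxE.
Qed.

Lemma TNN_lim (Kn : nat -> nat -> nat -> R) K :
  (forall n, TNN (Kn n)) ->
  (forall i j, Kn n i j @[n --> \oo] --> K i j) -> TNN K.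
Proof.
move=> H HK f g sf sg.
have C : \det (\matrix_(i < N, j < N) Kn n (f i) (g j)) @[n --> \oo] -->
         \det (\matrix_(i < N, j < N) K (f i) (g j)).
  apply: cvgr_det => i j; rewrite mxE.
  by under eq_cvg do rewrite mxE; exact: HK.
by apply: (cvgr_to_ge C); apply: nearW => n; exact: H.
Qed.

Lemma TNN_partial_mul n X Y : TNN X -> TNN Y ->
  TNN (fun i j => \sum_(k < n) X i k * Y k j).
Proof.
move=> HX HY f g sf sg.
have -> : \matrix_(i < N, j < N) (\sum_(k < n) X (f i) k * Y k (g j)) =
   (\matrix_(i < N, k < n) X (f i) k) *m (\matrix_(k < n, j < N) Y k (g j)).
  by apply/matrixP => i j; rewrite !mxE; apply: eq_bigr => k _; rewrite !mxE.
rewrite Cauchy_Binet; apply: sumr_ge0 => h sh; apply: mulr_ge0.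
  rewrite (_ : \matrix_(_, _) _ = \matrix_(i, j) X (f i) (h j)); first exact: HX.
  by apply/matrixP => i j; rewrite !mxE.
rewrite (_ : \matrix_(_, _) _ = \matrix_(i, j) Y (h i) (g j)); first exact: HY.
by apply/matrixP => i j; rewrite !mxE.
Qed.

(** Cauchy-Binet for the truncated products, whose limit need not be a finite sum. *)
Lemma TNN_mul X Y Z : TNN X -> TNN Y ->
  (forall i j, (\sum_(k < n) X i k * Y k j) @[n --> \oo] --> Z i j) -> TNN Z.
Proof.
move=> HX HY; apply: TNN_lim => n; exact: TNN_partial_mul.
Qed.

Lemma TNN_scale (u v : nat -> R) K : (forall i, 0 <= u i) -> (forall i, 0 <= v i) ->
  TNN K -> TNN (fun i j => K i j * u i * v j).
Proof.
move=> u0 v0 HK f g sf sg.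
have -> : \matrix_(i < N, j < N) (K (f i) (g j) * u (f i) * v (g j)) =
  diag_mx (\row_i u (f i)) *m (\matrix_(i < N, j < N) K (f i) (g j))
    *m diag_mx (\row_i v (g i)).
  rewrite mul_diag_mx mul_mx_diag; apply/matrixP => i j; rewrite !mxE; ring.
by rewrite !det_mulmx !det_diag !mulr_ge0 ?HK //; apply: prodr_ge0 => i _;
  rewrite mxE.
Qed.

(** A minor of the identity is 1 if the row and column sets agree; otherwise it has a
    zero row. *)
Lemma det_delta_ge0 (f g : 'I_N -> nat) : strictly_decr N f -> strictly_decr N g ->
  0 <= \det (\matrix_(i < N, j < N) ((f i == g j)%:R : R)).
Proof.
move=> sf sg.
have [/existsP [i /forallP Hi]|] := boolP [exists i, forall j, f i != g j].
  rewrite (expand_det_row _ i) big1 // => j _.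
  by rewrite mxE (negbTE (Hi j)) mul0r.
rewrite negb_exists => /forallP H.
have fg : f =1 g.
  apply: strictly_decr_eq => // i; move: (H i); rewrite negb_forall => /existsP [j].
  by rewrite negbK => /eqP; exists j.
rewrite (_ : \matrix_(_, _) _ = 1%:M) ?det1 //.
by apply/matrixP => i j; rewrite !mxE -fg (inj_eq (strictly_decr_inj _ _ sf)).
Qed.

Lemma TNN_id : TNN (fun i j => (i == j)%:R).
Proof. by move=> f g; exact: det_delta_ge0. Qed.

(** Non-crossing: in the expansion of a minor, row i selects the column f i or
    f i - 1, and such choices are weakly decreasing in i.  Each of them contributes
    zero, if a value is repeated, or a nonnegative multiple of a minor of the
    identity. *)
Lemma TNN_lower_bidiag (d c : nat -> R) :
  (forall i, 0 <= d i) -> (forall i, 0 <= c i) ->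
  TNN (fun i j => d i * (i == j)%:R + c i * (i == j.+1)%:R).
Proof.
move=> d0 c0 f g sf sg.
pose K i j := d i * (i == j)%:R + c i * (i == j.+1)%:R.
rewrite -[X in 0 <= \det X]/(\matrix_(i < N, j < N) K (f i) (g j)).
pose n := (\max_(i < N) (f i)).+1.
have fn i : (f i < n)%N by rewrite ltnS; exact: (leq_bigmax i).
have -> : \matrix_(i < N, j < N) K (f i) (g j) =
   (\matrix_(i < N, k < n) K (f i) k) *m
   (\matrix_(k < n, j < N) ((k == g j :> nat)%:R)).
  apply/matrixP => i j; rewrite !mxE.
  have [gn|gn] := ltnP (g j) n.
    rewrite (bigD1 (Ordinal gn)) //= !mxE eqxx mulr1 big1 ?addr0 //.
    move=> k kg; rewrite !mxE -val_eqE /= in kg *.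
    by rewrite (negbTE kg) mulr0.
  rewrite big1 => [|k _]; last first.
    rewrite !mxE (_ : (k == g j :> nat) = false) ?mulr0 //.
    by apply/negbTE; rewrite neq_ltn (leq_trans (ltn_ord k) gn).
  have fg := leq_trans (fn i) gn.
  by rewrite /K !ltn_eqF ?mulr0 ?addr0 // ltnS ltnW.
rewrite det_mulmx_expand; apply: sumr_ge0 => h _.
have K0 i j : 0 <= K i j by rewrite /K addr_ge0 // mulr_ge0 // ler0n.
have [/existsP [i /eqP Hi]|] :=
    boolP [exists i, (\matrix_(i < N, k < n) K (f i) k) i (h i) == 0].
  by rewrite (bigD1 i) //= Hi !mul0r.
rewrite negb_exists => /forallP H.
apply: mulr_ge0; first by apply: prodr_ge0 => i _; rewrite mxE.
have hf i : (h i <= f i <= (h i).+1)%N.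
  move: (H i); rewrite mxE /K.
  have [->|_] := eqVneq (f i) (h i); first by rewrite leqnn leqnSn.
  have [->|_] := eqVneq (f i) (h i).+1; first by rewrite leqnSn leqnn.
  by rewrite !mulr0 addr0 eqxx.
have [hinj|hn] := boolP (injectiveb h); last by rewrite det_row_eq0.
rewrite (_ : \matrix_(_, _) _ = \matrix_(i, j) ((h i == g j :> nat)%:R)); last first.
  by apply/matrixP => i j; rewrite !mxE.
apply: det_delta_ge0 => //; apply/strictly_decrP => i j ij.
rewrite ltn_neqAle; apply/andP; split.
  rewrite val_eqE (inj_eq (injectiveP _ hinj)).
  by apply: contraTneq ij => ->; rewrite ltnn.
move/strictly_decrP: (sf) => /(_ i j ij).
by have := hf i; have := hf j; lia.
Qed.

Lemma TNN_upper_bidiag (d c : nat -> R) :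
  (forall i, 0 <= d i) -> (forall i, 0 <= c i) ->
  TNN (fun i j => d j * (j == i)%:R + c j * (j == i.+1)%:R).
Proof. by move=> d0 c0; apply: TNN_tr; exact: TNN_lower_bidiag. Qed.

(** Row i of a minor is the indicator of a final segment of columns, and these
    segments shrink as i grows.  Unless two of them coincide or one of them is
    empty, the minor is unitriangular. *)
Lemma TNN_triangle : TNN (fun i j => (j <= i)%N%:R).
Proof.
move=> f g sf sg.
set M := \matrix_(i, j) _.
have rowE i j : M i j = (g j <= f i)%N%:R by rewrite mxE.
have [/existsP [i /forallP Hi]|] := boolP [exists i, forall j, ~~ (g j <= f i)%N].
  rewrite (expand_det_row _ i) big1 // => j _.
  by rewrite rowE (negbTE (Hi j)) mul0r.
rewrite negb_exists => /forallP Hne.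
have [/existsP [i /existsP [j /andP [ij /forallP Hij]]]|] := boolP
    [exists i, exists j : 'I_N, (i != j) && [forall k, (g k <= f i)%N == (g k <= f j)%N]].
  rewrite (determinant_alternate ij) // => k.
  by rewrite !rowE (eqP (Hij k)).
rewrite negb_exists => /forallP Hneq.
pose r (i : 'I_N) := #|[set k | (g k <= f i)%N]%SET|.
have sub (i j : 'I_N) : (i <= j)%N ->
    [set k | (g k <= f j)%N]%SET \subset [set k | (g k <= f i)%N]%SET.
  move=> ij; apply/fintype.subsetP => k; rewrite !inE => /leq_trans; apply.
  by move: ij; rewrite leq_eqVlt => /orP [/eqP/val_inj ->//|/(strictly_decrP _ _ sf)/ltnW].
have rdec (i j : 'I_N) : (i < j)%N -> (r j < r i)%N.
  move=> ij; apply: proper_card; rewrite finset.properEneq sub ?(ltnW ij) // andbT.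
  move: (Hneq i); rewrite negb_exists => /forallP /(_ j).
  rewrite negb_and negbK => /orP [/eqP eij|].
    by move: ij; rewrite eij ltnn.
  rewrite negb_forall => /existsP [k]; apply: contraNneq => /finset.setP /(_ k).
  by rewrite !inE => ->.
have rE (i : 'I_N) : r i = (N - i)%N.
  have up m (i0 : 'I_N) : (m + i0 = N.-1)%N -> (m < r i0)%N.
    elim: m i0 => [|m IH] i0 mi.
      rewrite /r card_gt0; apply/finset.set0Pn; move: (Hne i0).
      by rewrite negb_forall => /existsP [k]; rewrite negbK => H; exists k; rewrite inE.
    have lt1 : (i0.+1 < N)%N by have := ltn_ord i0; lia.
    have := IH (Ordinal lt1); rewrite /= => /(_ ltac:(lia)) H1.
    by apply: (leq_ltn_trans H1); apply: rdec.
  have dn m (i0 : 'I_N) : i0 = m :> nat -> (r i0 <= N - m)%N.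
    elim: m i0 => [|m IH] i0 mi.
      by rewrite subn0 /r -[X in (_ <= X)%N]card_ord; exact: max_card.
    have lt1 : (m < N)%N by have := ltn_ord i0; lia.
    have := IH (Ordinal lt1) erefl.
    by have := rdec (Ordinal lt1) i0; rewrite /= mi ltnSn => /(_ isT); lia.
  by have := up (N.-1 - i)%N i; have := dn i i erefl; have := ltn_ord i; lia.
(* a set of N - i columns closed upwards consists of the last ones *)
have rowE' i j : (g j <= f i)%N = (i <= j)%N.
  have cl (j1 j2 : 'I_N) : (g j1 <= f i)%N -> (j1 <= j2)%N -> (g j2 <= f i)%N.
    move=> H12; rewrite leq_eqVlt => /orP [/eqP/val_inj <-//|/(strictly_decrP _ _ sg)/ltnW H].
    exact: leq_trans H H12.
  have cge (m : nat) : (m <= N)%N -> #|[set k : 'I_N | (m <= k)%N]%SET| = (N - m)%N.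
    move=> mN; rewrite -sum1_card.
    rewrite (eq_bigl (fun k : 'I_N => (m <= k)%N)); last by move=> k; rewrite inE.
    have := @big_geq_mkord nat 0%N addn m N xpredT (fun=> 1%N) => /= <-.
    by rewrite sum_nat_const_nat muln1.
  apply/idP/idP => H.
    have : [set k : 'I_N | (j <= k)%N]%SET \subset [set k | (g k <= f i)%N]%SET.
      by apply/fintype.subsetP => k; rewrite !inE; exact: cl.
    move=> /subset_leq_card; rewrite -/(r i) rE cge ?(ltnW (ltn_ord j)) //.
    by have := ltn_ord i; have := ltn_ord j; lia.
  rewrite leqNgt; apply/negP => Hn.
  have : [set k | (g k <= f i)%N]%SET \subset [set k : 'I_N | (j.+1 <= k)%N]%SET.
    apply/fintype.subsetP => k; rewrite !inE => Hk; rewrite ltnNge; apply/negP => kj.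
    by have := cl _ _ Hk kj; rewrite leqNgt Hn.
  move=> /subset_leq_card; rewrite -/(r i) rE cge //.
  by have := ltn_ord i; have := ltn_ord j; lia.
rewrite -det_tr det_trig.
  by apply: prodr_ge0 => i _; rewrite mxE rowE ler0n.
apply/is_trig_mxP => i j ij; rewrite mxE rowE rowE'.
by rewrite leqNgt ij.
Qed.

(** The entries of the inverse of a bidiagonal kernel have this form. *)
Lemma TNN_green (u v : nat -> R) : (forall i, 0 <= u i) -> (forall i, 0 <= v i) ->
  TNN (fun i j => (j <= i)%N%:R * u i * v j).
Proof. by move=> u0 v0; apply: TNN_scale => //; exact: TNN_triangle. Qed.

End TNN.


(** * Integration over a period *)

Section CircleIntegral.
Variable R : realType.
Implicit Types f g : R -> R.

(** A class of functions on the line that is integrable over a period, closed under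
    sums and products, and under bounded pointwise limits. *)
Definition bounded_meas f := measurable_fun [set: R] f /\ exists M, forall t, `|f t| <= M.

Definition I2pi f : R := Rintegral (@lebesgue_measure R) `[0, 2 * pi] f.

Lemma bounded_meas_cst (c : R) : bounded_meas (fun=> c).
Proof. by split; [exact: measurable_cst | exists `|c|]. Qed.

Lemma bounded_measD f g : bounded_meas f -> bounded_meas g -> bounded_meas (fun t => f t + g t).
Proof.
move=> [mf [M Mf]] [mg [M' Mg]]; split; first exact: measurable_funD.
by exists (M + M') => t; apply: (le_trans (ler_normD _ _)); exact: lerD.
Qed.

Lemma bounded_measM f g : bounded_meas f -> bounded_meas g -> bounded_meas (fun t => f t * g t).
Proof.
move=> [mf [M Mf]] [mg [M' Mg]]; split; first exact: measurable_funM.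
by exists (M * M') => t; rewrite normrM; exact: ler_pM.
Qed.

Lemma bounded_measN f : bounded_meas f -> bounded_meas (fun t => - f t).
Proof.
move=> [mf [M Mf]]; split; first exact: measurable_funN.
by exists M => t; rewrite normrN.
Qed.

Lemma bounded_meas_continuous f M : continuous f -> (forall t, `|f t| <= M) -> bounded_meas f.
Proof. by move=> cf Mf; split; [exact: continuous_measurable_fun|exists M]. Qed.

Lemma continuous_linmul (a : R) : continuous (fun t : R => a * t).
Proof. by move=> t; apply: cvgM; [exact: cvg_cst|exact: cvg_id]. Qed.

Lemma bounded_meas_cos (a : R) : bounded_meas (fun t => cos (a * t)).
Proof.
apply: (@bounded_meas_continuous _ 1) => [t|t]; last by rewrite ler_norml cos_geN1 cos_le1.
apply: (@continuous_comp _ _ _ (fun t => a * t) cos); first exact: continuous_linmul.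
exact: continuous_cos.
Qed.

Lemma bounded_meas_sin (a : R) : bounded_meas (fun t => sin (a * t)).
Proof.
apply: (@bounded_meas_continuous _ 1) => [t|t]; last by rewrite ler_norml sin_geN1 sin_le1.
apply: (@continuous_comp _ _ _ (fun t => a * t) sin); first exact: continuous_linmul.
exact: continuous_sin.
Qed.

Lemma mu2pi_lty : (@lebesgue_measure R `[0%R, (2 * pi)%R]%classic < +oo)%E.
Proof. by rewrite lebesgue_measure_itv /=; case: ifP => _; rewrite ltry. Qed.

Lemma bounded_meas_integrable f : bounded_meas f ->
  (@lebesgue_measure R).-integrable `[0, 2 * pi] (EFin \o f).
Proof.
move=> [mf [M Mf]]; apply: measurable_bounded_integrable => //.
- exact: mu2pi_lty.
- exact: measurable_funS mf.
- exists M; split; first exact: num_real.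
  by move=> x Mx t _ /=; apply: le_trans (Mf t) (ltW Mx).
Qed.

Lemma I2piD f g : bounded_meas f -> bounded_meas g -> I2pi (fun t => f t + g t) = I2pi f + I2pi g.
Proof. by move=> bf bg; apply: RintegralD => //; exact: bounded_meas_integrable. Qed.

Lemma I2piB f g : bounded_meas f -> bounded_meas g -> I2pi (fun t => f t - g t) = I2pi f - I2pi g.
Proof. by move=> bf bg; apply: RintegralB => //; exact: bounded_meas_integrable. Qed.

Lemma I2piZ (c : R) f : bounded_meas f -> I2pi (fun t => c * f t) = c * I2pi f.
Proof. by move=> bf; apply: RintegralZl => //; exact: bounded_meas_integrable. Qed.

Lemma eq_I2pi f g : f =1 g -> I2pi f = I2pi g.
Proof. by move=> fg; apply: eq_Rintegral => t _; exact: fg. Qed.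

Lemma pi2_gt0 : 0 < 2 * pi :> R.
Proof. by rewrite mulr_gt0 // pi_gt0. Qed.

Lemma I2pi_cst (c : R) : I2pi (fun=> c) = c * (2 * pi).
Proof.
rewrite /I2pi Rintegral_cst //; congr (_ * _).
have E : (@lebesgue_measure R `[0%R, (2 * pi)%R]%classic = (2 * pi)%:E)%E.
  by rewrite lebesgue_measure_itv /= lte_fin pi2_gt0 -EFinB subr0.
exact: (congr1 fine E).
Qed.

Lemma I2pi_bound f M : bounded_meas f -> (forall t, `|f t| <= M) -> `|I2pi f| <= M * (2 * pi).
Proof.
move=> bf Mf; apply: le_trans (le_normr_Rintegral _ _) _ => //.
  exact: bounded_meas_integrable.
rewrite -I2pi_cst; apply: le_Rintegral => //.
- have [mf _] := bf; apply: bounded_meas_integrable; split; first exact: measurableT_comp.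
  by exists M => t; rewrite normr_id.
- exact/bounded_meas_integrable/bounded_meas_cst.
Qed.

(** The limit is measurable because the approximations are, so that membership in the
    class is part of the conclusion. *)
Lemma I2pi_dominated (fn : nat -> R -> R) f M : (forall n, bounded_meas (fn n)) ->
  (forall n t, `|fn n t| <= M) -> (forall t, fn n t @[n --> \oo] --> f t) ->
  bounded_meas f /\ I2pi (fn n) @[n --> \oo] --> I2pi f.
Proof.
move=> bfn Mfn cfn.
have mf : measurable_fun [set: R] f.
  by apply: (@measurable_fun_cvg _ _ _ _ fn) => [m|x _]; [exact: (bfn m).1|exact: cfn].
have Mf t : `|f t| <= M.
  have C : `|fn n t| @[n --> \oo] --> `|f t| by apply: cvg_norm; exact: cfn.
  by apply: (cvgr_to_le C); apply: nearW => n; exact: Mfn.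
have bf : bounded_meas f by split => //; exists M.
split=> //.
have := @dominated_convergence _ _ R (@lebesgue_measure R) `[0, 2 * pi]%classic _
  (fun n t => (fn n t)%:E) (fun t => (f t)%:E) (fun=> M%:E).
case.
- exact: measurable_itv.
- move=> n; apply/measurable_EFinP; exact: measurable_funS (bfn n).1.
- by apply/measurable_EFinP; exact: measurable_funS mf.
- by apply: aeW => t _; apply: cvg_EFin; [exact: nearW|exact: cfn].
- exact/bounded_meas_integrable/bounded_meas_cst.
- by apply: aeW => t n _; rewrite abse_EFin lee_fin.
move=> _ _ C; rewrite /I2pi /Rintegral; apply: fine_cvg.
rewrite fineK; first exact: C.
by apply: integrable_fin_num => //; exact: bounded_meas_integrable.
Qed.

Lemma I2pi_FTC f (F : R -> R) : continuous f ->
  (forall t : R, is_derive t (1 : R) F (f t)) -> I2pi f = F (2 * pi) - F 0.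
Proof.
move=> cf dF.
have cF : continuous F.
  by move=> t; apply: differentiable_continuous; apply/derivable1_diffP;
     have [] := dF t.
rewrite /I2pi /Rintegral (@continuous_FTC2 _ f F) ?pi2_gt0 //.
- exact: continuous_subspaceT.
- split; first by move=> t _; have [] := dF t.
    by apply: cvg_at_right_filter; exact: cF.
  by apply: cvg_at_left_filter; exact: cF.
- by move=> t _; rewrite derive1E; have [_ ->] := dF t.
Qed.

Lemma cos_mulr_2pi n : cos (n%:R * (2 * pi)) = 1 :> R.
Proof.
rewrite (mulr_natl pi 2); elim: n => [|n IH]; first by rewrite mul0r cos0.
by rewrite -natr1 mulrDl mul1r cosD2pi.
Qed.

Lemma sin_mulr_2pi n : sin (n%:R * (2 * pi)) = 0 :> R.
Proof.
rewrite (mulr_natl pi 2); elim: n => [|n IH]; first by rewrite mul0r sin0.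
by rewrite -natr1 mulrDl mul1r sinD2pi.
Qed.

Lemma I2pi_cos n : I2pi (fun t => cos (n%:R * t)) = (n == 0%N)%:R * (2 * pi).
Proof.
case: n => [|n].
  by rewrite -[RHS]I2pi_cst; apply: eq_I2pi => t; rewrite mul0r cos0.
have dF (t : R) : is_derive t (1 : R) (fun t : R => n.+1%:R^-1 * sin (n.+1%:R * t))
    (cos (n.+1%:R * t)).
  apply: is_derive_eq.
  by rewrite /GRing.scale /= mulr1 mulrA mulrAC mulVf ?mul1r ?pnatr_eq0.
have cf : continuous (fun t : R => cos (n.+1%:R * t)).
  move=> t; exact: (continuous_comp (continuous_linmul _ t) (@continuous_cos R _)).
by rewrite (I2pi_FTC _ _ cf dF) sin_mulr_2pi !mulr0 sin0 mulr0 subrr mul0r.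
Qed.

Lemma I2pi_sin n : I2pi (fun t => sin (n%:R * t)) = 0.
Proof.
case: n => [|n].
  by rewrite -[RHS](mul0r (2 * pi)) -I2pi_cst; apply: eq_I2pi => t; rewrite mul0r sin0.
have dF (t : R) : is_derive t (1 : R) (fun t : R => - n.+1%:R^-1 * cos (n.+1%:R * t))
    (sin (n.+1%:R * t)).
  apply: is_derive_eq.
  rewrite /GRing.scale /=.
  by field; rewrite addrC natr1 pnatr_eq0.
have cf : continuous (fun t : R => sin (n.+1%:R * t)).
  move=> t; exact: (continuous_comp (continuous_linmul _ t) (@continuous_sin R _)).
by rewrite (I2pi_FTC _ _ cf dF) cos_mulr_2pi mulr0 cos0 subrr.
Qed.

End CircleIntegral.


(** * Multiplication and division by bidiagonal kernels *)

Section KernelSteps.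
Variables (R : realType) (N : nat).
Implicit Types K X Y : nat -> nat -> R.

Lemma sum_delta (u : nat -> R) n j : (j < n)%N ->
  \sum_(k < n) u k * (j == k)%:R = u j.
Proof.
move=> jn; rewrite (bigD1 (Ordinal jn)) //= eqxx mulr1 big1 ?addr0 //.
by move=> k; rewrite -val_eqE /= eq_sym => /negbTE ->; rewrite mulr0.
Qed.

Lemma TNN_mul_upper X (d c : nat -> R) :
  (forall i, 0 <= d i) -> (forall i, 0 <= c i) -> TNN R N X ->
  TNN R N (fun i j => d j * X i j + c j * (if j is j'.+1 then X i j' else 0)).
Proof.
move=> d0 c0 HX.
apply: (TNN_mul _ _ _ _ _ HX (TNN_upper_bidiag R N d c d0 c0)) => i j.
apply: cvg_near_cst; exists j.+1 => // n /= jn.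
under eq_bigr do rewrite mulrDr mulrCA [X in _ + X]mulrCA.
rewrite big_split /= -!mulr_sumr sum_delta //; congr (_ + _ * _).
case: j jn => [|j] jn; first by rewrite big1 // => k _; rewrite mulr0.
under eq_bigr do rewrite eqSS.
by rewrite sum_delta // ltnW.
Qed.

Lemma TNN_mul_lower X (d c : nat -> R) :
  (forall i, 0 <= d i) -> (forall i, 0 <= c i) -> TNN R N X ->
  TNN R N (fun i j => d j * X i j + c j.+1 * X i j.+1).
Proof.
move=> d0 c0 HX.
apply: (TNN_mul _ _ _ _ _ HX (TNN_lower_bidiag R N d c d0 c0)) => i j.
apply: cvg_near_cst; exists j.+2 => // n /= jn.
under eq_bigr => k _ do rewrite mulrDr !mulrA [X i k * d k]mulrC [X i k * c k]mulrC
   [(k : nat) == j]eq_sym [(k : nat) == j.+1]eq_sym.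
rewrite big_split /= (sum_delta (fun k => d k * X i k)) ?(ltnW jn) //.
by rewrite (sum_delta (fun k => c k * X i k)).
Qed.

Variables (d : nat -> R) (t : R).
Hypotheses (d_gt0 : forall i, 0 < d i) (t_gt0 : 0 < t).

(* The inverse of a bidiagonal kernel with diagonal d and off-diagonal -t has the
   entries gu i * gv j on one side of the diagonal, and 0 on the other. *)
Let gu i := t ^+ i / \prod_(k < i.+1) d k.
Let gv j := (\prod_(k < j) d k) / t ^+ j.

Let D_gt0 n : 0 < \prod_(k < n) d k.
Proof. by apply: prodr_gt0 => k _; exact: d_gt0. Qed.

Let gu_gt0 i : 0 < gu i.
Proof. by rewrite divr_gt0 // exprn_gt0. Qed.

Let gv_gt0 i : 0 < gv i.
Proof. by rewrite divr_gt0 // exprn_gt0. Qed.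

Let guv i : gu i * gv i = (d i)^-1.
Proof.
rewrite /gu /gv big_ord_recr /=; have := D_gt0 i; have := d_gt0 i.
have := exprn_gt0 i t_gt0 => *.
by field; rewrite !gt_eqF.
Qed.

Let guS i : gu i.+1 = gu i * (t / d i.+1).
Proof.
rewrite /gu exprS [X in _ / X = _]big_ord_recr /=.
have := D_gt0 i.+1; have := d_gt0 i.+1 => *.
by field; rewrite !gt_eqF.
Qed.

Let gvS i : gv i.+1 = gv i * (d i / t).
Proof.
rewrite /gv exprS big_ord_recr /=.
have := exprn_gt0 i t_gt0 => *.
by field; rewrite !gt_eqF.
Qed.

(** Forward substitution in a bidiagonal system expresses Y as X times a kernel whose
    entries are a triangular indicator scaled in rows and columns. *)
Lemma TNN_div_upper X Y : TNN R N X ->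
  (forall i j, d j * Y i j - t * (if j is j'.+1 then Y i j' else 0) = X i j) ->
  TNN R N Y.
Proof.
move=> HX HY.
have HG : TNN R N (fun i j => (i <= j)%N%:R * gu j * gv i).
  by apply: TNN_tr; apply: TNN_green => k; exact: ltW.
apply: (TNN_mul _ _ _ _ _ HX HG) => i j.
have gvE m : gv m = (d m)^-1 / gu m.
  by rewrite -guv mulrAC mulfV ?mul1r // gt_eqF.
have E m : \sum_(k < m.+1) X i k * gv k = Y i m / gu m.
  elim: m => [|m IH].
    rewrite big_ord1 gvE -HY mulr0 subr0.
    by have := d_gt0 0%N; have := gu_gt0 0 => *; field; rewrite !gt_eqF.
  rewrite big_ord_recr /= IH -HY gvE guS.
  have := d_gt0 m.+1; have := gu_gt0 m => *.
  by field; rewrite !gt_eqF.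
apply: cvg_near_cst; exists j.+1 => // n /= jn.
rewrite -(big_mkord xpredT (fun k => X i k * ((k <= j)%N%:R * gu j * gv k))).
rewrite (big_cat_nat (leq0n j.+1) jn) /= [X in _ + X]big_nat_cond [X in _ + X]big1 ?addr0; last first.
  by move=> k /andP [/andP [jk _] _]; rewrite leqNgt jk !mul0r mulr0.
rewrite big_mkord (eq_bigr (fun k : 'I_j.+1 => gu j * (X i k * gv k))); last first.
  by move=> k _; rewrite -ltnS ltn_ord mul1r mulrCA.
by rewrite -mulr_sumr E mulrCA mulfV ?mulr1 // gt_eqF.
Qed.

(** Solving the recursion upwards leaves the remainder Y i n * gv j / gv n.  It
    disappears because Y is bounded and gv grows geometrically, and Y is the limit of
    truncated products of X with a totally nonnegative kernel. *)
Lemma TNN_div_lower X Y (s M : R) : TNN R N X -> t < s -> (forall j, d j.+1 = s) ->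
  (forall i j, `|Y i j| <= M) ->
  (forall i j, d j * Y i j - t * Y i j.+1 = X i j) ->
  TNN R N Y.
Proof.
move=> HX ts ds YM HY.
have HG : TNN R N (fun i j => (j <= i)%N%:R * gu i * gv j).
  by apply: TNN_green => k; exact: ltW.
apply: (TNN_mul _ _ _ _ _ HX HG) => i j.
have E m : \sum_(k < j + m) X i k * ((j <= k)%N%:R * gu k * gv j) =
    Y i j - Y i (j + m)%N * (gv j / gv (j + m)%N).
  elim: m => [|m IH].
    rewrite addn0 mulfV ?gt_eqF // mulr1 subrr big1 // => k _.
    by rewrite leqNgt ltn_ord !mul0r mulr0.
  rewrite addnS big_ord_recr /= IH leq_addr mul1r -HY gvS.
  have -> : gu (j + m)%N = (d (j + m)%N)^-1 / gv (j + m)%N.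
    by rewrite -guv mulfK // gt_eqF.
  have := d_gt0 (j + m)%N; have := gv_gt0 (j + m)%N => *.
  by field; rewrite !gt_eqF.
have gvn m : gv m.+1 = gv 1 * (s / t) ^+ m.
  elim: m => [|m IH]; first by rewrite mulr1.
  by rewrite [LHS]gvS IH ds exprSr -mulrA.
rewrite -(cvg_shiftn j.+1) /=.
have -> : (fun n => \sum_(k < n + j.+1) X i k * ((j <= k)%N%:R * gu k * gv j)) =
    (fun n => Y i j - Y i (j + n.+1)%N * (gv j / (gv 1 * (s / t) ^+ j)) * (t / s) ^+ n).
  apply/funext => n; rewrite addnS -addSn addnC E.
  rewrite addnS gvn exprD.
  rewrite -[t / s]invf_div exprVn.
  have st0 : 0 < s / t by rewrite divr_gt0 // (lt_trans t_gt0).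
  have := exprn_gt0 j st0; have := exprn_gt0 n st0; have := gv_gt0 1 => *.
  by field; rewrite !gt_eqF.
rewrite -{2}[Y i j]subr0; apply: cvgB; first exact: cvg_cst.
pose C := M * `|gv j / (gv 1 * (s / t) ^+ j)|.
have s0 : 0 < s by exact: lt_trans ts.
have C0 : (fun n => C * (t / s) ^+ n) @ \oo --> (0 : R).
  rewrite -[0](mulr0 C); apply: cvgM; first exact: cvg_cst.
  by apply: cvg_expr; rewrite ger0_norm ?divr_ge0 ?ltW // ltr_pdivrMr // mul1r.
apply/norm_cvg0P; apply: (squeeze_cvgr _ (cvg_cst 0) C0); apply: nearW => n.
have q0 : 0 <= (t / s) ^+ n by rewrite exprn_ge0 ?divr_ge0 ?ltW.
rewrite normr_ge0 /= normrM normrM (ger0_norm q0).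
by apply: ler_wpM2r => //; apply: ler_wpM2r.
Qed.

End KernelSteps.


(** * Multiplication operators in a system of sines *)

Section SineKernel.
Variables (R : realType) (X : lie_series).
Implicit Types (F G : R -> R) (k l : nat).

Let e : R := eps R X.

(** The sequence of sines, continued to the position -1, takes there the value of the
    position 0 with the factor - [wall_weight], since eps - 1 is - 1 / 2 or 0. *)
Definition wall_weight : R := match X with SeriesB => 1 | SeriesC => 0 end.

Definition reflect_pred (K : nat -> R) l : R := if l is l'.+1 then K l' else - wall_weight * K 0%N.

Definition sine_mode k (t : R) : R := sin ((k%:R + e) * t).

(** The matrix elements of multiplication by F (cos t): the system of sines is
    orthonormal for the measure dt / pi on a period ([sine_kernel_one]). *)
Definition sine_kernel F k l : R := pi^-1 * I2pi R (fun t => F (cos t) * (sine_mode k t * sine_mode l t)).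

Definition bounded_at_cos F := bounded_meas R (fun t => F (cos t)).

Lemma bounded_meas_sine_mode2 k l : bounded_meas R (fun t => sine_mode k t * sine_mode l t).
Proof. by apply: bounded_measM; exact: bounded_meas_sin. Qed.

Lemma bounded_meas_sine_kernel F k l : bounded_at_cos F -> bounded_meas R (fun t => F (cos t) *
    (sine_mode k t * sine_mode l t)).
Proof. by move=> bf; apply: bounded_measM => //; exact: bounded_meas_sine_mode2. Qed.

Lemma sine_mode2_le1 k l t : `|sine_mode k t * sine_mode l t| <= 1.
Proof.
by rewrite normrM mulr_ile1 // ler_norml sin_geN1 sin_le1.
Qed.

Lemma sine_kernel_bound F M k l : bounded_at_cos F -> (forall t, `|F (cos t)| <= M) -> `|sine_kernel F k l| <= 2 * M.
Proof.
move=> bf FM; rewrite /sine_kernel normrM ger0_norm ?invr_ge0 ?pi_ge0 //.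
rewrite mulrC ler_pdivrMr ?pi_gt0 //.
have -> : 2 * M * pi = M * (2 * pi) by ring.
apply: I2pi_bound; first exact: bounded_meas_sine_kernel.
move=> t; rewrite normrM -[M]mulr1; apply: ler_pM => //; exact: sine_mode2_le1.
Qed.

Lemma eq_sine_kernel F G : (forall t, F (cos t) = G (cos t)) -> sine_kernel F = sine_kernel G.
Proof.
move=> FG; apply/funext => k; apply/funext => l; congr (_ * _).
by apply: eq_I2pi => t; rewrite FG.
Qed.

Lemma sine_kernel_linear (a b : R) F G k l : bounded_at_cos F -> bounded_at_cos G ->
  sine_kernel (fun x => a * F x + b * G x) k l = a * sine_kernel F k l + b * sine_kernel G k l.
Proof.
move=> bf bg; rewrite /sine_kernel.
rewrite (eq_I2pi _ _ (fun t => a * (F (cos t) * (sine_mode k t * sine_mode l t)) +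
   b * (G (cos t) * (sine_mode k t * sine_mode l t)))); last by move=> t; ring.
rewrite I2piD ?I2piZ; try exact: bounded_meas_sine_kernel.
- by ring.
- by apply: bounded_measM; [exact: bounded_meas_cst|exact: bounded_meas_sine_kernel].
- by apply: bounded_measM; [exact: bounded_meas_cst|exact: bounded_meas_sine_kernel].
Qed.

Lemma bounded_at_cos_cst c : bounded_at_cos (fun=> c).
Proof. exact: bounded_meas_cst. Qed.

Lemma bounded_at_cos_id : bounded_at_cos (fun x => x).
Proof.
have := bounded_meas_cos R 1; rewrite /bounded_at_cos.
by under [X in bounded_meas _ X -> _]eq_fun do rewrite mul1r.
Qed.

Lemma bounded_at_cosM F G : bounded_at_cos F -> bounded_at_cos G -> bounded_at_cos (fun x => F x * G x).
Proof. exact: bounded_measM. Qed.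

Lemma bounded_at_cosD F G : bounded_at_cos F -> bounded_at_cos G -> bounded_at_cos (fun x => F x + G x).
Proof. exact: bounded_measD. Qed.

(** The addition formula sin (u + t) + sin (u - t) = 2 sin u cos t; for l = 0 the second
    sine is reflected at the wall. *)
Lemma cos_sine_mode l t : cos t * sine_mode l t = (sine_mode l.+1 t + reflect_pred (sine_mode^~ t) l) / 2.
Proof.
have Sl (a : R) : sin (a + t) + sin (a - t) = 2 * (cos t * sin a).
  by rewrite sinD sinB; ring.
have -> : sine_mode l.+1 t = sin ((l%:R + e) * t + t).
  by rewrite /sine_mode -natr1; congr sin; ring.
have -> : reflect_pred (sine_mode^~ t) l = sin ((l%:R + e) * t - t).
  case: l => [|l] /=; last by rewrite /sine_mode -natr1; congr sin; ring.
  rewrite /sine_mode /wall_weight /e /eps; case: X.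
    rewrite mulN1r -sinN; congr sin; lra.
  by rewrite oppr0 mul0r -[LHS]sin0; congr sin; ring.
by rewrite Sl /sine_mode mulrAC divff ?mul1r // pnatr_eq0.
Qed.

Lemma sine_kernel_mulx F k l : bounded_at_cos F ->
  sine_kernel (fun x => x * F x) k l = (sine_kernel F k l.+1 + reflect_pred (sine_kernel F k) l) / 2.
Proof.
move=> bf.
have E c j1 j2 : sine_kernel (fun x => x * F x) k l =
   pi^-1 * I2pi R (fun t => F (cos t) * (sine_mode k t * sine_mode j1 t) / 2
     + c * (F (cos t) * (sine_mode k t * sine_mode j2 t)) / 2) ->
   sine_kernel (fun x => x * F x) k l = (sine_kernel F k j1 + c * sine_kernel F k j2) / 2.
  move=> ->; rewrite /sine_kernel.
  rewrite (eq_I2pi _ _ (fun t => 2^-1 * (F (cos t) * (sine_mode k t * sine_mode j1 t)) +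
     c / 2 * (F (cos t) * (sine_mode k t * sine_mode j2 t)))); last by move=> t; ring.
  rewrite I2piD ?I2piZ; try exact: bounded_meas_sine_kernel.
  - by ring.
  - by apply: bounded_measM; [exact: bounded_meas_cst|exact: bounded_meas_sine_kernel].
  - by apply: bounded_measM; [exact: bounded_meas_cst|exact: bounded_meas_sine_kernel].
have C t : cos t * F (cos t) * (sine_mode k t * sine_mode l t) =
    F (cos t) * (sine_mode k t * ((sine_mode l.+1 t + reflect_pred (sine_mode^~ t) l) / 2)).
  by rewrite -cos_sine_mode; ring.
case: l E C => [|l] E C /=.
  apply: E; congr (_ * _); apply: eq_I2pi => t; rewrite C /=; ring.
rewrite -[sine_kernel F k l]mul1r.
apply: E; congr (_ * _); apply: eq_I2pi => t; rewrite C /=; ring.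
Qed.

Lemma sine_kernel_one k l : sine_kernel (fun=> 1) k l = (k == l)%:R.
Proof.
(* Twice eps is an integer, so the cosines below have integer frequencies. *)
have [c ce c0] : exists2 c, e + e = c%:R & (0 < c)%N.
  by rewrite /e /eps; case: X; [exists 1%N; rewrite //; lra|exists 2%N; rewrite //; ring].
wlog kl : k l / (k <= l)%N.
  move=> W; case: (leqP k l) => [/W //|/ltnW lk].
  by rewrite eq_sym -(W _ _ lk) /sine_kernel; congr (_ * _); apply: eq_I2pi => t; ring.
rewrite /sine_kernel.
rewrite (eq_I2pi _ _ (fun t => 2^-1 * cos ((l - k)%:R * t) -
   2^-1 * cos ((k + l + c)%:R * t))); last first.
  move=> t; rewrite natrB // !natrD -ce mulrBl !mulrDl /sine_mode !mulrDl.
  rewrite (_ : l%:R * t - k%:R * t = (l%:R * t + e * t) - (k%:R * t + e * t)); last by ring.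
  rewrite (_ : _ + (e * t + e * t) = (l%:R * t + e * t) + (k%:R * t + e * t)); last by ring.
  rewrite cosB [cos (_ + _ + _)]cosD; by field.
rewrite I2piB ?I2piZ; try exact: bounded_meas_cos.
- rewrite !I2pi_cos (_ : (k + l + c == 0)%N = false) ?mul0r ?mulr0 ?subr0; last by lia.
  rewrite (_ : (l - k == 0)%N = (k == l)); last by lia.
  have := pi_gt0 R => p0.
  by case: eqP => _ /=; rewrite ?mul0r ?mulr0 // mulr1n mul1r mulKf ?pnatr_eq0 // mulVf ?gt_eqF.
- by apply: bounded_measM; [exact: bounded_meas_cst|exact: bounded_meas_cos].
- by apply: bounded_measM; [exact: bounded_meas_cst|exact: bounded_meas_cos].
Qed.

Lemma sine_kernel_linfactor F (b : R) k l : bounded_at_cos F ->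
  sine_kernel (fun x => F x * (1 + b * (x - 1))) k l =
  (1 - b) * sine_kernel F k l + b / 2 * (sine_kernel F k l.+1 + reflect_pred (sine_kernel F k) l).
Proof.
move=> bf.
rewrite (eq_sine_kernel _ (fun x => (1 - b) * F x + b * (x * F x))); last by move=> t; ring.
rewrite sine_kernel_linear // ?sine_kernel_mulx //; last exact: bounded_at_cosM bounded_at_cos_id bf.
by rewrite mulrA mulrAC.
Qed.

Lemma sine_kernel_dominated (Fn : nat -> R -> R) F M : (forall n, bounded_at_cos (Fn n)) ->
  (forall n t, `|Fn n (cos t)| <= M) ->
  (forall t, Fn n (cos t) @[n --> \oo] --> F (cos t)) ->
  bounded_at_cos F /\ forall k l, sine_kernel (Fn n) k l @[n --> \oo] --> sine_kernel F k l.
Proof.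
move=> bFn FM cF.
have [bf _] := I2pi_dominated R _ _ M bFn FM cF.
split => // k l; apply: cvgM; first exact: cvg_cst.
apply: (I2pi_dominated R _ _ M _ _ _).2.
- by move=> n; exact: bounded_meas_sine_kernel.
- move=> n t; rewrite normrM -[M]mulr1; apply: ler_pM => //; exact: sine_mode2_le1.
- by move=> t; apply: cvgM; [exact: cF|exact: cvg_cst].
Qed.

Variable N : nat.

Lemma wall_weight01 : 0 <= wall_weight <= 1.
Proof. by rewrite /wall_weight; case: X; rewrite ?lexx ?ler01. Qed.

(** With s = 1 - beta / 2 and t = beta / 2 the factor is (s + t z) (s + t / z) in
    terms of x = (z + 1 / z) / 2.  The matching product of bidiagonal kernels has
    diagonal s and off-diagonal t, except that the square of its corner entry is
    s ^ 2 - wall_weight s t, which absorbs the reflection at the wall. *)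
Lemma TNN_beta_factor F (beta : R) : bounded_at_cos F -> 0 <= beta <= 1 -> TNN R N (sine_kernel F) ->
  TNN R N (sine_kernel (fun x => F x * (1 + beta * (1 - beta / 2) * (x - 1)))).
Proof.
move=> bf /andP [b0 b1] HT.
pose s := 1 - beta / 2; pose t := beta / 2.
have /andP [k0 k1] := wall_weight01.
have t0 : 0 <= t by rewrite /t; lra.
have ts : t <= s by rewrite /t /s; lra.
have sp : 0 <= s by lra.
have s0 : 0 <= s ^+ 2 - wall_weight * (s * t).
  rewrite subr_ge0; apply: (le_trans (y := s * t)).
    by apply: ler_piMl => //; exact: mulr_ge0.
  by rewrite expr2; exact: ler_wpM2l.
pose d j : R := if j is j'.+1 then s else Num.sqrt (s ^+ 2 - wall_weight * (s * t)).
have d0 i : 0 <= d i by case: i => [|i] /=; [exact: sqrtr_ge0|lra].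
have H1 := TNN_mul_upper R N _ d (fun=> t) d0 (fun=> t0) HT.
have H2 := TNN_mul_lower R N _ d (fun=> t) d0 (fun=> t0) H1.
move: H2; congr (TNN _ _ _).
apply/funext => i; apply/funext => j; rewrite sine_kernel_linfactor //.
have sq : d 0 * d 0 = s ^+ 2 - wall_weight * (s * t) by rewrite -expr2 sqr_sqrtr.
case: j => [|[|j]] /=.
- rewrite mulr0 addr0 mulrDr addrA mulrA -/(d 0) sq /s /t; by field.
- rewrite /s /t; by field.
- rewrite /s /t; by field.
Qed.

(** With s = 1 + alpha / 2 and t = alpha / 2 the factor in the denominator is
    (s - t z) (s - t / z).  So the kernel of F comes from the kernel of
    F / (1 - a (x - 1)) by two bidiagonal kernels with nonpositive off-diagonal
    entries, and dividing by them one after the other preserves total nonnegativity. *)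
Lemma TNN_alpha_factor F (alpha : R) (M : R) : 0 <= alpha ->
  bounded_at_cos (fun x => F x / (1 - alpha * (1 + alpha / 2) * (x - 1))) ->
  (forall t, `|F (cos t) / (1 - alpha * (1 + alpha / 2) * (cos t - 1))| <= M) ->
  TNN R N (sine_kernel F) ->
  TNN R N (sine_kernel (fun x => F x / (1 - alpha * (1 + alpha / 2) * (x - 1)))).
Proof.
move=> a0 bG GM HT; set G := fun x => _ in bG GM *.
have [a00|an0] := eqVneq alpha 0.
  by rewrite (eq_sine_kernel _ F) // => u; rewrite /G a00 !mul0r subr0 divr1.
have {an0}a0 : 0 < alpha by rewrite lt_def an0.
pose s := 1 + alpha / 2; pose t := alpha / 2.
have /andP [k0 k1] := wall_weight01.
have t0 : 0 < t by rewrite /t; lra.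
have ts : t < s by rewrite /t /s; lra.
have sp : 0 < s by lra.
have s0 : 0 < s ^+ 2 + wall_weight * (s * t).
  by rewrite ltr_pwDl ?exprn_gt0 // mulr_ge0 // mulr_ge0 // ltW.
pose d j : R := if j is j'.+1 then s else Num.sqrt (s ^+ 2 + wall_weight * (s * t)).
have d0 i : 0 < d i by case: i => [|i] /=; [rewrite sqrtr_gt0|lra].
have sq : d 0 * d 0 = s ^+ 2 + wall_weight * (s * t) by rewrite -expr2 sqr_sqrtr // ltW.
have FE i j : sine_kernel F i j = (1 + alpha * s) * sine_kernel G i j
    - alpha * s / 2 * (sine_kernel G i j.+1 + reflect_pred (sine_kernel G i) j).
  rewrite (eq_sine_kernel F (fun x => G x * (1 + (- (alpha * s)) * (x - 1)))); last first.
    move=> u; rewrite /G /s; field.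
    have := cos_le1 u => c1; rewrite gt_eqF //; nra.
  by rewrite sine_kernel_linfactor //; ring.
pose B i j := d j * sine_kernel G i j - t * (if j is j'.+1 then sine_kernel G i j' else 0).
have MT i j := sine_kernel_bound G M i j bG GM.
have M0 : 0 <= M by exact: le_trans (normr_ge0 _) (GM 0).
have HB : TNN R N B.
  apply: (TNN_div_lower R N d t d0 t0 (sine_kernel F) B s ((d 0 + s + t) * (2 * M))) => //.
    move=> i j; rewrite /B; apply: (le_trans (ler_normB _ _)).
    rewrite normrM [`|t * _|]normrM (gtr0_norm (d0 j)) (gtr0_norm t0) mulrDl; apply: lerD.
      apply: ler_pM => //; first exact: ltW.
      have := d0 0%N; case: j => [|j] /= *; lra.
    apply: ler_pM => //; first exact: ltW.
    by case: j => [|j] //; rewrite normr0 mulr_ge0.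
  move=> i j; rewrite FE /B.
  case: j => [|j] /=.
    rewrite mulr0 subr0 mulrA -/(d 0) sq /s /t; by field.
  rewrite /s /t; by field.
exact: (TNN_div_upper R N d t d0 t0 B _ HB).
Qed.

End SineKernel.


Local Notation nc := (@Normc.normc _).

(** * Limits of complex sequences, products and exponentials *)

Section ComplexLimits.
Variable R : realType.
Implicit Types (x y z : R[i]) (u : nat -> R[i]).

Lemma ncE z : (nc z)%:C = `|z|.
Proof. by case: z. Qed.

Lemma nc_ge0 z : 0 <= nc z.
Proof. by rewrite -ler0c ncE normr_ge0. Qed.

Lemma ncM x y : nc (x * y) = nc x * nc y.
Proof. exact: Normc.normcM. Qed.

Lemma ncV x : nc x^-1 = (nc x)^-1.
Proof. exact: Normc.normcV. Qed.

Lemma ncD x y : nc (x + y) <= nc x + nc y.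
Proof. exact: le_normcD. Qed.

Lemma ncN x : nc (- x) = nc x.
Proof. exact: normcN. Qed.

Lemma ncB x y : nc (x - y) <= nc x + nc y.
Proof. by rewrite -(ncN y); exact: ncD. Qed.

Lemma nc1 : nc (1 : R[i]) = 1.
Proof. exact: Normc.normc1. Qed.

Lemma nc0 : nc (0 : R[i]) = 0.
Proof. exact: Normc.normc0. Qed.

Lemma ncR (a : R) : nc (a%:C) = `|a|.
Proof. by rewrite /= expr0n /= addr0 sqrtr_sqr. Qed.

Lemma ncX x n : nc (x ^+ n) = nc x ^+ n.
Proof. by elim: n => [|n IH]; rewrite ?nc1 // !exprS ncM IH. Qed.

Lemma nc_eq0 x : (nc x == 0) = (x == 0).
Proof.
by apply/eqP/eqP => [/Normc.eq0_normc//|->]; exact: nc0.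
Qed.

Lemma nc_prod I (r : seq I) (P : pred I) (F : I -> R[i]) :
  nc (\prod_(i <- r | P i) F i) = \prod_(i <- r | P i) nc (F i).
Proof. by apply: (big_morph _ ncM nc1). Qed.

Lemma nc_sum I (r : seq I) (P : pred I) (F : I -> R[i]) :
  nc (\sum_(i <- r | P i) F i) <= \sum_(i <- r | P i) nc (F i).
Proof.
elim/big_rec2: _ => [|i y1 y2 _ H]; first by rewrite nc0.
by apply: (le_trans (ncD _ _)); rewrite lerD2l.
Qed.

Lemma realC_mul (a b : R) : (a * b)%:C = a%:C * b%:C :> R[i].
Proof. exact: rmorphM. Qed.

Lemma realC_inv (a : R) : (a^-1)%:C = (a%:C)^-1 :> R[i].
Proof. exact: fmorphV. Qed.

Lemma cReD x y : complex.Re (x + y) = complex.Re x + complex.Re y.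
Proof. by case: x; case: y. Qed.
Lemma cImD x y : complex.Im (x + y) = complex.Im x + complex.Im y.
Proof. by case: x; case: y. Qed.
Lemma cReN x : complex.Re (- x) = - complex.Re x.
Proof. by case: x. Qed.
Lemma cImN x : complex.Im (- x) = - complex.Im x.
Proof. by case: x. Qed.
Lemma cReM x y : complex.Re (x * y) =
  complex.Re x * complex.Re y - complex.Im x * complex.Im y.
Proof. by case: x; case: y. Qed.
Lemma cImM x y : complex.Im (x * y) =
  complex.Re x * complex.Im y + complex.Im x * complex.Re y.
Proof. by case: x; case: y. Qed.

Lemma ReIm_eq x y : complex.Re x = complex.Re y -> complex.Im x = complex.Im y -> x = y.
Proof. by case: x => a b; case: y => c d /= -> ->. Qed.

Lemma Re_le_nc z : `|complex.Re z| <= nc z.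
Proof. by rewrite -lecR ncE; exact: normc_ge_Re. Qed.

Lemma Im_le_nc z : `|complex.Im z| <= nc z.
Proof.
case: z => a b /=; rewrite -[leLHS]sqrtr_sqr ler_sqrt ?addr_ge0 ?sqr_ge0 //.
by rewrite lerDr sqr_ge0.
Qed.

Lemma nc_le_ReIm z : nc z <= `|complex.Re z| + `|complex.Im z|.
Proof.
case: z => a b /=.
rewrite -[leRHS](@ger0_norm _ (`|a| + `|b|)) ?addr_ge0 // -sqrtr_sqr.
rewrite ler_sqrt ?sqr_ge0 // sqrrD !real_normK ?num_real // -addrA.
by rewrite lerD2l addrC lerDl mulrn_wge0 // mulr_ge0.
Qed.

Lemma cvg_dist0 (v : nat -> R) (l : R) :
  `|v n - l| @[n --> \oo] --> (0 : R) -> v @ \oo --> l.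
Proof. by move=> /norm_cvg0P H; apply/subr_cvg0. Qed.

(** Reduces convergence in the complex field, where distances are complex numbers,
    to convergence of a real sequence. *)
Lemma cvgC_nc u (l : R[i]) :
  ((u : nat -> Cplx R) @ \oo --> (l : Cplx R)) <->
  (nc (u n - l) @[n --> \oo] --> (0 : R)).
Proof.
split=> [/cvgrPdist_lt H|/cvgr0Pnorm_lt H].
  apply/cvgr0Pnorm_lt => e e0.
  have e0C : (0 : Cplx R) < e%:C by rewrite ltcR.
  apply: filterS (H _ e0C) => n /=.
  rewrite -[l - u n]opprB normrN (_ : `|u n - l| = (nc (u n - l))%:C); last by rewrite ncE.
  by rewrite ltcR ger0_norm // nc_ge0.
apply/cvgrPdist_lt => -[e e'] /=; rewrite ltcE /= => /andP [/eqP -> e0].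
apply: filterS (H _ e0) => n /=.
rewrite -[l - u n]opprB normrN (_ : `|u n - l| = (nc (u n - l))%:C); last by rewrite ncE.
by rewrite -[e +i* 0]/(e%:C) ltcR ger0_norm // nc_ge0.
Qed.

Lemma cvgC_ReIm u (l : R[i]) :
  ((u : nat -> Cplx R) @ \oo --> (l : Cplx R)) <->
  (complex.Re (u n) @[n --> \oo] --> complex.Re l) /\
  (complex.Im (u n) @[n --> \oo] --> complex.Im l).
Proof.
rewrite cvgC_nc; split=> [H|[H1 H2]].
  by split; apply: cvg_dist0; apply: (squeeze_cvgr _ (cvg_cst 0) H); apply: nearW => n;
    rewrite normr_ge0 /=; [rewrite -cReN -cReD|rewrite -cImN -cImD];
    [exact: Re_le_nc|exact: Im_le_nc].
have H : `|complex.Re (u n) - complex.Re l| + `|complex.Im (u n) - complex.Im l|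
   @[n --> \oo] --> (0 : R).
  rewrite -[0]addr0; apply: cvgD; apply/norm_cvg0P.
    by rewrite -(subrr (complex.Re l)); apply: cvgB => //; exact: cvg_cst.
  by rewrite -(subrr (complex.Im l)); apply: cvgB => //; exact: cvg_cst.
apply: (squeeze_cvgr _ (cvg_cst 0) H); apply: nearW => n.
rewrite nc_ge0 /= -cReN -cReD -cImN -cImD; exact: nc_le_ReIm.
Qed.

Lemma cvgC_bounded u (l : R[i]) : ((u : nat -> Cplx R) @ \oo --> (l : Cplx R)) ->
  exists M, forall n, nc (u n) <= M.
Proof.
move=> /cvgC_nc H.
have /cvg_seq_bounded [M [_ HM]] : cvgn (fun n => nc (u n - l)) by apply/cvg_ex; exists 0.
exists (M + 1 + nc l) => n.
rewrite -[u n](subrK l); apply: (le_trans (ncD _ _)); rewrite lerD2r.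
apply: le_trans (HM (M + 1) _ n I); first exact: ler_norm.
by rewrite ltrDl.
Qed.

(** Comparison with exp of the sum of the v i bounds the partial products; their
    increments are then absolutely summable, and so are the real and imaginary parts. *)
Lemma cvgC_prod u (v : nat -> R) : (forall i, nc (u i) <= v i) -> cvgn (series v) ->
  exists l : Cplx R, ((fun n => \prod_(i < n) (1 + u i)) : nat -> Cplx R) @ \oo --> l.
Proof.
move=> uv cv.
have v0 i : 0 <= v i by exact: le_trans (nc_ge0 _) (uv i).
pose P n : R[i] := \prod_(i < n) (1 + u i).
pose V := limn (series v).
have sV n : series v n <= V.
  apply: nondecreasing_cvgn_le => //; apply: nondecreasing_series => i _ _; exact: v0.
have PM n : nc (P n) <= expR V.
  apply: (@le_trans _ _ (expR (series v n))); last by rewrite ler_expR.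
  rewrite /P nc_prod /series /= big_mkord expR_sum.
  apply: ler_prod => i _; rewrite nc_ge0 /=.
  apply: (le_trans (ncD _ _)); rewrite nc1; apply: le_trans (expR_ge1Dx _).
  by rewrite lerD2l.
have dP n : nc (P n.+1 - P n) <= expR V * v n.
  rewrite /P big_ord_recr /= mulrDr mulr1 addrAC subrr add0r ncM.
  by apply: ler_pM; rewrite ?nc_ge0 //; exact: PM.
have cvgP (f : R[i] -> R) : (forall x y, f (x - y) = f x - f y) ->
    (forall x, `|f x| <= nc x) -> cvgn (fun n => f (P n)).
  move=> fB fnc.
  have -> : (fun n => f (P n)) = (fun n => f (P 0%N) + series (fun n => f (P n.+1) - f (P n)) n).
    by apply/funext => n; rewrite /series /= telescope_sumr // addrC subrK.
  apply: is_cvgD; first exact: is_cvg_cst.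
  apply: normed_cvg; apply: (series_le_cvg (v_ := fun n => expR V * v n)).
  - by move=> n /=.
  - by move=> n; rewrite mulr_ge0 // expR_ge0.
  - by move=> n /=; rewrite -fB; exact: le_trans (fnc _) (dP n).
  - exact: is_cvg_seriesZ.
exists (limn (fun n => complex.Re (P n)) +i* limn (fun n => complex.Im (P n))).
apply/cvgC_ReIm; split.
- by apply: (cvgP (@complex.Re R)) => [x y|x]; [rewrite cReD cReN|exact: Re_le_nc].
- by apply: (cvgP (@complex.Im R)) => [x y|x]; [rewrite cImD cImN|exact: Im_le_nc].
Qed.

Lemma cisD (a b : R) : cis (a + b) = cis a * cis b.
Proof. by rewrite /cis cosD sinD; apply: ReIm_eq => //=; rewrite addrC; ring. Qed.

Lemma nc_cis (a : R) : nc (cis a) = 1.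
Proof. by rewrite /= cos2Dsin2 sqrtr1. Qed.

Lemma cexpD x y : cexp (x + y) = cexp x * cexp y.
Proof. by rewrite /cexp cReD cImD expRD cisD rmorphM /=; ring. Qed.

Lemma cexp0 : cexp (0 : R[i]) = 1.
Proof. by rewrite /cexp /= expR0 /cis cos0 sin0 mul1r. Qed.

Lemma nc_cexp z : nc (cexp z) <= expR (nc z).
Proof.
rewrite /cexp ncM nc_cis mulr1 ncR ger0_norm ?expR_ge0 // ler_expR.
exact: le_trans (ler_norm _) (Re_le_nc z).
Qed.

Lemma cexpX z n : cexp (n%:R * z) = cexp z ^+ n.
Proof.
elim: n => [|n IH]; first by rewrite mul0r cexp0.
by rewrite -natr1 mulrDl mul1r cexpD IH exprSr.
Qed.

(** Telescoping of x ^ n - y ^ n. *)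
Lemma nc_subX x y (M : R) n : 1 <= M -> nc x <= M -> nc y <= M ->
  nc (x ^+ n - y ^+ n) <= n%:R * M ^+ n * nc (x - y).
Proof.
move=> M1 xM yM; have M0 : 0 <= M by exact: le_trans M1.
elim: n => [|n IH]; first by rewrite subrr nc0 !mul0r.
have -> : x ^+ n.+1 - y ^+ n.+1 = x * (x ^+ n - y ^+ n) + (x - y) * y ^+ n.
  by rewrite !exprS; ring.
apply: (le_trans (ncD _ _)); rewrite !ncM -natr1.
rewrite -mulrA mulrDl mul1r; apply: lerD.
  rewrite exprS -mulrA mulrCA; apply: ler_pM; rewrite ?nc_ge0 //.
  by rewrite mulrA.
rewrite mulrC; apply: ler_wpM2r; first exact: nc_ge0.
rewrite ncX; apply: (@le_trans _ _ (M ^+ n)); first by apply: lerXn2r; rewrite ?nnegrE ?nc_ge0.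
by apply: ler_weXn2l.
Qed.

Lemma derive_scaled_limit (g : R -> R) (d : R) : is_derive (0 : R) (1 : R) g d ->
  (n.+1%:R * (g n.+1%:R^-1 - g 0)) @[n --> \oo] --> d.
Proof.
move=> [/cvg_ex [l Hl] dE].
have {dE}ld : l = d by rewrite -dE; apply/esym/cvg_lim.
rewrite -ld.
have H : (fun n => n.+1%:R^-1 : R) @ \oo --> (0 : R)^'.
  move=> A [e e0 HA].
  have H0 := @cvg_harmonic R.
  apply: (@filterS nat \oo _ _ _ _ (H0 _ (nbhsx_ballx 0 e e0))) => n Hn; apply: HA => //.
have := cvg_comp _ _ H Hl.
apply: cvg_trans; apply: near_eq_cvg; apply: nearW => n /=.
by rewrite invrK /GRing.scale /= mulr1 addr0.
Qed.

(** The real and imaginary parts of cexp (s z) are differentiable at s = 0, with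
    derivatives the real and imaginary parts of z. *)
Lemma cexp_first_order z :
  (n.+1%:R * nc (cexp (n.+1%:R^-1 * z) - (1 + n.+1%:R^-1 * z))) @[n --> \oo] --> (0 : R).
Proof.
case: z => a b.
have dRe : is_derive (0 : R) (1 : R) (fun s : R => expR (s * a) * cos (s * b)) a.
  apply: is_derive_eq.
  by rewrite !mul0r expR0 cos0 sin0 /GRing.scale /= !mulr1; ring.
have dIm : is_derive (0 : R) (1 : R) (fun s : R => expR (s * a) * sin (s * b)) b.
  apply: is_derive_eq.
  by rewrite !mul0r expR0 cos0 sin0 /GRing.scale /= !mulr1; ring.
have cRe := derive_scaled_limit _ _ dRe.
have cIm := derive_scaled_limit _ _ dIm.
have H : `|n.+1%:R * (expR (n.+1%:R^-1 * a) * cos (n.+1%:R^-1 * b) - expR (0 * a) * cos (0 * b)) - a|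
   + `|n.+1%:R * (expR (n.+1%:R^-1 * a) * sin (n.+1%:R^-1 * b) - expR (0 * a) * sin (0 * b)) - b|
    @[n --> \oo] --> (0 + 0 : R).
  apply: cvgD; apply/norm_cvg0P.
    by apply/subr_cvg0; exact: cRe.
  by apply/subr_cvg0; exact: cIm.
rewrite addr0 in H; apply: (squeeze_cvgr _ (cvg_cst 0) H); apply: nearW => n.
rewrite mulr_ge0 ?nc_ge0 //=.
have n0 : 0 < n.+1%:R :> R by rewrite ltr0n.
rewrite -[X in X * _](@ger0_norm _ n.+1%:R) ?ler0n // -ncR -ncM.
apply: (le_trans (nc_le_ReIm _)).
have E : (n.+1%:R^-1 : R[i]) = (n.+1%:R^-1 : R)%:C by rewrite fmorphV rmorph_nat.
rewrite E /cexp /cis !(cReM, cImM, cReD, cImD, cReN, cImN) /=.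
rewrite !mul0r expR0 cos0 sin0 !(subr0, addr0, mulr0, mulr1, add0r, mul0r).
have nn0 : n.+1%:R != 0 :> R by rewrite pnatr_eq0.
by apply: lerD; rewrite le_eqVlt; apply/orP; left; apply/eqP; congr `|_|;
  rewrite ?opprD !mulrDr !mulrN ?mulr1 mulVKf // ?addrA.
Qed.

(** Compare (1 + z / n) ^ n with cexp z = cexp (z / n) ^ n: by [nc_subX] the difference is
    at most exp |z| times n times the first-order error of cexp at z / n. *)
Lemma cvgC_cexp z :
  ((fun n => (1 + n.+1%:R^-1 * z) ^+ n.+1) : nat -> Cplx R) @ \oo --> (cexp z : Cplx R).
Proof.
apply/cvgC_nc.
have H : expR (nc z) * (n.+1%:R * nc (cexp (n.+1%:R^-1 * z) - (1 + n.+1%:R^-1 * z)))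
    @[n --> \oo] --> (0 : R).
  rewrite -(mulr0 (expR (nc z))); apply: cvgM; first exact: cvg_cst.
  exact: cexp_first_order.
apply: (squeeze_cvgr _ (cvg_cst 0) H); apply: nearW => n; rewrite nc_ge0 /=.
have n0 : 0 < n.+1%:R :> R by rewrite ltr0n.
have {2}-> : z = n.+1%:R * (n.+1%:R^-1 * z) by rewrite mulrA mulfV ?mul1r // pnatr_eq0.
rewrite cexpX -[X in X <= _]ncN opprB.
set y := cexp _; set x := 1 + _.
have E : nc (n.+1%:R^-1 * z) = n.+1%:R^-1 * nc z.
  have -> : (n.+1%:R^-1 : R[i]) = (n.+1%:R^-1 : R)%:C by rewrite fmorphV rmorph_nat.
  by rewrite ncM ncR ger0_norm // invr_ge0 ler0n.
pose M := expR (n.+1%:R^-1 * nc z).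
have M1 : 1 <= M by rewrite -expR0 ler_expR mulr_ge0 ?nc_ge0 // invr_ge0 ler0n.
have yM : nc y <= M by rewrite /M -E; exact: nc_cexp.
have xM : nc x <= M.
  by apply: (le_trans (ncD _ _)); rewrite nc1 E; exact: expR_ge1Dx.
apply: (le_trans (nc_subX _ _ _ _ M1 yM xM)).
by rewrite /M -expRM_natl mulrA mulfV ?gt_eqF // mul1r mulrA [expR _ * _]mulrC.
Qed.

End ComplexLimits.


(** * Mean values over circles and Cauchy's formula *)

Section ComplexCircleIntegral.
Variable R : realType.
Implicit Types (f g h : R -> R[i]).

(** A class of integrands on which the mean over the circle is linear, and which is
    closed under the algebraic operations that occur. *)
Definition cont_bounded h := [/\ continuous (fun t => complex.Re (h t)),
  continuous (fun t => complex.Im (h t)) & exists M : R, forall t, nc (h t) <= M].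

Lemma cont_bounded_cst (c : R[i]) : cont_bounded (fun=> c).
Proof. by split; [move=> t; exact: cvg_cst|move=> t; exact: cvg_cst|exists (nc c)]. Qed.

Lemma cont_boundedD f g : cont_bounded f -> cont_bounded g -> cont_bounded (fun t => f t + g t).
Proof.
move=> [f1 f2 [M Mf]] [g1 g2 [M' Mg]]; split.
- under [X in continuous X]eq_fun do rewrite cReD.
  by move=> t; apply: cvgD; [exact: f1|exact: g1].
- under [X in continuous X]eq_fun do rewrite cImD.
  by move=> t; apply: cvgD; [exact: f2|exact: g2].
- by exists (M + M') => t; apply: (le_trans (ncD _ _ _)); exact: lerD.
Qed.

Lemma cont_boundedM f g : cont_bounded f -> cont_bounded g -> cont_bounded (fun t => f t * g t).
Proof.
move=> [f1 f2 [M Mf]] [g1 g2 [M' Mg]]; split.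
- under [X in continuous X]eq_fun do rewrite cReM.
  by move=> t; apply: cvgB; apply: cvgM; [exact: f1|exact: g1|exact: f2|exact: g2].
- under [X in continuous X]eq_fun do rewrite cImM.
  by move=> t; apply: cvgD; apply: cvgM; [exact: f1|exact: g2|exact: f2|exact: g1].
- by exists (M * M') => t; rewrite ncM; apply: ler_pM; rewrite ?nc_ge0.
Qed.

Lemma cont_boundedV f (d : R) : cont_bounded f -> 0 < d -> (forall t, d <= nc (f t)) ->
  cont_bounded (fun t => (f t)^-1).
Proof.
move=> [f1 f2 [M Mf]] d0 df.
have n0 t : complex.Re (f t) ^+ 2 + complex.Im (f t) ^+ 2 != 0.
  apply/eqP => E; have := lt_le_trans d0 (df t).
  by case: (f t) E => a b /= ->; rewrite sqrtr0 ltxx.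
have cV : continuous (fun t => (complex.Re (f t) ^+ 2 + complex.Im (f t) ^+ 2)^-1).
  move=> t; apply: cvgV; first exact: n0.
  by apply: cvgD; rewrite expr2; under eq_cvg do rewrite expr2;
    apply: cvgM; [exact: f1|exact: f1|exact: f2|exact: f2].
split.
- have -> : (fun t => complex.Re (f t)^-1) = (fun t => complex.Re (f t) *
      (complex.Re (f t) ^+ 2 + complex.Im (f t) ^+ 2)^-1).
    by apply/funext => t; case: (f t).
  by move=> t; apply: cvgM; [exact: f1|exact: cV].
- have -> : (fun t => complex.Im (f t)^-1) = (fun t => - complex.Im (f t) *
      (complex.Re (f t) ^+ 2 + complex.Im (f t) ^+ 2)^-1).
    by apply/funext => t; case: (f t) => a b /=; rewrite mulNr.
  by move=> t; apply: cvgM; [apply: cvgN; exact: f2|exact: cV].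
- exists d^-1 => t; rewrite ncV lef_pV2 ?posrE //.
  exact: lt_le_trans (df t).
Qed.

Lemma cont_boundedX f n : cont_bounded f -> cont_bounded (fun t => f t ^+ n).
Proof.
move=> cf; elim: n => [|n IH]; first exact: cont_bounded_cst.
by under [X in cont_bounded X]eq_fun do rewrite exprS; exact: cont_boundedM.
Qed.

Lemma cont_bounded_cis (a : R) : cont_bounded (fun t => cis (a * t)).
Proof.
split; last by exists 1 => t; rewrite nc_cis.
- by move=> t; exact: (continuous_comp (continuous_linmul _ _ t) (@continuous_cos R _)).
- by move=> t; exact: (continuous_comp (continuous_linmul _ _ t) (@continuous_sin R _)).
Qed.

Lemma cont_bounded_Re f : cont_bounded f -> bounded_meas R (fun t => complex.Re (f t)).
Proof.
move=> [f1 _ [M Mf]]; apply: (@bounded_meas_continuous _ _ M) => // t.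
exact: le_trans (Re_le_nc _ _) (Mf t).
Qed.

Lemma cont_bounded_Im f : cont_bounded f -> bounded_meas R (fun t => complex.Im (f t)).
Proof.
move=> [_ f2 [M Mf]]; apply: (@bounded_meas_continuous _ _ M) => // t.
exact: le_trans (Im_le_nc _ _) (Mf t).
Qed.

Lemma circle_intE h : circle_int h =
  (I2pi R (fun t => complex.Re (h t)) +i* I2pi R (fun t => complex.Im (h t)))
   / (2 * pi)%:C.
Proof. by []. Qed.

Lemma eq_circle_int f g : f =1 g -> circle_int f = circle_int g.
Proof. by move=> /funext ->. Qed.

Lemma circle_intD f g : cont_bounded f -> cont_bounded g ->
  circle_int (fun t => f t + g t) = circle_int f + circle_int g.
Proof.
move=> cf cg; rewrite !circle_intE -mulrDl; congr (_ / _).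
apply: ReIm_eq => /=.
  rewrite -I2piD; [|exact: cont_bounded_Re|exact: cont_bounded_Re].
  by apply: eq_I2pi => t; rewrite cReD.
rewrite -I2piD; [|exact: cont_bounded_Im|exact: cont_bounded_Im].
by apply: eq_I2pi => t; rewrite cImD.
Qed.

Lemma circle_intZ (c : R[i]) f : cont_bounded f ->
  circle_int (fun t => c * f t) = c * circle_int f.
Proof.
move=> cf; rewrite !circle_intE mulrA; congr (_ / _).
have B1 (d : R) : bounded_meas R (fun t => d * complex.Re (f t)).
  by apply: bounded_measM; [exact: bounded_meas_cst|exact: cont_bounded_Re].
have B2 (d : R) : bounded_meas R (fun t => d * complex.Im (f t)).
  by apply: bounded_measM; [exact: bounded_meas_cst|exact: cont_bounded_Im].
apply: ReIm_eq; rewrite ?cReM ?cImM /=.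
  rewrite -!I2piZ; [|exact: cont_bounded_Im|exact: cont_bounded_Re].
  by rewrite -I2piB //; apply: eq_I2pi => t; rewrite cReM.
rewrite -!I2piZ; [|exact: cont_bounded_Re|exact: cont_bounded_Im].
by rewrite -I2piD //; apply: eq_I2pi => t; rewrite cImM.
Qed.

Lemma nc_circle_int f (M : R) : cont_bounded f -> (forall t, nc (f t) <= M) ->
  nc (circle_int f) <= 2 * M.
Proof.
move=> cf Mf; rewrite circle_intE ncM ncV ncR (gtr0_norm (pi2_gt0 R)).
rewrite ler_pdivrMr ?pi2_gt0 //.
apply: (le_trans (nc_le_ReIm _ _)) => /=.
have -> : 2 * M * (2 * pi) = M * (2 * pi) + M * (2 * pi) by ring.
apply: lerD; apply: I2pi_bound.
- exact: cont_bounded_Re.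
- by move=> t; exact: le_trans (Re_le_nc _ _) (Mf t).
- exact: cont_bounded_Im.
- by move=> t; exact: le_trans (Im_le_nc _ _) (Mf t).
Qed.

(** Dominated convergence towards zero suffices for what follows, and avoids any
    statement about the limits of the integrands. *)
Lemma circle_int_cvg0 (fn : nat -> R -> R[i]) (M : R) : (forall n, cont_bounded (fn n)) ->
  (forall n t, nc (fn n t) <= M) ->
  (forall t, nc (fn n t) @[n --> \oo] --> (0 : R)) ->
  nc (circle_int (fn n)) @[n --> \oo] --> (0 : R).
Proof.
move=> cfn Mfn H.
have HR : I2pi R (fun t => complex.Re (fn n t)) @[n --> \oo] --> I2pi R (fun=> 0).
  apply: (I2pi_dominated R _ _ M _ _ _).2.
  - by move=> n; exact: cont_bounded_Re.
  - by move=> n t; exact: le_trans (Re_le_nc _ _) (Mfn n t).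
  - move=> t; apply/norm_cvg0P; apply: (squeeze_cvgr _ (cvg_cst 0) (H t)).
    by apply: nearW => n; rewrite normr_ge0 Re_le_nc.
have HI : I2pi R (fun t => complex.Im (fn n t)) @[n --> \oo] --> I2pi R (fun=> 0).
  apply: (I2pi_dominated R _ _ M _ _ _).2.
  - by move=> n; exact: cont_bounded_Im.
  - by move=> n t; exact: le_trans (Im_le_nc _ _) (Mfn n t).
  - move=> t; apply/norm_cvg0P; apply: (squeeze_cvgr _ (cvg_cst 0) (H t)).
    by apply: nearW => n; rewrite normr_ge0 Im_le_nc.
have K : (`|I2pi R (fun t => complex.Re (fn n t))| + `|I2pi R (fun t => complex.Im (fn n t))|)
   / (2 * pi) @[n --> \oo] --> (0 + 0) / (2 * pi : R).
  apply: cvgM; last exact: cvg_cst.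
  by rewrite I2pi_cst mul0r in HR HI; apply: cvgD; exact/norm_cvg0P.
rewrite addr0 mul0r in K; apply: (squeeze_cvgr _ (cvg_cst 0) K); apply: nearW => n.
rewrite nc_ge0 andTb circle_intE ncM ncV ncR (gtr0_norm (pi2_gt0 R)).
rewrite ler_pM2r ?invr_gt0 ?pi2_gt0 //; exact: (nc_le_ReIm _ (_ +i* _)).
Qed.

Lemma circle_int_cis n : circle_int (fun t => cis (n%:R * t)) = (n == 0%N)%:R :> R[i].
Proof.
rewrite circle_intE /= I2pi_cos I2pi_sin.
have -> : (n == 0%N)%:R * (2 * pi) +i* 0 = ((n == 0%N)%:R * (2 * pi) : R)%:C by [].
rewrite rmorphM /= mulfK ?rmorph_nat //.
by rewrite -(rmorph0 (real_complex R)) (inj_eq (@complexI R)) gt_eqF ?pi2_gt0.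
Qed.

Lemma circle_int_cisN n : circle_int (fun t => cis (- n%:R * t)) = (n == 0%N)%:R :> R[i].
Proof.
rewrite circle_intE /=.
rewrite (eq_I2pi _ _ (fun t => cos (n%:R * t))); last by move=> t; rewrite mulNr cosN.
rewrite (eq_I2pi _ (fun t => sin _) (fun t => -1 * sin (n%:R * t))); last first.
  by move=> t; rewrite mulNr sinN mulN1r.
rewrite I2piZ ?I2pi_cos ?I2pi_sin ?mulr0; last exact: bounded_meas_sin.
have -> : (n == 0%N)%:R * (2 * pi) +i* 0 = ((n == 0%N)%:R * (2 * pi) : R)%:C by [].
rewrite rmorphM /= mulfK ?rmorph_nat //.
by rewrite -(rmorph0 (real_complex R)) (inj_eq (@complexI R)) gt_eqF ?pi2_gt0.
Qed.

End ComplexCircleIntegral.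

Section Cauchy.
Variables (R : realType) (r p : R).
Hypotheses (r0 : 0 < r) (pr : `|p| < r).
Implicit Types F G : R[i] -> R[i].

Definition circle_pt (t : R) : R[i] := r%:C * cis t.

Let circle_ptX n t : circle_pt t ^+ n = (r ^+ n)%:C * cis (n%:R * t).
Proof.
elim: n => [|n IH]; first by rewrite !expr0 mul0r /cis cos0 sin0 mulr1.
rewrite !exprS IH /circle_pt -natr1 mulrDl mul1r cisD rmorphM /=; ring.
Qed.

Lemma nc_circle_pt t : nc (circle_pt t) = r.
Proof. by rewrite /circle_pt ncM nc_cis mulr1 ncR gtr0_norm. Qed.

Lemma cont_bounded_circle_pt : cont_bounded R circle_pt.
Proof.
apply: cont_boundedM; first exact: cont_bounded_cst.
by have := cont_bounded_cis R 1; under [X in cont_bounded _ X -> _]eq_fun do rewrite mul1r.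
Qed.

Let nc_ztp t : r - `|p| <= nc (circle_pt t - p%:C).
Proof.
rewrite lerBlDr -[X in X <= _](nc_circle_pt t) -(ncR _ p).
by rewrite -{1}(subrK p%:C (circle_pt t)); exact: ncD.
Qed.

Let rp0 : 0 < r - `|p|. Proof. by rewrite subr_gt0. Qed.

Let ztp_neq0 t : circle_pt t - p%:C != 0.
Proof. by rewrite -nc_eq0 gt_eqF // (lt_le_trans rp0). Qed.

Let cont_bounded_ztp : cont_bounded R (fun t => (circle_pt t - p%:C)^-1).
Proof.
apply: (cont_boundedV _ _ (r - `|p|)) => //; apply: cont_boundedD; [exact:
    cont_bounded_circle_pt|exact: cont_bounded_cst].
Qed.

Lemma cont_bounded_ker : cont_bounded R (fun t => circle_pt t / (circle_pt t - p%:C)).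
Proof. by apply: cont_boundedM; [exact: cont_bounded_circle_pt|exact: cont_bounded_ztp]. Qed.

(** What holomorphy inside the circle of radius r gives for F: the moments of positive
    order vanish and the Cauchy formula holds at p.  These properties pass to sums
    and products by explicit manipulations, without complex analysis. *)
Definition Cauchy_at F := [/\ cont_bounded R (fun t => F (circle_pt t)),
  (forall n, circle_int (fun t => F (circle_pt t) * circle_pt t ^+ n.+1) = 0)
  & circle_int (fun t => F (circle_pt t) * (circle_pt t / (circle_pt t - p%:C))) = F p%:C].

Lemma eq_Cauchy_at F G : F =1 G -> Cauchy_at F -> Cauchy_at G.
Proof. by move=> /funext ->. Qed.

(** As z / (z - p) = 1 + p / (z - p), it is enough that the mean of 1 / (z - p) vanishes.
    That mean is p ^ n times the mean of z ^ (- n) / (z - p), for every n, and p is smaller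
    than r in modulus. *)
Lemma Cauchy_at_1 : Cauchy_at (fun=> 1).
Proof.
split; first exact: cont_bounded_cst.
  move=> n.
  rewrite (eq_circle_int _ _ (fun t => (r ^+ n.+1)%:C * cis (n.+1%:R * t))).
    by rewrite circle_intZ ?circle_int_cis ?mulr0 //; exact: cont_bounded_cis.
  by move=> t; rewrite mul1r circle_ptX.
(* v n is r ^ n times the mean of z ^ (- n) / (z - p). *)
pose v n := circle_int (fun t => cis (- n%:R * t) * (circle_pt t - p%:C)^-1).
have cv n : cont_bounded R (fun t => cis (- n%:R * t) * (circle_pt t - p%:C)^-1).
  by apply: cont_boundedM; [exact: cont_bounded_cis|exact: cont_bounded_ztp].
have rc0 : r%:C != 0 by rewrite -nc_eq0 ncR normr_eq0 gt_eqF.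
have vS n : v n = (p / r)%:C * v n.+1.
  rewrite -circle_intZ; last exact: cv.
  have -> : v n = circle_int (fun t => r%:C^-1 * cis (- n.+1%:R * t) +
      (p / r)%:C * (cis (- n.+1%:R * t) * (circle_pt t - p%:C)^-1)).
    apply: eq_circle_int => t; rewrite rmorphM fmorphV /=.
    have -> : cis (- n%:R * t) = cis (- n.+1%:R * t) * (circle_pt t / r%:C).
      rewrite /circle_pt mulrAC mulfV // mul1r -cisD; congr cis.
      by rewrite -natr1; ring.
    by have := ztp_neq0 t => h; field; rewrite h.
  rewrite circle_intD.
  - by rewrite (circle_intZ _ r%:C^-1) ?circle_int_cisN ?mulr0 ?add0r //; exact: cont_bounded_cis.
  - by apply: cont_boundedM; [exact: cont_bounded_cst|exact: cont_bounded_cis].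
  - by apply: cont_boundedM; [exact: cont_bounded_cst|exact: cv].
have vE n : v 0%N = (p / r)%:C ^+ n * v n.
  by elim: n => [|n ->]; rewrite ?expr0 ?mul1r // vS mulrA exprSr.
have v0 : v 0%N = 0.
  apply: Normc.eq0_normc.
  have B n : nc (v n) <= 2 * (r - `|p|)^-1.
    apply: nc_circle_int => // t; rewrite ncM nc_cis mul1r ncV lef_pV2 ?posrE //.
    exact: lt_le_trans (nc_ztp t).
  have K : `|p / r| ^+ n * (2 * (r - `|p|)^-1) @[n --> \oo] --> (0 : R).
    rewrite -(mul0r (2 * (r - `|p|)^-1)); apply: cvgM; last exact: cvg_cst.
    by apply: cvg_expr; rewrite normr_id normrM normfV (gtr0_norm r0) ltr_pdivrMr // mul1r.
  have K' : (fun=> nc (v 0%N)) @ \oo --> (0 : R).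
    apply: (squeeze_cvgr _ (cvg_cst 0) K); apply: nearW => n.
    rewrite nc_ge0 andTb (vE n) ncM ncX ncR.
    by apply: ler_wpM2l => //; rewrite exprn_ge0.
  by have := cvg_unique _ K' (cvg_cst _) => ->.
rewrite (eq_circle_int _ _ (fun t => 1 + p%:C * (cis (- 0%:R * t) * (circle_pt t - p%:C)^-1))); last first.
  move=> t; rewrite mul1r oppr0 mul0r /cis cos0 sin0 mul1r.
  by have := ztp_neq0 t => h; field; rewrite h.
rewrite circle_intD; [|exact: cont_bounded_cst|by apply: cont_boundedM; [exact: cont_bounded_cst|exact: cv]].
rewrite circle_intZ; last exact: cv.
rewrite -/(v 0%N) v0 mulr0 addr0.
rewrite (eq_circle_int _ _ (fun t => cis (0%:R * t))) ?circle_int_cis // => t.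
by rewrite mul0r /cis cos0 sin0.
Qed.

Lemma Cauchy_at_lin (a b : R[i]) F G : Cauchy_at F -> Cauchy_at G ->
  Cauchy_at (fun z => a * F z + b * G z).
Proof.
move=> [cF mF pF] [cG mG pG].
have L (k : R -> R[i]) : cont_bounded R k ->
    circle_int (fun t => (a * F (circle_pt t) + b * G (circle_pt t)) * k t) =
    a * circle_int (fun t => F (circle_pt t) * k t) + b * circle_int (fun t => G (circle_pt t) * k t).
  move=> ck; rewrite -!circle_intZ; [|exact: cont_boundedM|exact: cont_boundedM].
  rewrite -circle_intD; first by apply: eq_circle_int => t; ring.
    by apply: cont_boundedM; [exact: cont_bounded_cst|exact: cont_boundedM].
  by apply: cont_boundedM; [exact: cont_bounded_cst|exact: cont_boundedM].
split.
- by apply: cont_boundedD; apply: cont_boundedM => //; exact: cont_bounded_cst.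
- by move=> n; rewrite L ?mF ?mG ?mulr0 ?addr0 //; apply: cont_boundedX; exact: cont_bounded_circle_pt.
- by rewrite L; [rewrite pF pG|exact: cont_bounded_ker].
Qed.

(** Multiplication by z shifts the moments, and z ^ 2 / (z - p) = z + p z / (z - p). *)
Lemma Cauchy_at_mulz F : Cauchy_at F -> Cauchy_at (fun z => F z * z).
Proof.
move=> [cF mF pF].
have cFz : cont_bounded R (fun t => F (circle_pt t) * circle_pt t) by apply: cont_boundedM => //;
    exact: cont_bounded_circle_pt.
split => //.
- move=> n; rewrite -[RHS](mF n.+1); apply: eq_circle_int => t.
  by rewrite -mulrA -exprS.
- rewrite (eq_circle_int _ _ (fun t => F (circle_pt t) * circle_pt t ^+ 1 +
      p%:C * (F (circle_pt t) * (circle_pt t / (circle_pt t - p%:C))))); last first.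
    by move=> t; have := ztp_neq0 t => h; field; rewrite h.
  rewrite circle_intD ?circle_intZ ?mF ?pF ?add0r 1?mulrC //.
  + by apply: cont_boundedM => //; exact: cont_bounded_ker.
  + by apply: cont_boundedM; [exact: cont_bounded_cst|apply: cont_boundedM => //; exact: cont_bounded_ker].
Qed.

Lemma Cauchy_at_mul_affine (a b : R[i]) F : Cauchy_at F ->
  Cauchy_at (fun z => F z * (a + b * z)).
Proof.
move=> HF; have := Cauchy_at_lin a b _ _ HF (Cauchy_at_mulz _ HF).
by apply: eq_Cauchy_at => z; ring.
Qed.

Lemma nc_pole_factor (a : R) t : 0 <= a -> 1 - a * (r - 1) <= nc (1 - a%:C * (circle_pt t - 1)).
Proof.
move=> a0.
have -> : 1 - a%:C * (circle_pt t - 1) = (1 + a)%:C - a%:C * circle_pt t by rewrite rmorphD /=; ring.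
have -> : 1 - a * (r - 1) = (1 + a) - a * r by ring.
rewrite lerBlDr.
have -> : a * r = nc (a%:C * circle_pt t) by rewrite ncM nc_circle_pt ncR ger0_norm.
rewrite -[X in X <= _](@ger0_norm _ (1 + a)) ?addr_ge0 // -ncR.
by rewrite -{1}(subrK (a%:C * circle_pt t) (1 + a)%:C); exact: ncD.
Qed.

(** Let m n be the mean of F z ^ (n + 1) / (1 - a (z - 1)).  By hypothesis on F,
    (1 + a) m n = a m (n + 1).  A nonzero solution would grow like the powers of the
    pole (1 + a) / a, which lies outside the circle, while m n is at most a constant
    times r ^ n.  The Cauchy formula follows from
    1 - a (z - 1) = 1 - a (p - 1) - a (z - p) and m 0 = 0. *)
Lemma Cauchy_at_div (a : R) F : 0 <= a -> 0 < 1 - a * (r - 1) ->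
  Cauchy_at F -> Cauchy_at (fun z => F z / (1 - a%:C * (z - 1))).
Proof.
move=> a0 ar [cF mF pF].
have cW : cont_bounded R (fun t => 1 - a%:C * (circle_pt t - 1)).
  have -> : (fun t => 1 - a%:C * (circle_pt t - 1)) = (fun t => 1 + (- a%:C) * (circle_pt t + (- 1))).
    by apply/funext => t; rewrite mulNr.
  apply: cont_boundedD; first exact: cont_bounded_cst.
  apply: cont_boundedM; first exact: cont_bounded_cst.
  by apply: cont_boundedD; [exact: cont_bounded_circle_pt|exact: cont_bounded_cst].
have cV : cont_bounded R (fun t => (1 - a%:C * (circle_pt t - 1))^-1).
  by apply: (cont_boundedV _ _ (1 - a * (r - 1))) => // t; exact: nc_pole_factor.
have w0 t : 1 - a%:C * (circle_pt t - 1) != 0.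
  by rewrite -nc_eq0 gt_eqF // (lt_le_trans ar) // nc_pole_factor.
have wp0 : 1 - a%:C * (p%:C - 1) != 0.
  have -> : 1 - a%:C * (p%:C - 1) = (1 - a * (p - 1))%:C.
    by rewrite rmorphB rmorphM rmorphB /=.
  rewrite -nc_eq0 ncR normr_eq0 gt_eqF //; apply: lt_le_trans ar _.
  rewrite lerD2l lerN2; apply: ler_wpM2l => //; rewrite lerD2r.
  by apply: le_trans (ltW pr); exact: ler_norm.
have cG : cont_bounded R (fun t => F (circle_pt t) / (1 - a%:C * (circle_pt t - 1))) by exact: cont_boundedM.
pose m n := circle_int (fun t => F (circle_pt t) / (1 - a%:C * (circle_pt t - 1)) * circle_pt t ^+ n.+1).
have cm n : cont_bounded R (fun t => F (circle_pt t) / (1 - a%:C * (circle_pt t - 1)) * circle_pt t ^+ n.+1).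
  by apply: cont_boundedM => //; apply: cont_boundedX; exact: cont_bounded_circle_pt.
pose c := a / (1 + a).
have a1 : 0 < 1 + a by lra.
have mS n : m n = c%:C * m n.+1.
  have H : (1 + a)%:C * m n - a%:C * m n.+1 = 0.
    rewrite -mulNr -!circle_intZ //.
    rewrite -circle_intD; [|by apply: cont_boundedM; [exact: cont_bounded_cst|exact: cm]..].
    rewrite -[RHS](mF n); apply: eq_circle_int => t.
    rewrite [circle_pt t ^+ n.+2]exprS rmorphD /=; have := w0 t => h; by field.
  have a1c : (1 + a)%:C != 0 by rewrite -nc_eq0 ncR normr_eq0 gt_eqF.
  apply: (mulfI a1c); rewrite /c rmorphM fmorphV /=.
  have -> : (1 + a)%:C * (a%:C / (1 + a)%:C * m n.+1) = a%:C * m n.+1.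
    by rewrite -mulrA mulrCA mulVKf.
  by apply/eqP; rewrite -subr_eq0 H.
have mE k n : m n = c%:C ^+ k * m (n + k)%N.
  elim: k => [|k IH]; first by rewrite expr0 mul1r addn0.
  by rewrite IH mS mulrA -exprSr addnS.
have [M HM] : exists M, forall t, nc (F (circle_pt t) / (1 - a%:C * (circle_pt t - 1))) <= M.
  by case: cG.
have m0 n : m n = 0.
  apply: Normc.eq0_normc.
  have B k : nc (m (n + k)%N) <= 2 * (M * r ^+ (n + k).+1).
    apply: nc_circle_int => // t; rewrite ncM ncX nc_circle_pt.
    by apply: ler_wpM2r; rewrite ?exprn_ge0 // ltW.
  have c0 : 0 <= c by rewrite divr_ge0 // ltW.
  have K : (2 * (M * r ^+ n.+1)) * (c * r) ^+ k @[k --> \oo] --> (0 : R).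
    rewrite -(mulr0 (2 * (M * r ^+ n.+1))); apply: cvgM; first exact: cvg_cst.
    apply: cvg_expr; rewrite ger0_norm; last by rewrite mulr_ge0 // ltW.
    rewrite /c mulrAC ltr_pdivrMr // mul1r; lra.
  have K' : (fun=> nc (m n)) @ \oo --> (0 : R).
    apply: (squeeze_cvgr _ (cvg_cst 0) K); apply: nearW => k.
    rewrite nc_ge0 andTb (mE k) ncM ncX ncR (ger0_norm c0).
    apply: le_trans (ler_wpM2l _ (B k)) _; first by rewrite exprn_ge0.
    by rewrite -addSn exprD [(c * r) ^+ k]exprMn le_eqVlt; apply/orP; left; apply/eqP; ring.
  by have := cvg_unique _ K' (cvg_cst _) => ->.
split => //.
have cK : cont_bounded R (fun t => F (circle_pt t) / (1 - a%:C * (circle_pt t - 1)) * (circle_pt t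
    / (circle_pt t - p%:C))).
  by apply: cont_boundedM => //; exact: cont_bounded_ker.
apply: (mulIf wp0); rewrite mulfVK // -pF mulrC -circle_intZ //.
rewrite -[LHS]addr0 -(mulr0 (- a%:C)) -(m0 0%N) -circle_intZ //.
rewrite -circle_intD; [|by apply: cont_boundedM; [exact: cont_bounded_cst|done]..].
apply: eq_circle_int => t; rewrite expr1.
have := w0 t => h; have := ztp_neq0 t => h'; by field; rewrite h h'.
Qed.

End Cauchy.


(** * Rational approximations of Phi *)

Section PhiApprox.
Variables (R : realType) (w : params R).
Hypothesis hw : in_Omega w.

(** The coefficients of x - 1 in the factors of Phi: [zero_coef] in the numerators,
    [pole_coef], up to sign, in the denominators. *)
Definition pole_coef i : R := alpha w i * (1 + alpha w i / 2).
Definition zero_coef i : R := beta w i * (1 - beta w i / 2).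

Lemma alpha_ge0 i : 0 <= alpha w i.
Proof. by case: hw => -[]. Qed.

Lemma beta_ge0 i : 0 <= beta w i.
Proof. by case: hw => -[]. Qed.

Lemma gamma_ge0 : 0 <= gamma w.
Proof. by case: hw => -[]. Qed.

Lemma alphaS i : alpha w i.+1 <= alpha w i.
Proof. by case: hw => _ []. Qed.

Lemma beta_le1 i : beta w i <= 1.
Proof.
case: hw => _ [_ bS b1 _]; elim: i => // i; exact: le_trans.
Qed.

Lemma alpha_le0 i : alpha w i <= alpha w 0.
Proof. by elim: i => // i; apply: le_trans; exact: alphaS. Qed.

Lemma pole_coef_ge0 i : 0 <= pole_coef i.
Proof. by rewrite /pole_coef mulr_ge0 ?alpha_ge0 //; have := alpha_ge0 i; lra. Qed.

Lemma pole_coefS i : pole_coef i.+1 <= pole_coef i.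
Proof.
rewrite /pole_coef; have := alphaS i; have := alpha_ge0 i.+1; have := alpha_ge0 i => *.
apply: ler_pM => //; lra.
Qed.

Lemma pole_coef_anti i j : (i <= j)%N -> pole_coef j <= pole_coef i.
Proof.
elim: j => [|j IH]; first by rewrite leqn0 => /eqP ->.
rewrite leq_eqVlt => /orP [/eqP -> //|/IH]; apply: le_trans; exact: pole_coefS.
Qed.

Lemma zero_coef_ge0 i : 0 <= zero_coef i.
Proof.
by rewrite /zero_coef mulr_ge0 ?beta_ge0 //; have := beta_le1 i; have := beta_ge0 i; lra.
Qed.

Lemma zero_coef_le1 i : zero_coef i <= 1.
Proof.
have := beta_le1 i; have := beta_ge0 i => *.
by rewrite /zero_coef mulr_ile1 //; lra.
Qed.

Lemma coef_summable : cvgn (series (fun i => pole_coef i + zero_coef i)).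
Proof.
case: hw => _ [_ _ _ cs].
pose c := 1 + alpha w 0.
have c1 : 1 <= c by rewrite /c; have := alpha_ge0 0; lra.
apply: (series_le_cvg (v_ := fun i => c * (alpha w i + beta w i))).
- by move=> i; rewrite addr_ge0 ?pole_coef_ge0 ?zero_coef_ge0.
- by move=> i; rewrite mulr_ge0 ?addr_ge0 ?alpha_ge0 ?beta_ge0 //; lra.
- move=> i /=; rewrite mulrDr; apply: lerD; rewrite /pole_coef /zero_coef mulrC.
    apply: ler_wpM2r; first exact: alpha_ge0.
    by rewrite /c; have := alpha_le0 i; have := alpha_ge0 i; lra.
  by apply: ler_wpM2r; [exact: beta_ge0|have := beta_ge0 i; lra].
- exact: is_cvg_seriesZ.
Qed.

Lemma pole_coef_cvg0 : pole_coef @ \oo --> (0 : R).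
Proof.
have := cvg_series_cvg_0 coef_summable => H.
apply: (squeeze_cvgr _ (cvg_cst 0) H); apply: nearW => i.
by rewrite pole_coef_ge0 /= lerDl zero_coef_ge0.
Qed.

Definition Phi_factor i (z : R[i]) : R[i] :=
  (1 + (zero_coef i)%:C * (z - 1)) / (1 - (pole_coef i)%:C * (z - 1)).

Definition exp_approx m (z : R[i]) : R[i] := (1 + m.+1%:R^-1 * ((gamma w)%:C * (z - 1))) ^+ m.+1.

Definition Phi_approx m (z : R[i]) : R[i] := exp_approx m z * \prod_(i < m) Phi_factor i z.

(** The factor with index i differs from 1 by (a_i + b_i) (z - 1) / (1 - a_i (z - 1)), which
    is summable: the denominators tend to 1 and do not vanish, so their inverses are
    bounded. *)
Lemma Phi_approx_cvg (z : R[i]) : (forall i, 1 - (pole_coef i)%:C * (z - 1) != 0) ->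
  (fun m => Phi_approx m z : Cplx R) @ \oo --> (Phi w z : Cplx R).
Proof.
move=> nz.
have Hinv : (fun i => (nc (1 - (pole_coef i)%:C * (z - 1)))^-1) @ \oo --> (1^-1 : R).
  apply: cvgV; first exact: oner_neq0.
  have K : pole_coef n * nc (z - 1) @[n --> \oo] --> (0 * nc (z - 1) : R).
    by apply: cvgM; [exact: pole_coef_cvg0|exact: cvg_cst].
  rewrite mul0r in K; apply: cvg_dist0.
  apply: (squeeze_cvgr _ (cvg_cst 0) K); apply: nearW => i.
  rewrite normr_ge0 andTb.
  have E : nc ((pole_coef i)%:C * (z - 1)) = pole_coef i * nc (z - 1).
    by rewrite ncM ncR ger0_norm ?pole_coef_ge0.
  rewrite -E -(nc1 R) ler_norml; apply/andP; split.
    rewrite lerBrDr -[X in - X]opprK opprK addrC lerBlDr.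
    rewrite -{1}(subrK ((pole_coef i)%:C * (z - 1)) 1); exact: ncD.
  by rewrite lerBlDr [leRHS]addrC; exact: ncB.
(* The denominators tend to 1, so their inverses are bounded. *)
have [M [_ HM]] : bounded_fun (fun i => (nc (1 - (pole_coef i)%:C * (z - 1)))^-1).
  by apply: cvg_seq_bounded; apply/cvg_ex; exists 1^-1.
pose C := (`|M| + 1) * nc (z - 1).
have C0 : 0 <= C by rewrite mulr_ge0 ?nc_ge0 // addr_ge0.
have [l Hl] : exists l : Cplx R,
    ((fun n => \prod_(i < n) (1 + (Phi_factor i z - 1))) : nat -> Cplx R) @ \oo --> l.
  apply: (cvgC_prod R (fun i => Phi_factor i z - 1) (fun i => C * (pole_coef i + zero_coef i))); last first.
    by apply: is_cvg_seriesZ; exact: coef_summable.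
  move=> i.
  have -> : Phi_factor i z - 1 = (pole_coef i + zero_coef i)%:C * (z - 1) / (1 - (pole_coef i)%:C * (z - 1)).
    by rewrite /Phi_factor rmorphD /=; field; exact: nz.
  rewrite !ncM ncV ncR ger0_norm ?addr_ge0 ?pole_coef_ge0 ?zero_coef_ge0 //.
  rewrite /C [leRHS]mulrC -mulrA; apply: ler_wpM2l.
    by rewrite addr_ge0 ?pole_coef_ge0 ?zero_coef_ge0.
  rewrite mulrC; apply: ler_wpM2r; first exact: nc_ge0.
  apply: le_trans (HM (`|M| + 1) _ i I); last by rewrite (le_lt_trans (ler_norm M)) // ltrDl.
  exact: ler_norm.
have E n : \prod_(i < n) (1 + (Phi_factor i z - 1)) = \prod_(i < n) Phi_factor i z.
  by apply: eq_bigr => i _; rewrite addrC subrK.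
have {}Hl : ((fun n => \prod_(i < n) Phi_factor i z) : nat -> Cplx R) @ \oo --> l.
  by apply: cvg_trans Hl; apply: near_eq_cvg; apply: nearW => n; rewrite E.
have limE : limn (fun n => \prod_(i < n) Phi_factor i z : Cplx R) = l.
  exact/cvg_lim.
rewrite /Phi -[limn _]/(limn (fun n => \prod_(i < n) Phi_factor i z : Cplx R)) limE.
apply: cvgM; last exact: Hl.
exact: cvgC_cexp.
Qed.

End PhiApprox.


(** * The Taylor series of Phi inside the annulus *)

Section CauchyProducts.
Variables (R : realType) (r p : R).
Hypotheses (r0 : 0 < r) (pr : `|p| < r).
Implicit Types F : R[i] -> R[i].

Lemma Cauchy_at_prod (n : nat) (A B : nat -> R[i]) F : Cauchy_at R r p F ->
  Cauchy_at R r p (fun z => F z * \prod_(i < n) (A i + B i * z)).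
Proof.
move=> HF; elim: n => [|n IH].
  by apply: eq_Cauchy_at HF => z; rewrite big_ord0 mulr1.
have := Cauchy_at_mul_affine R r p r0 pr (A n) (B n) _ IH.
by apply: eq_Cauchy_at => z; rewrite big_ord_recr /= mulrA.
Qed.

Lemma Cauchy_at_prodV (m n : nat) (a : nat -> R) F :
  (forall i, (m <= i)%N -> 0 <= a i /\ 0 < 1 - a i * (r - 1)) ->
  Cauchy_at R r p F ->
  Cauchy_at R r p (fun z => F z * \prod_(m <= i < m + n) (1 - (a i)%:C * (z - 1))^-1).
Proof.
move=> Ha HF; elim: n => [|n IH].
  by apply: eq_Cauchy_at HF => z; rewrite addn0 big_geq // mulr1.
have [a0 ar] := Ha (m + n)%N (leq_addr _ _).
have := Cauchy_at_div R r p r0 pr (a (m + n)%N) _ a0 ar IH.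
by apply: eq_Cauchy_at => z; rewrite addnS big_nat_recr ?leq_addr //= mulrA.
Qed.

Lemma Cauchy_at_poly (c : nat -> R[i]) n :
  Cauchy_at R r p (fun z => \sum_(0 <= i < n) c i * z ^+ i).
Proof.
have HX k : Cauchy_at R r p (fun z => z ^+ k).
  elim: k => [|k IH]; first by apply: eq_Cauchy_at (Cauchy_at_1 R r p r0 pr) => z.
  have := Cauchy_at_mulz R r p r0 pr _ IH.
  by apply: eq_Cauchy_at => z; rewrite exprSr.
elim: n => [|n IH].
  have := Cauchy_at_lin R r p r0 pr 0 0 _ _ (HX 0) (HX 0).
  by apply: eq_Cauchy_at => z; rewrite big_geq // !mul0r addr0.
have := Cauchy_at_lin R r p r0 pr 1 (c n) _ _ IH (HX n).
by apply: eq_Cauchy_at => z; rewrite big_nat_recr //= mul1r.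
Qed.

End CauchyProducts.

Section TaylorOnInterval.
Variables (R : realType) (w : params R) (xm r1 r2 : R).
Hypothesis hw : in_Omega w.
Hypotheses (xm1 : 1 <= xm) (r1_xm : r1 < xm) (xm_r2 : xm < r2).
Hypothesis hT : forall z : R[i], r1%:C < `|z| < r2%:C ->
  series (fun n => phi w n * z ^+ n) @ \oo --> (Phi w z : Cplx R).

Let a := pole_coef R w.
Let b := zero_coef R w.

(** The finitely many poles of Phi that are at most xm are cancelled by a polynomial
    D.  On a circle slightly larger than xm, inside the annulus and with all other
    poles outside, Phi D is a bounded limit of functions H n that satisfy Cauchy's
    formula at p, and also of the products G n D with the Taylor polynomials G n.
    So the mean of (H n - G n D) z / (z - p), which is the value of H n - G n D at p,
    tends to 0.  As H n p tends to Phi p D p and D p is not 0, G n p tends to Phi p. *)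
Lemma Phi_Taylor : exists rho C : R, [/\ xm < rho,
    (forall n, nc (phi w n) <= C * rho ^- n)
  & (forall x : R, -1 <= x <= 1 ->
       series (fun n => phi w n * x%:C ^+ n) @ \oo --> (Phi w x%:C : Cplx R))].
Proof.
have xm1' := xm1; have r1_xm' := r1_xm; have xm_r2' := xm_r2.
have a0 i : 0 <= a i by exact: pole_coef_ge0.
have b0 i : 0 <= b i by exact: zero_coef_ge0.
have b1 i : b i <= 1 by exact: zero_coef_le1.
have g0 := gamma_ge0 R w hw.
have exK : exists K, 0 < 1 - a K * (xm - 1).
  have H : a i * (xm - 1) @[i --> \oo] --> (0 * (xm - 1) : R).
    by apply: cvgM; [exact: pole_coef_cvg0|exact: cvg_cst].
  rewrite mul0r in H; have /cvgr_lt /(_ _ ltr01) [K _ HK] := H.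
  by exists K; rewrite subr_gt0; apply: (HK K) => /=.
case: (ex_minnP exK) => K K0 Kmin.
(* del keeps the circle of radius xm + del inside the annulus and the pole of
   index K outside it. *)
pose del := Num.min ((r2 - xm) / 2) ((1 - a K * (xm - 1)) / (2 * (a K + 1))).
have del0 : 0 < del.
  rewrite /del lt_min; apply/andP; split; first by rewrite divr_gt0 ?subr_gt0.
  by apply: divr_gt0 => //; have := a0 K; lra.
have del1 : del <= (r2 - xm) / 2 by rewrite /del ge_min lexx.
have del2 : a K * del < 1 - a K * (xm - 1).
  have H : del <= (1 - a K * (xm - 1)) / (2 * (a K + 1)) by rewrite /del ge_min lexx orbT.
  have aK := a0 K.
  have H' := ler_wpM2l aK H; apply: le_lt_trans H' _.
  rewrite mulrA ltr_pdivrMr; last lra.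
  nra.
(* The coefficients are bounded by means of the radius rho, and the Cauchy formula is
   used on the smaller radius r. *)
pose rho := xm + del; pose r := xm + del / 2.
have r0 : 0 < r by rewrite /r; lra.
have rrho : r < rho by rewrite /r /rho; lra.
have rho0 : 0 < rho by rewrite (lt_trans r0).
have rge1 : 1 <= r by rewrite /r; lra.
have Kr i : (K <= i)%N -> 0 <= a i /\ 0 < 1 - a i * (r - 1).
  move=> Ki; split => //; have := pole_coef_anti R w hw K i Ki; rewrite -!/(a _) => ai.
  have H : a i * (r - 1) <= a K * (r - 1) by apply: ler_wpM2r => //; rewrite subr_ge0.
  have : a K * (r - 1) = a K * (xm - 1) + a K * del / 2 by rewrite /r; field.
  have := mulr_ge0 (a0 K) (ltW del0); lra.
have Kl i : (i < K)%N -> 1 - a i * (r - 1) < 0.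
  move=> iK; have : ~~ (0 < 1 - a i * (xm - 1)).
    by apply/negP => /Kmin; rewrite leqNgt iK.
  rewrite -leNgt => H.
  have ai : 0 < a i by rewrite lt_def a0 andbT; apply: contraTneq H => ->; rewrite -ltNge; lra.
  have -> : 1 - a i * (r - 1) = (1 - a i * (xm - 1)) - a i * (del / 2) by rewrite /r; field.
  have : 0 < a i * (del / 2) by rewrite mulr_gt0 // divr_gt0.
  lra.
have inann (s : R) (t : R) : 0 < s -> r1 < s -> s < r2 ->
    r1%:C < `|circle_pt R s t| < r2%:C.
  by move=> s0 rs sr; rewrite -ncE nc_circle_pt // !ltcR rs sr.
have rho_r2 : rho < r2 by rewrite /rho; lra.
have r1_rho : r1 < rho by rewrite /rho; lra.
have [M HM] := cvgC_bounded R _ _ (hT _ (inann rho 0 rho0 r1_rho rho_r2)).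
(* Each term is a difference of partial sums, which converge at a point of modulus
   rho. *)
have phiB n : nc (phi w n) <= 2 * M * rho ^- n.
  rewrite ler_pdivlMr ?exprn_gt0 //.
  have -> : nc (phi w n) * rho ^+ n = nc (phi w n * circle_pt R rho 0 ^+ n).
    by rewrite ncM ncX nc_circle_pt.
  have -> : phi w n * circle_pt R rho 0 ^+ n = series (fun n => phi w n * circle_pt R rho 0 ^+ n) n.+1
     - series (fun n => phi w n * circle_pt R rho 0 ^+ n) n.
    by rewrite /series /= big_nat_recr //= addrAC subrr add0r.
  by apply: (le_trans (ncB _ _ _)); rewrite mulr_natl mulr2n; apply: lerD; exact: HM.
have M0 : 0 <= M by exact: le_trans (nc_ge0 _ _) (HM 0%N).
exists rho, (2 * M); split => //; first by rewrite /rho; lra.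
move=> p /andP [p1 p2].
have pr : `|p| < r by rewrite ltr_norml /r; lra.
(* the approximations of Phi D, starting at an index where their factors are
   affine functions with nonnegative coefficients *)
have [n0 [n0K n0g]] : exists n0, (K <= n0)%N /\ gamma w <= n0%:R.
  exists (maxn K (Num.truncn (gamma w)).+1); split; first exact: leq_maxl.
  apply: ltW; apply: lt_le_trans (truncnS_gt _) _.
  by rewrite ler_nat leq_maxr.
pose D (z : R[i]) : R[i] := \prod_(i < K) (1 - (a i)%:C * (z - 1)).
pose E n (z : R[i]) : R[i] := exp_approx R w (n0 + n) z * \prod_(i < n0 + n) (1 + (b i)%:C * (z - 1)).
pose H n (z : R[i]) : R[i] := E n z * \prod_(K <= i < n0 + n) (1 - (a i)%:C * (z - 1))^-1.
pose G n (z : R[i]) : R[i] := \sum_(0 <= i < n) phi w i * z ^+ i.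
have HE n z : (forall i, 1 - (a i)%:C * (z - 1) != 0) -> H n z = Phi_approx R w (n0 + n) z * D z.
  move=> nz; rewrite /H /E /Phi_approx -!mulrA; congr (_ * _).
  rewrite /Phi_factor big_split /= -!mulrA; congr (_ * _).
  rewrite -(big_mkord xpredT (fun i => (1 - (a i)%:C * (z - 1))^-1)).
  rewrite (big_cat_nat (leq0n K)) /=; last by rewrite (leq_trans n0K) // leq_addr.
  rewrite mulrAC big_mkord /D -big_split /= [X in _ = X * _]big1 ?mul1r // => i _.
  by rewrite mulVf.
have Hcvg z : (forall i, 1 - (a i)%:C * (z - 1) != 0) ->
    (fun n => H n z : Cplx R) @ \oo --> (Phi w z * D z : Cplx R).
  move=> nz; under eq_fun do rewrite HE //.
  apply: cvgM; last exact: cvg_cst.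
  have := Phi_approx_cvg R w hw z nz.
  rewrite -(cvg_shiftn n0) /=.
  by under eq_fun do rewrite addnC.
have nzr (s : R[i]) : (forall i, 0 < nc (1 - (a i)%:C * (s - 1))) ->
    forall i, 1 - (a i)%:C * (s - 1) != 0.
  by move=> Hs i; rewrite -nc_eq0 gt_eqF.
have nz_circle t i : 1 - (a i)%:C * (circle_pt R r t - 1) != 0.
  apply/eqP => E0.
  have E1 : (a i)%:C * circle_pt R r t = (1 + a i)%:C.
    by rewrite rmorphD rmorph1; apply/eqP; rewrite -subr_eq0 -oppr_eq0 -E0; apply/eqP; ring.
  have := congr1 nc E1; rewrite ncM nc_circle_pt // !ncR !ger0_norm //; last by rewrite addr_ge0.
  move=> E2; have [Ki|iK] := leqP K i.
    by have [_] := Kr i Ki; nra.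
  by have := Kl i iK; nra.
have nz_p i : 1 - (a i)%:C * (p%:C - 1) != 0.
  have -> : 1 - (a i)%:C * (p%:C - 1) = (1 - a i * (p - 1))%:C.
    by apply: ReIm_eq => /=; ring.
  rewrite -nc_eq0 ncR normr_eq0 gt_eqF //; have := a0 i; nra.
have C1 := Cauchy_at_1 R r p r0 pr.
have CE n : Cauchy_at R r p (E n).
  pose c : R := (n0 + n).+1%:R^-1 * gamma w.
  have := Cauchy_at_prod R r p r0 pr (n0 + n).+1 (fun=> (1 - c)%:C) (fun=> c%:C) _ C1.
  move/(Cauchy_at_prod R r p r0 pr (n0 + n) (fun i => (1 - b i)%:C) (fun i => (b i)%:C)).
  apply: eq_Cauchy_at => z; rewrite mul1r /E prodr_const card_ord.
  congr (_ * _).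
    rewrite /exp_approx /c; congr (_ ^+ _).
    by rewrite rmorphB !rmorphM fmorphV rmorph_nat rmorph1 /=; ring.
  by apply: eq_bigr => i _; rewrite rmorphB rmorph1; ring.
have CH n : Cauchy_at R r p (H n).
  have := Cauchy_at_prodV R r p r0 pr K (n0 + n - K) a _ Kr (CE n).
  by rewrite subnKC // (leq_trans n0K) // leq_addr.
have CD F : Cauchy_at R r p F -> Cauchy_at R r p (fun z => F z * D z).
  move=> /(Cauchy_at_prod R r p r0 pr K (fun i => (1 + a i)%:C) (fun i => - (a i)%:C)).
  apply: eq_Cauchy_at => z; congr (_ * _); apply: eq_bigr => i _.
  by rewrite rmorphD rmorph1; ring.
have CG n : Cauchy_at R r p (fun z => G n z * D z).
  by apply: CD; exact: Cauchy_at_poly.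
have z0E : circle_pt R r 0 = r%:C by rewrite /circle_pt /cis cos0 sin0 mulr1.
have aff (c t : R) : 0 <= c <= 1 ->
    nc (1 + c%:C * (circle_pt R r t - 1)) <= nc (1 + c%:C * (circle_pt R r 0 - 1)).
  move=> /andP [c0 c1].
  have -> : nc (1 + c%:C * (circle_pt R r 0 - 1)) = (1 - c) + c * r.
    have -> : 1 + c%:C * (circle_pt R r 0 - 1) = (1 - c + c * r)%:C.
      by rewrite z0E; apply: ReIm_eq => /=; ring.
    rewrite ncR ger0_norm //; have := mulr_ge0 c0 (ltW r0); lra.
  have -> : 1 + c%:C * (circle_pt R r t - 1) = (1 - c)%:C + c%:C * circle_pt R r t.
    by rewrite rmorphB rmorph1; ring.
  apply: (le_trans (ncD _ _ _)); rewrite ncM nc_circle_pt // !ncR !ger0_norm //.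
  by rewrite subr_ge0.
have [MH HMH] : exists MH, forall n t, nc (H n (circle_pt R r t)) <= MH.
  have [MH HMH] := cvgC_bounded R _ _ (Hcvg _ (nz_circle 0)).
  exists MH => n t; apply: le_trans (HMH n).
  rewrite /H /E !ncM !nc_prod; apply: ler_pM.
  - by rewrite mulr_ge0 ?nc_ge0 // prodr_ge0 // => i _; exact: nc_ge0.
  - by rewrite prodr_ge0 // => i _; exact: nc_ge0.
  - apply: ler_pM.
    + exact: nc_ge0.
    + by rewrite prodr_ge0 // => i _; exact: nc_ge0.
    + rewrite /exp_approx !ncX; apply: lerXn2r; rewrite ?nnegrE ?nc_ge0 //.
      have Ez z : (n0 + n).+1%:R^-1 * ((gamma w)%:C * (z - 1)) =
          ((n0 + n).+1%:R^-1 * gamma w)%:C * (z - 1) :> R[i].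
        by rewrite rmorphM fmorphV rmorph_nat mulrA.
      rewrite !Ez; apply: aff; rewrite mulr_ge0 ?invr_ge0 //= mulrC ler_pdivrMr ?ltr0n // mul1r.
      by apply: (le_trans n0g); rewrite ler_nat (leq_trans (leq_addr n n0)).
    + by apply: ler_prod => i _; rewrite nc_ge0 /=; apply: aff; rewrite b0 b1.
  - rewrite big_nat_cond [leRHS]big_nat_cond; apply: ler_prod => i /andP [/andP [Ki _] _].
    rewrite nc_ge0 andTb !ncV.
    have [ai0 ai1] := Kr i Ki.
    have -> : nc (1 - (a i)%:C * (circle_pt R r 0 - 1)) = 1 - a i * (r - 1).
      have -> : 1 - (a i)%:C * (circle_pt R r 0 - 1) = (1 - a i * (r - 1))%:C.
        by rewrite z0E; apply: ReIm_eq => /=; ring.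
      by rewrite ncR gtr0_norm.
    have Hn := nc_pole_factor R r r0 (a i) t ai0.
    by rewrite lef_pV2 ?posrE // (lt_le_trans ai1).
have [MG HMG] : exists MG, forall n t, nc (G n (circle_pt R r t) * D (circle_pt R r t)) <= MG.
  have [[_ _ [MD HMD]] _ _] := CD _ C1.
  exists (2 * M / (1 - r / rho) * MD) => n t; rewrite ncM.
  have q1 : r / rho < 1 by rewrite ltr_pdivrMr // mul1r.
  apply: ler_pM; rewrite ?nc_ge0 //; last by have := HMD t; rewrite mul1r.
  apply: (le_trans (nc_sum _ _ _ _ _)).
  have Hs : \sum_(0 <= i < n) 2 * M * (r / rho) ^+ i <= 2 * M / (1 - r / rho).
    rewrite -mulr_sumr; apply: ler_wpM2l; first by rewrite mulr_ge0.
    by apply: geometric_sum_le => //; rewrite divr_ge0 // ltW.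
  apply: le_trans Hs; apply: ler_sum => i _.
  have -> : 2 * M * (r / rho) ^+ i = 2 * M * rho ^- i * r ^+ i.
    by rewrite exprMn exprVn mulrA mulrAC.
  rewrite ncM ncX nc_circle_pt //; apply: ler_wpM2r; first by rewrite exprn_ge0 // ltW.
  exact: phiB.
pose F n (t : R) : R[i] := H n (circle_pt R r t) + -1 * (G n (circle_pt R r t) * D (circle_pt R r t)).
have CF n := Cauchy_at_lin R r p r0 pr 1 (-1) _ _ (CH n) (CG n).
have F0 t : nc (F n t) @[n --> \oo] --> (0 : R).
  have cG : (fun n => G n (circle_pt R r t) : Cplx R) @ \oo --> (Phi w (circle_pt R r t) : Cplx R).
    by apply: hT; apply: inann => //; rewrite /r; lra.
  have : (fun n => F n t : Cplx R) @ \oo -->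
      (Phi w (circle_pt R r t) * D (circle_pt R r t) + -1 * (Phi w (circle_pt R r t) * D (circle_pt R r t)) : Cplx R).
    apply: cvgD; first exact: Hcvg (nz_circle t).
    apply: cvgM; first exact: cvg_cst.
    by apply: cvgM; [exact: cG|exact: cvg_cst].
  rewrite mulN1r subrr => /cvgC_nc.
  by under eq_fun do rewrite subr0.
have [Mk HMk] : exists Mk, forall t, nc (circle_pt R r t / (circle_pt R r t - p%:C)) <= Mk.
  by have [_ _ [Mk HMk]] := cont_bounded_ker R r p r0 pr; exists Mk.
have lim0 := circle_int_cvg0 R (fun n t => F n t * (circle_pt R r t / (circle_pt R r t - p%:C)))
   ((MH + MG) * Mk).
have {}lim0 : nc (circle_int (fun t => F n t * (circle_pt R r t / (circle_pt R r t - p%:C))))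
    @[n --> \oo] --> (0 : R).
  apply: lim0.
  - move=> n; apply: cont_boundedM; last exact: cont_bounded_ker.
    have [cF _ _] := CF n; have -> // : F n = (fun t => 1 * H n (circle_pt R r t) +
      -1 * (G n (circle_pt R r t) * D (circle_pt R r t))).
    by apply/funext => t; rewrite /F mul1r.
  - move=> n t; rewrite ncM; apply: ler_pM; rewrite ?nc_ge0 //.
    apply: (le_trans (ncD _ _ _)); apply: lerD => //.
    by rewrite mulN1r ncN.
  - move=> t; rewrite -(mul0r (nc (circle_pt R r t / (circle_pt R r t - p%:C)))).
    under eq_fun do rewrite ncM.
    by apply: cvgM; [exact: F0|exact: cvg_cst].
have Fp : (fun n => H n p%:C - G n p%:C * D p%:C : Cplx R) @ \oo --> (0 : Cplx R).
  apply/cvgC_nc; under eq_fun do rewrite subr0.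
  have E0 n : H n p%:C - G n p%:C * D p%:C =
      circle_int (fun t => F n t * (circle_pt R r t / (circle_pt R r t - p%:C))).
    have [_ _] := CF n; rewrite mul1r mulN1r => <-.
    by apply: eq_circle_int => t; rewrite /F mul1r.
  by under eq_fun do rewrite E0.
have Dp0 : D p%:C != 0.
  by apply/prodf_neq0 => i _; exact: nz_p.
have GD : (fun n => G n p%:C * D p%:C : Cplx R) @ \oo --> (Phi w p%:C * D p%:C : Cplx R).
  have : (fun n => H n p%:C - (H n p%:C - G n p%:C * D p%:C) : Cplx R) @ \oo -->
      (Phi w p%:C * D p%:C - 0 : Cplx R).
    by apply: cvgB; [exact: Hcvg|exact: Fp].
  rewrite subr0; apply: cvg_trans; apply: near_eq_cvg; apply: nearW => n /=.
  by rewrite opprB addrC subrK.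
move/cvgC_nc in GD; apply/cvgC_nc.
have K1 : nc (G n p%:C * D p%:C - Phi w p%:C * D p%:C) / nc (D p%:C)
    @[n --> \oo] --> (0 / nc (D p%:C) : R).
  by apply: cvgM; [exact: GD|exact: cvg_cst].
rewrite mul0r in K1; apply: cvg_trans K1; apply: near_eq_cvg; apply: nearW => n /=.
by rewrite -mulrBl ncM mulfK // nc_eq0.
Qed.

End TaylorOnInterval.


(** * Nonnegativity of the minors for Phi *)

Section RealPhi.
Variables (R : realType) (w : params R).
Hypothesis hw : in_Omega w.

Let a := pole_coef R w.
Let b := zero_coef R w.

Definition PhiR (x : R) : R := complex.Re (Phi w x%:C).

Definition exp_approxR m (x : R) : R := (1 + m.+1%:R^-1 * gamma w * (x - 1)) ^+ m.+1.

Definition Phi_approxR m (x : R) : R :=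
  exp_approxR m x * \prod_(i < m) ((1 + b i * (x - 1)) / (1 - a i * (x - 1))).

Lemma Phi_approxRE m (x : R) : Phi_approx R w m x%:C = (Phi_approxR m x)%:C.
Proof.
rewrite /Phi_approx /Phi_approxR rmorphM /=; congr (_ * _).
  rewrite /exp_approx /exp_approxR rmorphXn /=; congr (_ ^+ _).
  by rewrite !(rmorphD, rmorphM, fmorphV, rmorph_nat, rmorphB, rmorph1) /= rmorphN rmorph1 mulrA.
rewrite rmorph_prod /=; apply: eq_bigr => i _.
rewrite /Phi_factor [RHS]realC_mul [in RHS]realC_inv /a /b; congr (_ * _^-1); apply: ReIm_eq => /=; ring.
Qed.

Lemma PhiR_cvg (x : R) : (forall i, 1 - a i * (x - 1) != 0) ->
  Phi_approxR m x @[m --> \oo] --> PhiR x /\ Phi w x%:C = (PhiR x)%:C.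
Proof.
move=> nz.
have nzC i : 1 - (pole_coef R w i)%:C * (x%:C - 1) != 0.
  have -> : 1 - (pole_coef R w i)%:C * (x%:C - 1) = (1 - a i * (x - 1))%:C.
    by rewrite /a; apply: ReIm_eq => /=; ring.
  by rewrite -nc_eq0 ncR normr_eq0.
have /cvgC_ReIm [HR HI] := Phi_approx_cvg R w hw _ nzC.
have EI : complex.Im (Phi w x%:C) = 0.
  have H0 : complex.Im (Phi_approx R w n x%:C) @[n --> \oo] --> (0 : R).
    have -> : (fun n => complex.Im (Phi_approx R w n x%:C)) = (fun=> 0).
      by apply/funext => n; rewrite Phi_approxRE.
    exact: cvg_cst.
  exact: (cvg_unique _ HI H0).
split; last by apply: ReIm_eq => //=; rewrite EI.
have -> : Phi_approxR ^~ x = (fun n => complex.Re (Phi_approx R w n x%:C)).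
  by apply/funext => n; rewrite Phi_approxRE.
exact: HR.
Qed.

Lemma nonpole_le1 (x : R) i : x <= 1 -> 1 - a i * (x - 1) != 0.
Proof. by move=> x1; have := pole_coef_ge0 R w hw i; rewrite -/(a i) => ai; rewrite gt_eqF //; nra. Qed.

Variables (X : lie_series) (N : nat).

Let Tk := sine_kernel R X.

(** The properties passed from one partial product to the next.  The bounds keep the
    kernels bounded, which the division by a bidiagonal kernel and the final limit
    require. *)
Definition TNN_factor (F : R -> R) :=
  [/\ bounded_at_cos R F, (forall t, 0 <= F (cos t) <= 1) & TNN R N (Tk F)].

Lemma TNN_factor1 : TNN_factor (fun=> 1).
Proof.
split; [exact: bounded_at_cos_cst|by move=> t; rewrite ler01 lexx|].
have -> : Tk (fun=> 1) = fun k l => (k == l)%:R.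
  by apply/funext => k; apply/funext => l; exact: sine_kernel_one.
exact: TNN_id.
Qed.

Lemma TNN_factor_beta (be : R) F : 0 <= be <= 1 -> TNN_factor F ->
  TNN_factor (fun x => F x * (1 + be * (1 - be / 2) * (x - 1))).
Proof.
move=> be01 [bf f01 Tf]; split; last exact: TNN_beta_factor.
- apply: bounded_at_cosM => //; apply: bounded_at_cosD; first exact: bounded_at_cos_cst.
  by apply: bounded_at_cosM; [exact: bounded_at_cos_cst|apply: bounded_at_cosD; [exact:
      bounded_at_cos_id|exact: bounded_at_cos_cst]].
- move=> t; have /andP [f0 f1] := f01 t; move/andP: be01 => [b0 b1].
  have c1 := cos_le1 t; have c2 := cos_geN1 t.
  have u0 : 0 <= be * (1 - be / 2) by nra.
  have u1 : be * (1 - be / 2) <= 1 / 2 by nra.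
  have g0 : 0 <= 1 + be * (1 - be / 2) * (cos t - 1) by nra.
  have g1 : 1 + be * (1 - be / 2) * (cos t - 1) <= 1 by nra.
  by rewrite mulr_ge0 //= mulr_ile1.
Qed.

Lemma TNN_factor_alpha (al : R) F : 0 <= al -> TNN_factor F ->
  TNN_factor (fun x => F x / (1 - al * (1 + al / 2) * (x - 1))).
Proof.
move=> al0 [bf f01 Tf].
pose aa := al * (1 + al / 2).
have aa0 : 0 <= aa by rewrite /aa; nra.
have g1 t : 1 <= 1 - aa * (cos t - 1) by have := cos_le1 t; nra.
have bG : bounded_at_cos R (fun x => F x / (1 - aa * (x - 1))).
  apply: bounded_at_cosM => //; rewrite /bounded_at_cos.
  apply: (bounded_meas_continuous R _ 1) => [t|t].
    apply: cvgV; first by rewrite gt_eqF // (lt_le_trans ltr01).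
    apply: cvgB; first exact: cvg_cst.
    apply: cvgM; first exact: cvg_cst.
    by apply: cvgB; [exact: continuous_cos|exact: cvg_cst].
  by rewrite ger0_norm ?invr_ge0 ?(le_trans ler01) // invf_le1 // (lt_le_trans ltr01).
have G01 t : 0 <= F (cos t) / (1 - aa * (cos t - 1)) <= 1.
  have /andP [f0 f1] := f01 t; have g0 := lt_le_trans ltr01 (g1 t).
  apply/andP; split; first by apply: divr_ge0 => //; exact: ltW.
  by rewrite ler_pdivrMr // mul1r (le_trans f1).
split => //.
apply: (TNN_alpha_factor R X N F al 1) => // t.
by have /andP [h0 h1] := G01 t; rewrite ger0_norm.
Qed.

(** Every c in [0, 1 / 2] is beta (1 - beta / 2) for beta = 1 - sqrt (1 - 2 c); this covers
    the factors of the approximation of the exponential. *)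
Lemma TNN_factor_small (c : R) F : 0 <= c <= 1 / 2 -> TNN_factor F ->
  TNN_factor (fun x => F x * (1 + c * (x - 1))).
Proof.
move=> /andP [c0 c1] HF.
pose s := Num.sqrt (1 - 2 * c).
have s0 : 0 <= s by exact: sqrtr_ge0.
have ss : s ^+ 2 = 1 - 2 * c by rewrite sqr_sqrtr //; lra.
have s1 : s <= 1 by nra.
have -> : c = (1 - s) * (1 - (1 - s) / 2).
  have -> : (1 - s) * (1 - (1 - s) / 2) = (1 - s ^+ 2) / 2 by field.
  by rewrite ss; field.
by apply: TNN_factor_beta => //; lra.
Qed.

Lemma TNN_factor_approx m : gamma w * 2 <= m%:R -> TNN_factor (Phi_approxR m).
Proof.
move=> gm; have g0 := gamma_ge0 R w hw.
have H1 k : TNN_factor (fun x => (1 + m.+1%:R^-1 * gamma w * (x - 1)) ^+ k).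
  elim: k => [|k IH]; first exact: TNN_factor1.
  have E : (fun x => (1 + m.+1%:R^-1 * gamma w * (x - 1)) ^+ k.+1) =
      (fun x => (1 + m.+1%:R^-1 * gamma w * (x - 1)) ^+ k * (1 + m.+1%:R^-1 * gamma w * (x - 1))).
    by apply/funext => x; rewrite exprSr.
  rewrite E; apply: TNN_factor_small => //.
  rewrite mulr_ge0 ?invr_ge0 //= mulrC ler_pdivrMr ?ltr0n //.
  have : m%:R <= m.+1%:R :> R by rewrite ler_nat.
  lra.
have H2 k : TNN_factor (fun x => exp_approxR m x *
    \prod_(i < k) ((1 + b i * (x - 1)) / (1 - a i * (x - 1)))).
  elim: k => [|k IH].
    have -> : (fun x => exp_approxR m x * \prod_(i < 0) ((1 + b i * (x - 1)) / (1 - a i * (x - 1))))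
        = exp_approxR m by apply/funext => x; rewrite big_ord0 mulr1.
    exact: H1.
  have b01 : 0 <= beta w k <= 1 by rewrite beta_ge0 //= beta_le1.
  have := TNN_factor_alpha _ _ (alpha_ge0 R w hw k) (TNN_factor_beta _ _ b01 IH).
  congr TNN_factor; apply/funext => x.
  by rewrite big_ord_recr /= !mulrA.
exact: H2.
Qed.

Lemma TNN_PhiR : bounded_at_cos R PhiR /\ TNN R N (Tk PhiR).
Proof.
have [n0 Hn0] : exists n0, gamma w * 2 <= n0%:R.
  by exists (Num.truncn (gamma w * 2)).+1; apply: ltW; exact: truncnS_gt.
have good n : TNN_factor (Phi_approxR (n + n0)).
  by apply: TNN_factor_approx; apply: (le_trans Hn0); rewrite ler_nat leq_addl.
have [bP Phi_kernel] := sine_kernel_dominated R X (fun n => Phi_approxR (n + n0)) PhiR 1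
  (fun n => let: And3 h _ _ := good n in h)
  (fun n t => let: And3 _ h _ := good n in
     ltac:(by have /andP [h0 h1] := h t; rewrite ger0_norm))
  (fun t => ltac:(by rewrite (cvg_shiftn n0 (fun n => Phi_approxR n (cos t)));
     apply: (PhiR_cvg _ _).1 => i; apply: nonpole_le1; exact: cos_le1)).
split => //; apply: (TNN_lim _ _ (fun n => Tk (Phi_approxR (n + n0)))) => // n.
by case: (good n).
Qed.

(** On the unit circle z ^ l - z ^ (- l) is 2 i sin (l t), and Psi takes the value Phi (cos t). *)
Lemma circle_entryE (k l : nat) :
  circle_entry w (k%:R + eps R X) (l%:R + eps R X) = (2 * Tk PhiR k l)%:C.
Proof.
rewrite /circle_entry.
rewrite (eq_circle_int R _ (fun t => (4 * (PhiR (cos t) * (sine_mode R X k t * sine_mode R X l t)))%:C)); last first.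
  move=> t.
  have -> : Psi w (cis t) = (PhiR (cos t))%:C.
    rewrite -(PhiR_cvg (cos t) _).2; last by move=> i; apply: nonpole_le1; exact: cos_le1.
    rewrite /Psi; congr (Phi w _).
    have -> : (cis t)^-1 = cis (- t).
      rewrite -[LHS]mul1r.
      have cis0 : cis t != 0 by rewrite -nc_eq0 nc_cis oner_neq0.
      apply: (mulIf cis0); rewrite mulfVK // -cisD addNr.
      by rewrite /cis cos0 sin0.
    rewrite /cis cosN sinN.
    have -> : (cos t +i* sin t + cos t -i* sin t) = (2 * cos t)%:C.
      by apply: ReIm_eq => /=; ring.
    by rewrite rmorphM rmorph_nat /= mulrAC mulfV ?mul1r // pnatr_eq0.
  have E (u : R) : cis u - cis (- u) = 0 +i* (2 * sin u).
    by rewrite /cis cosN sinN; apply: ReIm_eq => /=; ring.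
  rewrite !mulNr !E; apply: ReIm_eq; rewrite ?cReM ?cImM /= /sine_mode; ring.
rewrite circle_intE /sine_kernel /=.
rewrite (eq_I2pi _ (fun=> 0) (fun=> 0)) // I2pi_cst mul0r.
have [bP _] := TNN_PhiR.
rewrite I2piZ; last exact: bounded_meas_sine_kernel.
set I := I2pi _ _.
have p0 := pi_gt0 R.
rewrite -[Tk PhiR k l]/(pi^-1 * I).
have -> : 2 * (pi^-1 * I) = 4 * I / (2 * pi).
  have pn0 : pi != 0 :> R by rewrite gt_eqF.
  by move: pn0; move: (pi : R) => P P0; field.
by rewrite [RHS]realC_mul realC_inv.
Qed.

End RealPhi.


(** * The eigenvector equation *)

Section RowSums.
Variables (R : realType) (X : lie_series).

Let e : R := eps R X.

(** An eigenvector, as a sequence in k, of the Jacobi matrix of cos t, for the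
    eigenvalue (z + 1 / z) / 2; it solves the same recursion at the wall as the sines. *)
Definition odd_mono (z : R) k : R := z `^ (k%:R + e) - z `^ (- (k%:R + e)).
(** Dominates [odd_mono] and is a supersolution of the Jacobi recursion with
    absolute values ([even_mono_mulx_le]); it serves for the absolute convergence. *)
Definition even_mono (z : R) k : R := z `^ (k%:R + e) + z `^ (- (k%:R + e)).

Lemma odd_mono_le z k : `|odd_mono z k| <= even_mono z k.
Proof.
by rewrite /odd_mono /even_mono; have := powR_ge0 z (k%:R + e); have := powR_ge0 z (- (k%:R + e));
  rewrite ler_norml => *; lra.
Qed.

Lemma even_mono_ge0 z k : 0 <= even_mono z k.
Proof. by rewrite addr_ge0 ?powR_ge0. Qed.

Variable z : R.
Hypothesis z0 : 0 < z.

Let x : R := (z + z^-1) / 2.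

Let zD (u v : R) : z `^ (u + v) = z `^ u * z `^ v.
Proof. by rewrite powRD // (gt_eqF z0) implybT. Qed.

Let shiftS k : k.+1%:R + e = k%:R + e + 1.
Proof. by rewrite -natr1 addrAC. Qed.

Let mulx (u : R) (s : R) :
  (z + z^-1) * (z `^ u + s * z `^ (- u)) =
  (z `^ (u + 1) + s * z `^ (- (u + 1))) + (z `^ (u - 1) + s * z `^ (- (u - 1))).
Proof.
have E1 : z `^ 1 = z by rewrite powRr1 // ltW.
have E2 : z `^ (- 1) = z^-1 by rewrite powR_inv1 // ltW.
by rewrite !opprD opprK !zD E1 E2; ring.
Qed.

Lemma odd_mono_mulx k : x * odd_mono z k = (odd_mono z k.+1 + reflect_pred R X (odd_mono z) k) / 2.
Proof.
have H := mulx (k%:R + e) (-1).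
have -> : x * odd_mono z k = ((z + z^-1) * (z `^ (k%:R + e) + -1 * z `^ (- (k%:R + e)))) / 2.
  by rewrite /x /odd_mono mulN1r mulrAC.
rewrite H !mulN1r; congr ((_ + _) / 2).
  by rewrite /odd_mono shiftS.
case: k {H} => [|k] /=; last by rewrite /odd_mono shiftS addrK.
rewrite /odd_mono add0r /wall_weight /e /eps; case: X.
  have -> : 2^-1 - 1 = - 2^-1 :> R by lra.
  by rewrite opprK mulN1r opprB.
by rewrite subrr oppr0 subrr mul0r.
Qed.

Lemma even_mono_mulx_le k : even_mono z k.+1 + (if k is k'.+1 then even_mono z k' else wall_weight
    R X * even_mono z 0) <=
  2 * (x * even_mono z k).
Proof.
have H := mulx (k%:R + e) 1.
have -> : 2 * (x * even_mono z k) = (z + z^-1) * (z `^ (k%:R + e) + 1 * z `^ (- (k%:R + e))).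
  by rewrite /x /even_mono mul1r; field; rewrite gt_eqF.
rewrite H !mul1r; apply: lerD.
  by rewrite /even_mono shiftS.
case: k {H} => [|k] /=; last by rewrite /even_mono shiftS addrK.
rewrite /even_mono add0r /wall_weight /e /eps; case: X.
  have -> : 2^-1 - 1 = - 2^-1 :> R by lra.
  by rewrite opprK mul1r addrC.
by rewrite mul0r addr_ge0 ?powR_ge0.
Qed.

(** The powers of the Jacobi matrix. *)
Definition monomial_kernel i : nat -> nat -> R := sine_kernel R X (fun y => y ^+ i).

Lemma bounded_at_cos_expr i : bounded_at_cos R (fun y : R => y ^+ i).
Proof.
elim: i => [|i IH]; first exact: bounded_at_cos_cst.
have -> : (fun y : R => y ^+ i.+1) = (fun y => y * y ^+ i) by apply/funext => y; rewrite exprS.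
by apply: bounded_at_cosM => //; exact: bounded_at_cos_id.
Qed.

Lemma sine_kernel_sym F k l : sine_kernel R X F k l = sine_kernel R X F l k.
Proof. by congr (_ * _); apply: eq_I2pi => t; rewrite [sine_mode _ _ _ _ * _]mulrC. Qed.

Lemma monomial_kernel_rec i k l : monomial_kernel i.+1 k l = (monomial_kernel i k.+1 l +
    reflect_pred R X (fun j => monomial_kernel i j l) k) / 2.
Proof.
rewrite /monomial_kernel sine_kernel_sym.
have -> : (fun y : R => y ^+ i.+1) = (fun y => y * y ^+ i) by apply/funext => y; rewrite exprS.
rewrite sine_kernel_mulx; last exact: bounded_at_cos_expr.
rewrite sine_kernel_sym; congr ((_ + _) / 2).
by case: k => [|k] /=; rewrite sine_kernel_sym.
Qed.

Lemma monomial_kernel0 k l : monomial_kernel 0 k l = (k == l)%:R.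
Proof. exact: sine_kernel_one. Qed.

Lemma sum_monomial_kernel_le i k M : \sum_(m < M) `|monomial_kernel i k m| * even_mono z m <= x ^+ i * even_mono z k.
Proof.
have x0 : 0 <= x by rewrite divr_ge0 // addr_ge0 ?invr_ge0 // ltW.
elim: i k => [|i IH] k.
  rewrite expr0 mul1r; under eq_bigr do rewrite monomial_kernel0 normr_nat mulrC.
  have [kM|kM] := ltnP k M; first by rewrite sum_delta.
  rewrite big1 ?even_mono_ge0 // => j _.
  by rewrite (gtn_eqF (leq_trans (ltn_ord j) kM)) mulr0.
pose lw m := if k is k'.+1 then `|monomial_kernel i k' m| else wall_weight R X * `|monomial_kernel i 0 m|.
have /andP [k0 k1] := wall_weight01 R X.
have H m : `|monomial_kernel i.+1 k m| * even_mono z m <=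
    2^-1 * (`|monomial_kernel i k.+1 m| * even_mono z m + lw m * even_mono z m).
  rewrite monomial_kernel_rec normrM (@ger0_norm _ 2^-1) // -mulrDl mulrA [2^-1 * _]mulrC.
  apply: ler_wpM2r; first exact: even_mono_ge0.
  apply: ler_wpM2r => //; apply: (le_trans (ler_normD _ _)); rewrite lerD2l /lw.
  by case: k {IH lw} => [|k] //=; rewrite normrM normrN (ger0_norm k0).
apply: (@le_trans _ _ (\sum_(m < M) 2^-1 * (`|monomial_kernel i k.+1 m| * even_mono z m + lw m * even_mono z m))).
  by apply: ler_sum => m _; exact: H.
rewrite -mulr_sumr big_split /= exprS.
rewrite mulrC ler_pdivrMr //.
apply: (le_trans (lerD (IH k.+1) (_ : _ <= x ^+ i * (if k is k'.+1 then even_mono z k' else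
    wall_weight R X * even_mono z 0)))).
  rewrite /lw; case: k {H lw} => [|k]; last exact: IH.
  under eq_bigr do rewrite -mulrA.
  rewrite -mulr_sumr mulrCA; apply: ler_wpM2l => //; exact: IH.
rewrite -mulrDr.
have -> : x * x ^+ i * even_mono z k * 2 = x ^+ i * (2 * (x * even_mono z k)) by ring.
by apply: ler_wpM2l; [exact: exprn_ge0|exact: even_mono_mulx_le].
Qed.

(** A power i of a tridiagonal matrix reaches only the positions up to k + i, hence the
    condition on the truncation. *)
Lemma sum_monomial_kernel i k M : (k + i < M)%N -> \sum_(m < M) monomial_kernel i k m * odd_mono z
    m = x ^+ i * odd_mono z k.
Proof.
elim: i k => [|i IH] k kM.
  rewrite expr0 mul1r; under eq_bigr do rewrite monomial_kernel0 mulrC.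
  by rewrite sum_delta //; rewrite addn0 in kM.
under eq_bigr do rewrite monomial_kernel_rec mulrAC mulrDl.
rewrite -mulr_suml big_split /= IH; last by rewrite addSnnS.
rewrite exprSr -[RHS]mulrA odd_mono_mulx [RHS]mulrA [x ^+ i * (_ + reflect_pred _ _ _ _)]mulrDr; congr ((_ + _) / 2).
case: k kM => [|k] kM /=; last by apply: IH; lia.
under eq_bigr do rewrite -mulrA.
by rewrite -mulr_sumr IH; [ring|lia].
Qed.

Variables (c : nat -> R) (C rho : R) (F : R -> R).
Hypotheses (cC : forall i, `|c i| <= C * rho ^- i) (xrho : x < rho).
Hypothesis FE : forall y, -1 <= y <= 1 -> series (fun i => c i * y ^+ i) @ \oo --> F y.
Hypothesis FxE : series (fun i => c i * x ^+ i) @ \oo --> F x.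

Let x_ge1 : 1 <= x.
Proof. exact: half_add_inv_ge1. Qed.

Let C0 : 0 <= C.
Proof. by have := cC 0; rewrite expr0 invr1 mulr1; exact: le_trans. Qed.

Let rho0 : 0 < rho. Proof. by rewrite (lt_trans _ xrho) // (lt_le_trans ltr01). Qed.

Lemma sine_kernel_power_series k l : series (fun i => c i * monomial_kernel i k l) @ \oo --> sine_kernel R X F k l.
Proof.
pose Fn n y := \sum_(0 <= i < n) c i * y ^+ i.
have bFn n : bounded_at_cos R (Fn n).
  elim: n => [|n IH].
    have -> : Fn 0 = (fun=> 0) by apply/funext => y; rewrite /Fn big_geq.
    exact: bounded_at_cos_cst.
  have -> : Fn n.+1 = (fun y => Fn n y + c n * y ^+ n).
    by apply/funext => y; rewrite /Fn big_nat_recr.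
  by apply: bounded_at_cosD => //; apply: bounded_at_cosM; [exact: bounded_at_cos_cst|exact: bounded_at_cos_expr].
have TFn n : sine_kernel R X (Fn n) k l = \sum_(0 <= i < n) c i * monomial_kernel i k l.
  elim: n => [|n IH].
    rewrite big_geq // (eq_sine_kernel R X _ (fun y => 0 * 1 + 0 * 1)).
      by rewrite sine_kernel_linear ?mul0r ?addr0 //; exact: bounded_at_cos_cst.
    by move=> t; rewrite /Fn big_geq // !mul0r addr0.
  rewrite big_nat_recr //= -IH.
  rewrite (eq_sine_kernel R X _ (fun y => 1 * Fn n y + c n * y ^+ n)).
    by rewrite sine_kernel_linear ?mul1r //; exact: bounded_at_cos_expr.
  by move=> t; rewrite /Fn big_nat_recr //= mul1r.
have cos1 (t : R) : -1 <= cos t <= 1 by rewrite cos_geN1 cos_le1.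
have Fn_le n t : `|Fn n (cos t)| <= C * (1 - rho^-1)^-1.
  have rho1 : rho^-1 < 1 by rewrite invf_lt1 // (le_lt_trans x_ge1).
  apply: le_trans (ler_wpM2l C0 (geometric_sum_le R _ n _ rho1)); last by rewrite invr_ge0 ltW.
  rewrite mulr_sumr; apply: (le_trans (ler_norm_sum _ _ _)); apply: ler_sum => i _.
  rewrite normrM exprVn -[leRHS]mulr1; apply: ler_pM => //.
  by rewrite normrX exprn_ile1 // ler_norml.
have [_ H] := sine_kernel_dominated R X Fn F (C * (1 - rho^-1)^-1) bFn Fn_le
  (fun t => FE (cos t) (cos1 t)).
have -> : series (fun i => c i * monomial_kernel i k l) = (fun n => sine_kernel R X (Fn n) k l).
  by apply/funext => n; rewrite TFn.
exact: H.
Qed.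

(** Exchange of the limit in M with the power series: by [sum_monomial_kernel] a
    truncation at M alters the eigenvector equation only for the powers i >= M - k, and
    the geometric bound on the coefficients makes the total error small. *)
Lemma sine_kernel_row_sum k :
  \sum_(m < M) sine_kernel R X F k m * odd_mono z m @[M --> \oo] --> F x * odd_mono z k.
Proof.
have x0 : 0 <= x by rewrite (le_trans ler01).
pose q := x / rho.
have q0 : 0 <= q by rewrite divr_ge0 // ltW.
have q1 : q < 1 by rewrite ltr_pdivrMr // mul1r.
pose B := 2 * even_mono z k * C * (1 - q)^-1.
have main M : (k <= M)%N ->
    `|\sum_(m < M) sine_kernel R X F k m * odd_mono z m - F x * odd_mono z k| <= B * q ^+ (M - k).
  move=> kM.
  have L : \sum_(0 <= i < n) c i * (\sum_(m < M) monomial_kernel i k m * odd_mono z m - x ^+ i * odd_mono z k)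
      @[n --> \oo] --> \sum_(m < M) sine_kernel R X F k m * odd_mono z m - F x * odd_mono z k.
    have -> : (fun n => \sum_(0 <= i < n) c i * (\sum_(m < M) monomial_kernel i k m * odd_mono z m
        - x ^+ i * odd_mono z k))
      = (fun n => \sum_(m < M) series (fun i => c i * monomial_kernel i k m) n * odd_mono z m -
            series (fun i => c i * x ^+ i) n * odd_mono z k).
      apply/funext => n; rewrite /series /= mulr_suml.
      have -> : \sum_(m < M) (\sum_(0 <= i < n) c i * monomial_kernel i k m) * odd_mono z m =
          \sum_(0 <= i < n) c i * \sum_(m < M) monomial_kernel i k m * odd_mono z m.
        under eq_bigr do rewrite mulr_suml.
        rewrite exchange_big /=; apply: eq_bigr => i _; rewrite mulr_sumr.
        by apply: eq_bigr => m _; rewrite mulrA.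
      by rewrite -sumrB; apply: eq_bigr => i _; rewrite mulrBr mulrA.
    apply: cvgB; last by apply: cvgM; [exact: FxE|exact: cvg_cst].
    apply: cvgr_sum => m _; apply: cvgM; last exact: cvg_cst.
    exact: sine_kernel_power_series.
  apply: (cvgr_to_le (cvg_norm L)); apply: nearW => n.
  apply: (le_trans (ler_norm_sum _ _ _)).
  (* Terms with k + i < M vanish. *)
  have T1 i : `|c i * (\sum_(m < M) monomial_kernel i k m * odd_mono z m - x ^+ i * odd_mono z k)| <=
      if (M - k <= i)%N then 2 * even_mono z k * C * q ^+ i else 0.
    case: leqP => [_|iM]; last first.
      by rewrite sum_monomial_kernel ?subrr ?mulr0 ?normr0 //; lia.
    rewrite normrM.
    have -> : 2 * even_mono z k * C * q ^+ i = (C * rho ^- i) * (x ^+ i * even_mono z k + x ^+ i * even_mono z k).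
      by rewrite /q exprMn exprVn; ring.
    apply: ler_pM => //; apply: (le_trans (ler_normB _ _)); apply: lerD.
      apply: le_trans (sum_monomial_kernel_le i k M); apply: (le_trans (ler_norm_sum _ _ _)).
      apply: ler_sum => m _; rewrite normrM; apply: ler_wpM2l => //; exact: odd_mono_le.
    rewrite normrM normrX (ger0_norm x0); apply: ler_wpM2l; first exact: exprn_ge0.
    exact: odd_mono_le.
  apply: (@le_trans _ _ (\sum_(0 <= i < n | (M - k <= i)%N) 2 * even_mono z k * C * q ^+ i)).
    by rewrite [leRHS]big_mkcond /=; apply: ler_sum => i _; exact: T1.
  rewrite -mulr_sumr /B -[leRHS]mulrA; apply: ler_wpM2l.
    by rewrite !mulr_ge0 // even_mono_ge0.
  apply: (@le_trans _ _ (\sum_(0 <= i < n) q ^+ i * q ^+ (M - k))); last first.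
    by rewrite -mulr_suml; apply: ler_wpM2r; [exact: exprn_ge0|exact: geometric_sum_le].
  have Hq d : \sum_(0 <= i < n | (d <= i)%N) q ^+ i <= \sum_(0 <= i < n) q ^+ i * q ^+ d.
    have [dn|dn] := leqP d n; last first.
      rewrite big_nat_cond big1 ?sumr_ge0 // => [i _|i /andP [/andP [_ in_] di]].
        by rewrite mulr_ge0 ?exprn_ge0.
      by have := leq_ltn_trans di (ltn_trans in_ dn); rewrite ltnn.
    rewrite (big_cat_nat (leq0n d) dn) /= [X in X + _]big_nat_cond big1 ?add0r; last first.
      by move=> i /andP [/andP [_ id] di]; rewrite ltnNge di in id.
    rewrite -{1}[d]add0n big_addn [X in _ <= X](big_cat_nat (leq0n (n - d)) (leq_subr _ _)) /=.
    rewrite -[X in X <= _]addr0; apply: lerD.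
      rewrite (eq_bigl xpredT) => [|i]; last by rewrite leq_addl.
      by apply: ler_sum => i _; rewrite exprD.
    by rewrite sumr_ge0 // => i _; rewrite mulr_ge0 ?exprn_ge0.
  exact: Hq.
apply: cvg_dist0.
rewrite -(cvg_shiftn k) /=.
have K : B * q ^+ M @[M --> \oo] --> (B * 0 : R).
  by apply: cvgM; [exact: cvg_cst|apply: cvg_expr; rewrite ger0_norm].
rewrite mulr0 in K; apply: (squeeze_cvgr _ (cvg_cst 0) K); apply: nearW => M.
rewrite normr_ge0 /=; apply: le_trans (main _ (leq_addl _ _)) _.
by rewrite addnK.
Qed.

End RowSums.


(** * The numerator of f at powers of q *)

Section QDimension.
Variables (R : realType) (X : lie_series) (q : R).
Hypotheses (q0 : 0 < q) (q1 : q < 1).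

Let e : R := eps R X.

Lemma eps_gt0 : 0 < e.
Proof. by rewrite /e /eps; case: X; rewrite ?ltr01 // invr_gt0. Qed.

Definition qpoint (k : nat) : R := q `^ (k%:R + e).

Lemma qpoint_gt0 k : 0 < qpoint k.
Proof. exact: powR_gt0. Qed.

Lemma ke_gt0 k : 0 < k%:R + e.
Proof. by rewrite ltr_wpDl // eps_gt0. Qed.

(** Both sides are q ^ a - q ^ (- a) for a = (j + eps) (k + eps); this exchanges the roles of
    the signature and of the points q ^ c. *)
Lemma odd_mono_sym j k : odd_mono R X (qpoint j) k = odd_mono R X (qpoint k) j.
Proof.
by rewrite /odd_mono /qpoint -!powRrM !mulrN [(j%:R + _) * _]mulrC.
Qed.

(** The Chebyshev polynomials of the second kind, for C, or fourth kind, for B, in the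
    monic normalization with variable z + 1 / z. *)
Fixpoint chebyshev n : {poly R} :=
  match n with
  | 0%N => 1
  | n'.+1 => if n' is n''.+1 then 'X * chebyshev n' - chebyshev n''
             else 'X + (wall_weight R X)%:P
  end.

Lemma chebyshevS n : chebyshev n.+2 = 'X * chebyshev n.+1 - chebyshev n.
Proof. by []. Qed.

Lemma chebyshev_lead n : size (chebyshev n) = n.+1 /\ chebyshev n \is monic.
Proof.
suff : (size (chebyshev n) = n.+1 /\ chebyshev n \is monic) /\
       (size (chebyshev n.+1) = n.+2 /\ chebyshev n.+1 \is monic) by case.
elim: n => [|n [[s0 m0] [s1 m1]]].
  split; first by rewrite size_poly1 monic1.
  by rewrite /= -[wall_weight R X]opprK polyCN size_XsubC monicXsubC.
split; first by split.
have sX : size ('X * chebyshev n.+1) = n.+3.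
  by rewrite mulrC size_mulX ?s1 // -size_poly_eq0 s1.
have lt : (size (- chebyshev n)%R < size ('X * chebyshev n.+1)%R)%N by rewrite size_polyN s0 sX.
rewrite chebyshevS size_polyDl // sX; split => //.
by rewrite monicE lead_coefDl // lead_coefM lead_coefX mul1r -monicE.
Qed.

Lemma odd_mono_chebyshev z k : 0 < z -> odd_mono R X z k = odd_mono R X z 0 * (chebyshev k).[z + z^-1].
Proof.
move=> z0.
have H n : odd_mono R X z n.+1 = (z + z^-1) * odd_mono R X z n - reflect_pred R X (odd_mono R X z) n.
  have := odd_mono_mulx R X z z0 n; lra.
suff : odd_mono R X z k = odd_mono R X z 0 * (chebyshev k).[z + z^-1] /\
       odd_mono R X z k.+1 = odd_mono R X z 0 * (chebyshev k.+1).[z + z^-1] by case.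
elim: k => [|k [IH1 IH2]].
  rewrite H /= hornerC hornerD hornerX hornerC; split; ring.
split => //; rewrite H IH2 /= -/(chebyshev k.+1) IH1 hornerD hornerN hornerM hornerX; ring.
Qed.

Variable N : nat.

(** The numerator of f at the points q ^ c, with the denominators of its entries cleared. *)
Definition detS (f : 'I_N -> nat) : R := \det (\matrix_(i < N, j < N) odd_mono R X (qpoint j) (f i)).

Definition qpoint_trace k : R := qpoint k + (qpoint k)^-1.

(** After [odd_mono_sym] the columns are monic polynomials of increasing degree in the
    variables z + 1 / z at the points z = q ^ (f i + eps), up to a common factor in each
    row. *)
Lemma detS_product (f : 'I_N -> nat) : detS f = (\prod_(i < N) odd_mono R X (qpoint (f i)) 0) *
  \prod_(i < N) \prod_(j < N | (i < j)%N) (qpoint_trace (f j) - qpoint_trace (f i)).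
Proof.
rewrite /detS.
pose V := Vandermonde N (\row_(i < N) qpoint_trace (f i)).
pose Cf := \matrix_(k < N, j < N) (chebyshev j)`_k.
have -> : \matrix_(i < N, j < N) odd_mono R X (qpoint j) (f i) =
    diag_mx (\row_(i < N) odd_mono R X (qpoint (f i)) 0) *m (V^T *m Cf).
  apply/matrixP => i j; rewrite mul_diag_mx !mxE odd_mono_sym odd_mono_chebyshev ?qpoint_gt0 //.
  congr (_ * _); rewrite (horner_coef_wide (n := N)); last first.
    by rewrite (chebyshev_lead j).1.
  by apply: eq_bigr => k _; rewrite !mxE mulrC.
rewrite !det_mulmx det_diag det_tr det_Vandermonde.
have -> : \det Cf = 1.
  rewrite -det_tr det_trig.
    apply: big1 => i _; rewrite !mxE.
    by have [s /monicP m] := chebyshev_lead i; rewrite -m lead_coefE s.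
  apply/is_trig_mxP => i j ij; rewrite !mxE nth_default //.
  by rewrite (chebyshev_lead i).1.
rewrite mulr1; congr (_ * _); first by apply: eq_bigr => i _; rewrite mxE.
by apply: eq_bigr => i _; apply: eq_bigr => j _; rewrite !mxE.
Qed.

Lemma ltr_powR_lt1 (a u v : R) : 0 < a -> a < 1 -> u < v -> a `^ v < a `^ u.
Proof.
move=> a0 a1 uv; rewrite /powR !gt_eqF // ltr_expR ltr_nM2r //.
by apply: ln_lt0; rewrite a0 a1.
Qed.

Lemma qpoint_lt1 k : qpoint k < 1.
Proof. by rewrite -(powRr0 q); apply: ltr_powR_lt1 => //; exact: ke_gt0. Qed.

Lemma qpoint_anti j k : (j < k)%N -> qpoint k < qpoint j.
Proof. by move=> jk; apply: ltr_powR_lt1 => //; rewrite ltrD2r ltr_nat. Qed.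

Lemma qpoint_trace_mono j k : (j < k)%N -> qpoint_trace j < qpoint_trace k.
Proof.
move=> jk; rewrite /qpoint_trace -subr_gt0.
have zj := qpoint_gt0 j; have zk := qpoint_gt0 k.
have -> : qpoint k + (qpoint k)^-1 - (qpoint j + (qpoint j)^-1) =
    (qpoint j - qpoint k) * (1 - qpoint j * qpoint k) / (qpoint j * qpoint k).
  by field; rewrite !gt_eqF.
rewrite divr_gt0 ?mulr_gt0 ?subr_gt0 ?qpoint_anti //.
by rewrite mulr_ilt1 ?ltW ?qpoint_lt1 // ltW.
Qed.

Lemma odd_mono_lt0 k : odd_mono R X (qpoint k) 0 < 0.
Proof.
rewrite /odd_mono subr_lt0; apply: ltr_powR_lt1; [exact: qpoint_gt0|exact: qpoint_lt1|].
by rewrite (lt_trans _ (ke_gt0 0)) // oppr_lt0 ke_gt0.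
Qed.

(** The sign is that of the order of the factors, which is the same for all strictly
    decreasing families. *)
Lemma detS_sign : exists s : R, forall f : 'I_N -> nat, strictly_decr N f -> 0 < s * detS f.
Proof.
exists ((\prod_(i < N) (-1)) * \prod_(i < N) \prod_(j < N | (i < j)%N) (-1)) => f sf.
rewrite detS_product mulrACA; apply: mulr_gt0; rewrite -big_split /=.
  by apply: prodr_gt0 => i _; rewrite mulN1r oppr_gt0 odd_mono_lt0.
apply: prodr_gt0 => i _; rewrite -big_split /=; apply: prodr_gt0 => j ij.
by rewrite mulN1r opprB subr_gt0 qpoint_trace_mono //; apply: (strictly_decrP _ _ sf).
Qed.

Lemma detS_ratio_gt0 (f g : 'I_N -> nat) : strictly_decr N f -> strictly_decr N g ->
  0 < detS f / detS g.
Proof.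
have [s Hs] := detS_sign => /Hs pf /Hs pg.
have s0 : s != 0 by apply: contraTneq pf => ->; rewrite mul0r ltxx.
have g0 : detS g != 0 by apply: contraTneq pg => ->; rewrite mulr0 ltxx.
have -> : detS f / detS g = (s * detS f) / (s * detS g) by field; rewrite s0 g0.
exact: divr_gt0.
Qed.

Lemma detS_neq0 (f : 'I_N -> nat) : strictly_decr N f -> detS f != 0.
Proof.
have [s Hs] := detS_sign => /Hs pf.
by apply: contraTneq pf => ->; rewrite mulr0 ltxx.
Qed.

End QDimension.


(** * The transition matrix *)

Section Positions.
Variable n : nat.
Let N := n.+1.

(** The distinct nonnegative integers l_i - eps. *)
Definition pos (la : Splus N) (i : 'I_N) : nat := (`|val la i|%N + (n - i))%N.

Lemma sig_le (la : Splus N) (i j : 'I_N) : (i <= j)%N -> val la j <= val la i.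
Proof. by case: la => l /= /andP [/forallP /(_ i) /forallP /(_ j) /implyP]. Qed.

Lemma sig_ge0 (la : Splus N) (i : 'I_N) : 0 <= val la i.
Proof. by case: la => l /= /andP [_ /forallP]. Qed.

Lemma leq_ordN (j : 'I_N) : (j <= n)%N.
Proof. by rewrite -ltnS; exact: ltn_ord. Qed.

Lemma strictly_decr_pos la : strictly_decr N (pos la).
Proof.
apply/strictly_decrP => i j ij; rewrite /pos.
have := sig_le la i j (ltnW ij); have := sig_ge0 la i; have := sig_ge0 la j.
have jn := leq_ordN j; case: (val la i) => // a; case: (val la j) => // b _ _.
rewrite lez_nat /=; lia.
Qed.

Lemma pos_inj : injective pos.
Proof.
move=> la mu E; apply: val_inj; apply/ffunP => i.
have := congr1 (fun f => f i) E; rewrite /pos.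
have := sig_ge0 la i; have := sig_ge0 mu i.
by case: (val la i) => // a; case: (val mu i) => // b /= _ _ /addIn ->.
Qed.

Lemma pos_surj (f : 'I_N -> nat) : strictly_decr N f -> exists la, pos la = f.
Proof.
move=> sf.
have gap_top (d : nat) (i : 'I_N) : (i + d = n)%N -> (d <= f i)%N.
  elim: d i => // d IH i id.
  have lt : (i.+1 < N)%N by rewrite ltnS; lia.
  have := IH (Ordinal lt); rewrite /= => /(_ ltac:(lia)).
  move=> H; apply: (leq_ltn_trans H); apply: (strictly_decrP _ _ sf) => /=; exact: ltnSn.
have fl (i : 'I_N) : (n - i <= f i)%N.
  by apply: gap_top; rewrite subnKC // -ltnS ltn_ord.
pose l := [ffun i : 'I_N => ((f i - (n - i))%N : int)].
have gap (d : nat) (i j : 'I_N) : (i + d = j)%N -> (f j + d <= f i)%N.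
  elim: d i => [|d IH] i id; first by rewrite addn0; rewrite addn0 in id; rewrite (val_inj id).
  have lt : (i.+1 < N)%N by rewrite ltnS; have := leq_ordN j; lia.
  have := IH (Ordinal lt); rewrite /= => /(_ ltac:(lia)).
  have := strictly_decrP _ _ sf i (Ordinal lt) (ltnSn i); lia.
have sl : is_signature l.
  apply/andP; split; apply/forallP => i; last by rewrite ffunE.
  apply/forallP => j; apply/implyP => ij; rewrite !ffunE lez_nat.
  have := gap (j - i)%N i j (subnKC ij).
  by have := fl i; have := fl j; have := leq_ordN i; have := leq_ordN j; lia.
exists (exist _ l sl); apply/funext => i; rewrite /pos /= ffunE /= subnK //.
Qed.

End Positions.

Section Transition.
Variables (R : realType) (q : R).
Hypotheses (q0 : 0 < q) (q1 : q < 1).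
Variables (X : lie_series) (n : nat).
Let N := n.+1.
Variable w : params R.
Hypothesis hw : in_Omega w.
Hypothesis hpos : forall i : 'I_N, 0 < Psi w (q `^ cX R X i.+1)%:C.
Hypothesis hTaylor : Taylor_cvg_annulus w (fun i : 'I_N => qX X q i.+1).

Let e : R := eps R X.
Let zz j := qpoint R X q j.

Definition qnode j : R := (zz j + (zz j)^-1) / 2.

Lemma cXE k : cX R X k.+1 = k%:R + e.
Proof. by rewrite /cX -natr1 addrK. Qed.

Lemma qX_qnode j : qX X q j.+1 = qnode j.
Proof. by rewrite /qX cXE powRN. Qed.

Lemma Psi_qpoint j : Psi w (zz j)%:C = Phi w (qnode j)%:C.
Proof.
rewrite /Psi /qnode; congr (Phi w _).
by rewrite [RHS]realC_mul [in RHS]rmorphD /= !realC_inv rmorph_nat.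
Qed.

Lemma PhiR_qnode (j : 'I_N) : Phi w (qnode j)%:C = (PhiR R w (qnode j))%:C /\ 0 < PhiR R w (qnode j).
Proof.
have := hpos j; rewrite cXE -/(qpoint R X q j) -/(zz j) Psi_qpoint ltcE /= => /andP [/eqP E H].
by split => //; apply: ReIm_eq => //=; rewrite E.
Qed.

Lemma Re_power_series (c : nat -> R[i]) (y : R) (l : R[i]) :
  series (fun k => c k * y%:C ^+ k) @ \oo --> (l : Cplx R) ->
  series (fun k => complex.Re (c k) * y ^+ k) @ \oo --> complex.Re l.
Proof.
move=> /cvgC_ReIm [H _].
have -> : series (fun k => complex.Re (c k) * y ^+ k) =
    (fun k => complex.Re (series (fun k => c k * y%:C ^+ k) k)).
  apply/funext => k; rewrite /series /=.
  elim: k => [|k IH]; first by rewrite !big_geq.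
  rewrite !big_nat_recr //= cReD IH; congr (_ + _).
  by rewrite cReM -rmorphXn /= mulr0 subr0.
exact: H.
Qed.

Lemma qnode_le_max (j : 'I_N) : qnode j <= qnode n.
Proof.
rewrite /qnode ler_pM2r ?invr_gt0 //.
have [->//|jn] := eqVneq (j : nat) n.
by apply: ltW; apply: (qpoint_trace_mono R X q q0 q1); rewrite ltn_neqAle jn -ltnS ltn_ord.
Qed.

Lemma qnode_ge1 j : 1 <= qnode j.
Proof. by apply: half_add_inv_ge1; exact: qpoint_gt0. Qed.

Let Phi_kernel := sine_kernel R X (PhiR R w).

Lemma Phi_kernel_row_sum (j : 'I_N) k :
  \sum_(m < M) Phi_kernel k m * odd_mono R X (zz j) m @[M --> \oo] --> PhiR R w (qnode j) * odd_mono R X (zz j) k.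
Proof.
have [r1 [r2 [r10 Hr hT]]] := hTaylor.
have Hr' (i : 'I_N) : r1 < qnode i < r2 by have := Hr i; rewrite qX_qnode.
have /andP [rn1 rn2] := Hr' ord_max.
have [rho [C [xrho cC HT]]] := Phi_Taylor R w (qnode n) r1 r2 hw (qnode_ge1 n) rn1 rn2 hT.
apply: (sine_kernel_row_sum R X (zz j) (qpoint_gt0 R X q q0 j) (fun i => complex.Re (phi w i)) C rho).
- by move=> i; apply: le_trans (Re_le_nc _ _) (cC i).
- exact: le_lt_trans (qnode_le_max j) xrho.
- by move=> y hy; exact: Re_power_series (HT y hy).
- apply: (Re_power_series _ _ _ (hT _ _)).
  have /andP [h1 h2] := Hr' j.
  by rewrite -ncE ncR ger0_norm ?(le_trans ler01 (qnode_ge1 j)) // !ltcR h1 h2.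
Qed.

Lemma shiftedE la i : shifted R X la i = (pos n la i)%:R + e.
Proof.
rewrite /shifted /pos.
have -> : (N - i = (n - i).+1)%N by rewrite /N subSn // -ltnS ltn_ord.
rewrite cXE addrA natrD; congr (_ + _ + _).
by have := sig_ge0 n la i; case: (val la i).
Qed.

Definition detT (f g : 'I_N -> nat) : R := \det (\matrix_(i < N, j < N) Phi_kernel (f i) (g j)).
Definition PhiProd : R := \prod_(j < N) PhiR R w (qnode j).

Lemma PhiProd_gt0 : 0 < PhiProd.
Proof. by apply: prodr_gt0 => j _; exact: (PhiR_qnode j).2. Qed.

(** The transition probability for arbitrary position families, so that it can be
    summed over finite boxes before positions are matched with signatures. *)
Definition transition_weight (f g : 'I_N -> nat) : R :=
  detS R X q N g / detS R X q N f * (detT f g / PhiProd).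

Lemma transition_weight_ge0 f g : strictly_decr N f -> strictly_decr N g -> 0 <= transition_weight f g.
Proof.
move=> sf sg; apply: mulr_ge0; first by apply: ltW; exact: detS_ratio_gt0.
apply: divr_ge0; last by apply: ltW; exact: PhiProd_gt0.
by have [_] := TNN_PhiR R w hw X N; apply.
Qed.

Definition transition (la mu : Splus N) : R := transition_weight (pos n la) (pos n mu).

Lemma fXE la : fX X la (fun i : 'I_N => q `^ cX R X i.+1) =
  detS R X q N (pos n la) * ((\prod_(j < N) (odd_mono R X (zz j) 0)^-1) /
    \prod_(i < N) \prod_(j < N | (i < j)%N) (qpoint_trace R X q i - qpoint_trace R X q j)).
Proof.
rewrite /fX mulrA; congr (_ / _).
  rewrite /detS -det_tr; set A := \matrix_(_, _) _.
  have -> : A^T = diag_mx (\row_(j < N) (odd_mono R X (zz j) 0)^-1) *m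
     (\matrix_(i < N, j < N) odd_mono R X (qpoint R X q j) (pos n la i))^T.
    apply/matrixP => i j; rewrite mul_diag_mx !mxE shiftedE cXE mulrC.
    by rewrite /odd_mono add0r.
  rewrite det_mulmx det_diag det_tr mulrC; congr (_ * _).
  by apply: eq_bigr => j _; rewrite mxE.
apply: eq_bigr => i _; apply: eq_bigr => j _; rewrite !cXE /qpoint_trace /qpoint opprD addrA //.
Qed.

(** The Vandermonde denominators and the factors of the columns cancel in the quotient
    of the values of f. *)
Lemma generator_formulaE la mu :
  generator_formula X q w la mu = (transition la mu - (la == mu)%:R)%:C.
Proof.
rewrite /generator_formula rmorphB rmorph_nat; congr (_ - _).
rewrite /transition /transition_weight [RHS]rmorphM /=; congr (_%:C * _).
  rewrite !fXE invfM mulrACA [X in _ * X = _](_ : _ = 1) ?mulr1 //.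
  apply: mulfV; apply: mulf_neq0.
    by apply/prodf_neq0 => j _; rewrite invr_neq0 // lt_eqF // odd_mono_lt0.
  rewrite invr_neq0 //; apply/prodf_neq0 => i _; apply/prodf_neq0 => j ij.
  by rewrite lt_eqF // subr_lt0 qpoint_trace_mono.
have -> : \prod_(j < N) Psi w (q `^ cX R X j.+1)%:C = PhiProd%:C.
  rewrite /PhiProd rmorph_prod; apply: eq_bigr => j _.
  by rewrite cXE -/(qpoint R X q j) -/(zz j) Psi_qpoint (PhiR_qnode j).1.
have -> : \matrix_(i < N, j < N) circle_entry w (shifted R X la i) (shifted R X mu j) =
    map_mx (real_complex R) (2 *: \matrix_(i < N, j < N) Phi_kernel (pos n la i) (pos n mu j)).
  by apply/matrixP => i j; rewrite !mxE !shiftedE circle_entryE.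
rewrite det_map_mx detZ /detT.
have E (d f : R) : (2 ^+ N * d)%:C / (2 ^+ N * f%:C) = (d / f)%:C.
  rewrite !realC_mul realC_inv rmorphXn /= rmorph_nat.
  by rewrite -mulf_div mulfV ?mul1r // expf_neq0 // pnatr_eq0.
exact: E.
Qed.

(** For the positions below M the sum is, by Cauchy-Binet, a determinant of truncated
    one-particle sums, to which the eigenvector equation applies entrywise. *)
Lemma transition_weight_sum_cvg f : strictly_decr N f ->
  \sum_(h : {ffun 'I_N -> 'I_M} | strictly_decr N (fun i => h i)) transition_weight f (fun i => h i)
    @[M --> \oo] --> (1 : R).
Proof.
move=> sf.
have fn0 := detS_neq0 R X q q0 q1 N f sf.
have P0 := PhiProd_gt0.
have -> : (fun M => \sum_(h : {ffun 'I_N -> 'I_M} | strictly_decr N (fun i => h i))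
    transition_weight f (fun i => h i)) =
   (fun M => (detS R X q N f * PhiProd)^-1 *
     \det (\matrix_(i < N, j < N) \sum_(m < M) Phi_kernel (f i) m * odd_mono R X (zz j) m)).
  apply/funext => M.
  have -> : \matrix_(i < N, j < N) (\sum_(m < M) Phi_kernel (f i) m * odd_mono R X (zz j) m) =
     (\matrix_(i < N, m < M) Phi_kernel (f i) m) *m (\matrix_(m < M, j < N) odd_mono R X (zz j) m).
    by apply/matrixP => i j; rewrite !mxE; apply: eq_bigr => m _; rewrite !mxE.
  rewrite Cauchy_Binet mulr_sumr; apply: eq_bigr => h _.
  rewrite /transition_weight /detT /detS.
  have -> : \matrix_(i, j) (\matrix_(i0 < N, m < M) Phi_kernel (f i0) m) i (h j) =
     \matrix_(i < N, j < N) Phi_kernel (f i) (h j) by apply/matrixP => i j; rewrite !mxE.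
  have -> : \matrix_(i, j) (\matrix_(m < M, j0 < N) odd_mono R X (zz j0) m) (h i) j =
     \matrix_(i < N, j < N) odd_mono R X (qpoint R X q j) (h i) by apply/matrixP => i j; rewrite !mxE.
  rewrite invfM; ring.
have L : \det (\matrix_(i < N, j < N) \sum_(m < M) Phi_kernel (f i) m * odd_mono R X (zz j) m)
    @[M --> \oo] --> \det (\matrix_(i < N, j < N) (PhiR R w (qnode j) * odd_mono R X (zz j) (f i))).
  apply: cvgr_det => i j; rewrite mxE.
  under eq_cvg do rewrite mxE.
  exact: Phi_kernel_row_sum.
have E : \det (\matrix_(i < N, j < N) (PhiR R w (qnode j) * odd_mono R X (zz j) (f i))) =
    detS R X q N f * PhiProd.
  have -> : \matrix_(i < N, j < N) (PhiR R w (qnode j) * odd_mono R X (zz j) (f i)) =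
     (\matrix_(i < N, j < N) odd_mono R X (qpoint R X q j) (f i)) *m
       diag_mx (\row_(j < N) PhiR R w (qnode j)).
    by apply/matrixP => i j; rewrite mul_mx_diag !mxE mulrC.
  rewrite det_mulmx det_diag; congr (_ * _).
  by apply: eq_bigr => j _; rewrite mxE.
rewrite E in L.
rewrite -(mulVf (_ : detS R X q N f * PhiProd != 0)); last first.
  by rewrite mulf_neq0 // gt_eqF.
by apply: cvgM; [exact: cvg_cst|exact: L].
Qed.

End Transition.


(** * Sums of nonnegative families *)

Section EsumTools.
Variable R : realType.
Local Open Scope ereal_scope.

Lemma esum_exchange (S1 S2 : choiceType) (a : S1 -> S2 -> \bar R) :
  (forall i j, 0 <= a i j) ->
  \esum_(i in [set: S1]) \esum_(j in [set: S2]) a i j =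
  \esum_(j in [set: S2]) \esum_(i in [set: S1]) a i j.
Proof.
move=> a0; rewrite (@esum_esum _ _ _ [set: S1] (fun=> [set: S2])) //.
rewrite (@esum_esum _ _ _ [set: S2] (fun=> [set: S1]) (fun j i => a i j)) //.
rewrite (reindex_esum ([set: S2] `*`` (fun=> [set: S1])) _ (fun x => (x.2, x.1))) //.
split => //=.
- by move=> [i1 i2] [j1 j2] /= _ _ [] -> ->.
- by move=> [i j] _ /=; exists (j, i).
Qed.

Lemma esumZ (S : choiceType) (c : R) (a : S -> \bar R) : (0 <= c)%R ->
  (forall i, 0 <= a i) ->
  \esum_(i in [set: S]) (c%:E * a i) = c%:E * \esum_(i in [set: S]) a i.
Proof.
move=> c0 a0.
have le (d : R) (b : S -> \bar R) : (0 <= d)%R -> (forall i, 0 <= b i) ->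
    \esum_(i in [set: S]) (d%:E * b i) <= d%:E * \esum_(i in [set: S]) b i.
  move=> d0 b0; apply: ge_ereal_sup => _ [A [finA _] <-].
  rewrite -ge0_mule_fsumr //; apply: lee_wpmul2l; first by rewrite lee_fin.
  by apply: ereal_sup_ubound; exists A.
have [->|cn0] := eqVneq c 0%R.
  by rewrite mul0e esum1 // => i _; rewrite mul0e.
apply/eqP; rewrite eq_le le //=.
have cp : (0 < c)%R by rewrite lt_def cn0.
have := le (c^-1)%R (fun i => c%:E * a i).
rewrite invr_ge0 c0 => /(_ isT) H.
have {}H : \esum_(i in [set: S]) a i <= (c^-1)%:E * \esum_(i in [set: S]) (c%:E * a i).
  apply: le_trans (H _); last by move=> i; rewrite mule_ge0 // lee_fin.
  apply: le_esum => i _.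
  by rewrite muleA -EFinM mulVf // mul1e.
apply: (le_trans (lee_wpmul2l _ H)); first by rewrite lee_fin.
by rewrite muleA -EFinM mulfV // mul1e.
Qed.

Lemma le_esum_term (S : choiceType) (a : S -> \bar R) i : (forall i, 0 <= a i) ->
  a i <= \esum_(j in [set: S]) a j.
Proof.
move=> a0; apply: esum_ge; exists [set i]; first by split.
by rewrite fsbig_set1.
Qed.

Lemma esum_series (u : nat -> R) : (forall n, 0 <= u n)%R -> cvgn (series u) ->
  \esum_(n in [set: nat]) (u n)%:E = (limn (series u))%:E.
Proof.
move=> u0 cu; rewrite -nneseries_esumT; last by move=> n; rewrite lee_fin.
rewrite -EFin_lim //; congr (limn _); apply/funext => n.
by rewrite /= /series /= sumEFin.
Qed.

Lemma esum_antidiagonal (a : nat -> nat -> \bar R) : (forall i j, 0 <= a i j) ->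
  \esum_(i in [set: nat]) \esum_(j in [set: nat]) a i j =
  \esum_(k in [set: nat]) \sum_(i < k.+1) a i (k - i)%N.
Proof.
move=> a0; rewrite (@esum_esum _ _ _ [set: nat] (fun=> [set: nat])) //.
transitivity (\esum_(k in [set: nat]) \esum_(i in `I_k.+1) a i (k - i)%N); last first.
  apply: eq_esum => k _; rewrite (esum_fset (finite_II _)) //.
  by rewrite (fsbig_ord _ _ (fun i => a i (k - i)%N)).
rewrite (@esum_esum _ _ _ [set: nat] (fun k => `I_k.+1) (fun k i => a i (k - i)%N)) //.
rewrite (reindex_esum ([set: nat] `*`` (fun k => `I_k.+1)) _ (fun x => (x.2, x.1 - x.2)%N)) //.
split => //=.
- move=> [i1 i2] [j1 j2] /=; rewrite !inE /= => -[_ h1] [_ h2] [e1 e2].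
  by congr pair; lia.
- move=> [i j] _ /=; exists (i + j, i)%N => /=; last by congr pair; lia.
  by split => //=; lia.
Qed.

End EsumTools.

(** * The Markov semigroup of a stochastic matrix *)

Section Poissonization.
Variables (R : realType) (S : countType) (P : S -> S -> R).
Hypothesis sP : stochastic P.

Lemma stochastic_le1 (K : S -> S -> R) x y : stochastic K -> K x y <= 1.
Proof.
move=> [K0 K1]; rewrite -lee_fin -(K1 x).
by apply: (le_esum_term _ _ (fun y => (K x y)%:E)) => i; rewrite lee_fin.
Qed.

Fixpoint iter_kernel n : S -> S -> R :=
  if n is n'.+1 then fun x y => fine (\esum_(u in [set: S]) (P x u * iter_kernel n' u y)%:E)
  else fun x y => (x == y)%:R.

Lemma esum_delta (x : S) (a : S -> \bar R) : (forall i, 0 <= a i)%E ->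
  (\esum_(u in [set: S]) ((x == u)%:R%:E * a u) = a x)%E.
Proof.
move=> a0; rewrite -(@esum_set1 _ _ x a) // esum_mkcond [RHS]esum_mkcond.
apply: eq_esum => u _; rewrite in_setT.
have [<-|xu] := eqVneq x u; first by rewrite mul1e mem_set.
by rewrite mul0e memNset // => /esym/eqP; exact/negP.
Qed.

(** The sums are at most 1, hence finite; the row sums are exchanged by Tonelli. *)
Lemma stochastic_comp (K L : S -> S -> R) : stochastic K -> stochastic L ->
  (forall x y, (fine (\esum_(u in [set: S]) (K x u * L u y)%:E))%:E =
     \esum_(u in [set: S]) (K x u * L u y)%:E)%E /\
  stochastic (fun x y => fine (\esum_(u in [set: S]) (K x u * L u y)%:E)).
Proof.
move=> sK sL; have [K0 K1] := sK; have [L0 L1] := sL.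
have KL0 x u y : (0 <= (K x u * L u y)%:E)%E by rewrite lee_fin mulr_ge0.
have fin x y : (fine (\esum_(u in [set: S]) (K x u * L u y)%:E))%:E =
     (\esum_(u in [set: S]) (K x u * L u y)%:E)%E.
  apply: fineK; rewrite ge0_fin_numE; last by apply: esum_ge0.
  apply: (@le_lt_trans _ _ 1%E); last by rewrite ltry.
  rewrite -(K1 x); apply: le_esum => u _; rewrite lee_fin.
  by apply: ler_piMr => //; exact: stochastic_le1.
split => //; split.
  by move=> x y; rewrite -lee_fin fin; apply: esum_ge0.
move=> x; rewrite -[RHS](K1 x).
under eq_esum do rewrite fin.
rewrite esum_exchange //; apply: eq_esum => u _.
rewrite -[RHS]mule1 -(L1 u) -esumZ //; by move=> i; rewrite lee_fin.
Qed.

Lemma stochastic_iter_kernel n : stochastic (iter_kernel n).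
Proof.
elim: n => [|n IH] /=; last by case: (stochastic_comp _ _ sP IH).
split=> [x y|x]; first by rewrite ler0n.
have := esum_delta x (fun=> 1%E) (fun=> lee01).
by under eq_esum do rewrite mule1.
Qed.

Lemma iter_kernel_ge0 n x y : 0 <= iter_kernel n x y.
Proof. by case: (stochastic_iter_kernel n). Qed.

Lemma iter_kernel_le1 n x y : iter_kernel n x y <= 1.
Proof. exact: stochastic_le1 (stochastic_iter_kernel n). Qed.

Lemma iter_kernelS n x y : ((iter_kernel n.+1 x y)%:E = \esum_(u in [set: S]) (P x u * iter_kernel n u y)%:E)%E.
Proof. by rewrite /= (stochastic_comp _ _ sP (stochastic_iter_kernel n)).1. Qed.

Lemma iter_kernelD n m x y :
  (\esum_(u in [set: S]) (iter_kernel n x u * iter_kernel m u y)%:E = (iter_kernel (n + m) x y)%:E)%E.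
Proof.
have P0 x' y' : (0 <= (P x' y')%:E)%E by rewrite lee_fin; case: sP.
elim: n x => [|n IH] x.
  have := esum_delta x (fun u => (iter_kernel m u y)%:E) (fun i => _).
  move=> <-; last by move=> i; rewrite lee_fin iter_kernel_ge0.
  by apply: eq_esum => u _; rewrite EFinM.
rewrite addSn iter_kernelS.
transitivity (\esum_(u in [set: S]) \esum_(v in [set: S])
    ((P x v)%:E * (iter_kernel n v u * iter_kernel m u y)%:E))%E.
  apply: eq_esum => u _; rewrite EFinM iter_kernelS muleC -esumZ ?iter_kernel_ge0 //.
    by apply: eq_esum => v _; rewrite -!EFinM; congr EFin; ring.
  by move=> v; rewrite lee_fin mulr_ge0 ?iter_kernel_ge0 //; case: sP.
rewrite esum_exchange; last first.
  by move=> u v; rewrite mule_ge0 // lee_fin mulr_ge0 ?iter_kernel_ge0.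
apply: eq_esum => v _; rewrite EFinM -IH esumZ //; first by case: sP.
by move=> u; rewrite lee_fin mulr_ge0 ?iter_kernel_ge0.
Qed.

Definition poisson_mass (t : R) n : R := expR (- t) * (t ^+ n / n`!%:R).

Lemma poisson_mass_ge0 t n : 0 <= t -> 0 <= poisson_mass t n.
Proof. by move=> t0; rewrite mulr_ge0 ?expR_ge0 // divr_ge0 // exprn_ge0. Qed.

Lemma poisson_mass_cvg t : series (poisson_mass t) @ \oo --> (1 : R).
Proof.
have -> : series (poisson_mass t) = (fun n => expR (- t) * series (exp_coeff t) n).
  by apply/funext => n; rewrite /series /= mulr_sumr.
rewrite -(expRxMexpNx_1 t) mulrC.
by apply: cvgM; [exact: cvg_cst|exact: is_cvg_series_exp_coeff].
Qed.

Lemma poisson_mass_esum t : 0 <= t -> (\esum_(n in [set: nat]) (poisson_mass t n)%:E = 1)%E.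
Proof.
move=> t0; rewrite esum_series; last by apply/cvg_ex; exists 1; exact: poisson_mass_cvg.
  by congr EFin; apply/cvg_lim => //; exact: poisson_mass_cvg.
by move=> n; exact: poisson_mass_ge0.
Qed.

Lemma poisson_mass_conv s t k : \sum_(i < k.+1) poisson_mass s i * poisson_mass t (k - i) = poisson_mass (s + t) k.
Proof.
rewrite /poisson_mass opprD expRD addrC exprDn.
rewrite mulr_suml mulr_sumr; apply: eq_bigr => i _.
have ik : (i <= k)%N by rewrite -ltnS.
rewrite -(bin_fact ik) -mulr_natr !natrM.
have f0 j : j`!%:R != 0 :> R by rewrite pnatr_eq0 -lt0n fact_gt0.
have b0 : 'C(k, i)%:R != 0 :> R by rewrite pnatr_eq0 -lt0n bin_gt0.
by field; rewrite !f0 b0.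
Qed.

(** The continuous-time chain that jumps according to P at the times of a rate one
    Poisson process. *)
Definition poissonized (t : R) (x y : S) : R := limn (series (fun n => poisson_mass t n * iter_kernel n x y)).

Lemma poissonized_cvg t x y : 0 <= t -> cvgn (series (fun n => poisson_mass t n * iter_kernel n x y)).
Proof.
move=> t0; apply: (series_le_cvg (v_ := poisson_mass t)).
- by move=> n; rewrite mulr_ge0 ?poisson_mass_ge0 ?iter_kernel_ge0.
- by move=> n; exact: poisson_mass_ge0.
- by move=> n; rewrite ler_piMr ?poisson_mass_ge0 ?iter_kernel_le1.
- by apply/cvg_ex; exists 1; exact: poisson_mass_cvg.
Qed.

Lemma poissonizedE t x y : 0 <= t ->
  ((poissonized t x y)%:E = \esum_(n in [set: nat]) (poisson_mass t n * iter_kernel n x y)%:E)%E.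
Proof.
move=> t0; rewrite esum_series //; last exact: poissonized_cvg.
by move=> n; rewrite mulr_ge0 ?poisson_mass_ge0 ?iter_kernel_ge0.
Qed.

Lemma poissonized_stochastic t : 0 <= t -> stochastic (poissonized t).
Proof.
move=> t0.
have pP0 n x y : (0 <= (poisson_mass t n * iter_kernel n x y)%:E)%E.
  by rewrite lee_fin mulr_ge0 ?poisson_mass_ge0 ?iter_kernel_ge0.
split=> [x y|x]; first by rewrite -lee_fin poissonizedE //; apply: esum_ge0.
under eq_esum do rewrite poissonizedE //.
rewrite esum_exchange // -(poisson_mass_esum t t0); apply: eq_esum => n _.
have [Pn0 Pn1] := stochastic_iter_kernel n.
rewrite -[RHS]mule1 -(Pn1 x) -esumZ ?poisson_mass_ge0 //.
by move=> y; rewrite lee_fin.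
Qed.

(** Independent Poisson variables add up: group the terms by the total number of
    jumps. *)
Lemma poissonized_semigroup s t : 0 <= s -> 0 <= t -> forall x y,
  (\esum_(u in [set: S]) (poissonized s x u * poissonized t u y)%:E = (poissonized (s + t) x y)%:E)%E.
Proof.
move=> s0 t0 x y.
have p0 r n x' y' : 0 <= r -> 0 <= poisson_mass r n * iter_kernel n x' y'.
  by move=> r0; rewrite mulr_ge0 ?poisson_mass_ge0 ?iter_kernel_ge0.
have Q0 r x' y' : 0 <= r -> 0 <= poissonized r x' y'.
  by move=> r0; have [+ _] := poissonized_stochastic r r0; apply.
transitivity (\esum_(u in [set: S]) \esum_(n in [set: nat]) \esum_(m in [set: nat])
    ((poisson_mass s n * iter_kernel n x u) * (poisson_mass t m * iter_kernel m u y))%:E)%E.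
  apply: eq_esum => u _; rewrite EFinM (poissonizedE s) // muleC -esumZ ?Q0 //; last first.
    by move=> n; rewrite lee_fin p0.
  apply: eq_esum => n _; rewrite muleC poissonizedE // -esumZ ?p0 //.
  by move=> m; rewrite lee_fin p0.
rewrite esum_exchange; last first.
  by move=> u n; apply: esum_ge0 => m _; rewrite lee_fin mulr_ge0 ?p0.
transitivity (\esum_(n in [set: nat]) \esum_(m in [set: nat])
    (poisson_mass s n * poisson_mass t m * iter_kernel (n + m) x y)%:E)%E.
  apply: eq_esum => n _; rewrite esum_exchange; last first.
    by move=> u m; rewrite lee_fin mulr_ge0 ?p0.
  apply: eq_esum => m _; rewrite EFinM -iter_kernelD -esumZ.
  - by apply: eq_esum => u _; rewrite -EFinM; congr EFin; ring.
  - by rewrite mulr_ge0 ?poisson_mass_ge0.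
  - by move=> u; rewrite lee_fin mulr_ge0 ?iter_kernel_ge0.
rewrite esum_antidiagonal; last first.
  by move=> n m; rewrite lee_fin mulr_ge0 ?iter_kernel_ge0 // mulr_ge0 ?poisson_mass_ge0.
rewrite poissonizedE ?addr_ge0 //; apply: eq_esum => k _.
rewrite sumEFin -poisson_mass_conv mulr_suml; congr EFin; apply: eq_bigr => i _.
by rewrite subnKC // -ltnS.
Qed.

Lemma poissonized0 x y : poissonized 0 x y = (x == y)%:R.
Proof.
apply/cvg_lim => //; apply: cvg_near_cst; exists 1%N => // -[//|n] _ /=.
rewrite /series /= big_nat_recl //= big1 ?addr0.
  by rewrite /poisson_mass oppr0 expR0 expr0 fact0 divr1 !mul1r.
by move=> i _; rewrite /poisson_mass exprS !mul0r mulr0 mul0r.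
Qed.

Lemma cvg_shift2 (v : nat -> R) (l : R) : v @ \oo --> l -> v n.+2 @[n --> \oo] --> l.
Proof.
rewrite -(cvg_shiftn 2) => H.
have -> : (fun n => v n.+2) = [sequence v (n + 2)%N]_n; last exact: H.
by apply/funext => n; rewrite /= addn2.
Qed.

(** Up to a probability 1 - exp (- t) (1 + t), which is o (t), there is at most one jump. *)
Lemma poissonized_first_order t x y : 0 <= t ->
  0 <= poissonized t x y - expR (- t) * ((x == y)%:R + t * P x y) <= 1 - expR (- t) * (1 + t).
Proof.
move=> t0; pose u n := poisson_mass t n * iter_kernel n x y.
have P1 : iter_kernel 1 x y = P x y.
  apply: EFin_inj; rewrite iter_kernelS.
  have := esum_delta y (fun v => (P x v)%:E) (fun i => _).
  move=> <-; last by move=> i; rewrite lee_fin; case: sP.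
  by apply: eq_esum => v _; rewrite -EFinM /= eq_sym mulrC.
have two (v : nat -> R) n : series v n.+2 - (v 0 + v 1) = \sum_(2 <= i < n.+2) v i.
  rewrite /series /= big_ltn // big_ltn //; ring.
have u01 : u 0 + u 1 = expR (- t) * ((x == y)%:R + t * P x y).
  by rewrite /u P1 /poisson_mass /= expr0 fact0 expr1 !divr1 mulr1; ring.
have p01 : poisson_mass t 0 + poisson_mass t 1 = expR (- t) * (1 + t).
  by rewrite /poisson_mass expr0 fact0 expr1 !divr1 mulr1; ring.
have cu : (fun n => series u n.+2 - (u 0 + u 1)) @ \oo --> poissonized t x y - (u 0 + u 1).
  apply: cvgB; last exact: cvg_cst.
  by apply: cvg_shift2; exact: poissonized_cvg.
have cp : (fun n => series (poisson_mass t) n.+2 - (poisson_mass t 0 + poisson_mass t 1)) @ \oo -->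
    1 - (poisson_mass t 0 + poisson_mass t 1).
  apply: cvgB; last exact: cvg_cst.
  by apply: cvg_shift2; exact: poisson_mass_cvg.
rewrite -u01 -p01; apply/andP; split.
  apply: (cvgr_to_ge cu); apply: nearW => n; rewrite two; apply: sumr_ge0 => i _.
  by rewrite mulr_ge0 ?poisson_mass_ge0 ?iter_kernel_ge0.
apply: (ler_cvg_to cu cp); apply: nearW => n; rewrite !two; apply: ler_sum => i _.
by rewrite /u ler_piMr ?poisson_mass_ge0 ?iter_kernel_le1.
Qed.

Lemma poissonized_generator : is_generator poissonized (fun x y => P x y - (x == y)%:R).
Proof.
move=> x y.
have dE : is_derive (0 : R) (1 : R) (fun t : R => expR (- t)) (-1).
  by apply: is_derive_eq; rewrite oppr0 expR0 /GRing.scale /=; ring.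
have D1 : t^-1 * (expR (- t) - 1) @[t --> 0^'+] --> (-1 : R).
  have [/cvg_ex [l Hl] lE] := dE.
  have ll : l = -1 by rewrite -lE; apply/esym/cvg_lim.
  rewrite ll in Hl; have := cvg_dnbhs_at_right Hl.
  apply: cvg_trans; apply: near_eq_cvg; near=> t.
  by rewrite /= addr0 /GRing.scale /= mulr1 oppr0 expR0.
have D2 : expR (- t) @[t --> 0^'+] --> (1 : R).
  have -> : (1 : R) = expR (- 0) by rewrite oppr0 expR0.
  apply: cvg_at_right_filter; apply: (continuous_comp (f := -%R)).
    exact: continuousN.
  exact: continuous_expR.
pose r t := poissonized t x y - expR (- t) * ((x == y)%:R + t * P x y).
have D3 : t^-1 * r t @[t --> 0^'+] --> (0 : R).
  have U : - (t^-1 * (expR (- t) - 1)) - expR (- t) @[t --> 0^'+] --> (- (-1) - 1 : R).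
    by apply: cvgB; [apply: cvgN; exact: D1|exact: D2].
  rewrite opprK subrr in U; apply: (squeeze_cvgr _ (cvg_cst 0) U); near=> t.
  have t0 : 0 < t by near: t; exact: nbhs_right_gt.
  have /andP [h1 h2] := poissonized_first_order t x y (ltW t0).
  rewrite mulr_ge0 ?invr_ge0 ?(ltW t0) //=.
  have -> : - (t^-1 * (expR (- t) - 1)) - expR (- t) = t^-1 * (1 - expR (- t) * (1 + t)).
    by field; rewrite gt_eqF.
  by apply: ler_wpM2l h2; rewrite invr_ge0 ltW.
have D4 : (x == y)%:R * (t^-1 * (expR (- t) - 1)) + expR (- t) * P x y + t^-1 * r t
    @[t --> 0^'+] --> ((x == y)%:R * -1 + 1 * P x y + 0 : R).
  apply: cvgD; last exact: D3.
  apply: cvgD; apply: cvgM; [exact: cvg_cst|exact: D1|exact: D2|exact: cvg_cst].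
have -> : P x y - (x == y)%:R = (x == y)%:R * -1 + 1 * P x y + 0 by ring.
apply: cvg_trans D4; apply: near_eq_cvg; near=> t.
have t0 : 0 < t by near: t; exact: nbhs_right_gt.
by rewrite poissonized0 /r; field; rewrite gt_eqF.
Unshelve. all: by end_near. Qed.

Lemma poissonized_Markov : Markov_semigroup poissonized.
Proof.
split.
- exact: poissonized_stochastic.
- exact: poissonized0.
- exact: poissonized_semigroup.
- move=> x y.
  have L : t * (t^-1 * (poissonized t x y - poissonized 0 x y)) + poissonized 0 x y @[t --> 0^'+] -->
      0 * (P x y - (x == y)%:R) + poissonized 0 x y.
    apply: cvgD; last exact: cvg_cst.
    apply: cvgM; last exact: poissonized_generator.
    by apply: cvg_at_right_filter; exact: cvg_id.
  rewrite mul0r add0r poissonized0 in L; apply: cvg_trans L; apply: near_eq_cvg; near=> t.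
  have t0 : 0 < t by near: t; exact: nbhs_right_gt.
  by rewrite mulVKf ?gt_eqF // subrK.
Unshelve. all: by end_near. Qed.

End Poissonization.


(** * Row sums over signatures *)

Section Stochastic.
Variables (R : realType) (q : R).
Hypotheses (q0 : 0 < q) (q1 : q < 1).
Variables (X : lie_series) (n : nat).
Let N := n.+1.
Variable w : params R.
Hypothesis hw : in_Omega w.
Hypothesis hpos : forall i : 'I_N, 0 < Psi w (q `^ cX R X i.+1)%:C.
Hypothesis hTaylor : Taylor_cvg_annulus w (fun i : 'I_N => qX X q i.+1).

Let P := transition R q X n w.

Let P_ge0 la mu : 0 <= P la mu.
Proof. by apply: (transition_weight_ge0 R q q0 q1 X n w hw hpos); exact: strictly_decr_pos. Qed.

Let box M : set (Splus N) := [set mu | forall i, (pos n mu i < M)%N].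

Let box_sum la M : R := \sum_(h : {ffun 'I_N -> 'I_M} | strictly_decr N (fun i => h i))
  transition_weight R q X n w (pos n la) (fun i => h i).

Lemma esum_subset (S : choiceType) (A B : set S) (a : S -> \bar R) :
  A `<=` B -> (\esum_(i in A) a i <= \esum_(i in B) a i)%E.
Proof.
move=> AB; apply: ge_ereal_sup => _ [C [finC CA] <-].
by apply: ereal_sup_ubound; exists C => //; split => //; exact: subset_trans AB.
Qed.

(** Positions identify the signatures with the strictly decreasing families. *)
Lemma esum_box la M : (\esum_(mu in box M.+1) (P la mu)%:E = (box_sum la M.+1)%:E)%E.
Proof.
pose a (h : {ffun 'I_N -> 'I_M.+1}) := (transition_weight R q X n w (pos n la) (fun i => h i))%:E.
pose enc (mu : Splus N) : {ffun 'I_N -> 'I_M.+1} := [ffun i => inord (pos n mu i)].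
have encE mu : box M.+1 mu -> (fun i => enc mu i : nat) = pos n mu.
  by move=> bmu; apply/funext => i; rewrite /enc ffunE inordK.
transitivity (\esum_(mu in box M.+1) a (enc mu))%E.
  by apply: eq_esum => mu bmu; rewrite /a encE.
rewrite -(reindex_esum _ [set h : {ffun 'I_N -> 'I_M.+1} | strictly_decr N (fun i => h i)] enc a).
  rewrite esum_mkcond esum_fset; [|exact: finite_finset|].
  2: {
    move=> h _; case: ifP => // /set_mem sh; rewrite lee_fin.
    by apply: (transition_weight_ge0 R q q0 q1 X n w hw hpos) => //; exact: strictly_decr_pos.
  }
  have -> : [set: {ffun 'I_N -> 'I_M.+1}] = [set` index_enum {ffun 'I_N -> 'I_M.+1}].
    by apply/seteqP; split => h _ //=; rewrite mem_index_enum.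
  rewrite -fsbig_seq ?index_enum_uniq // /box_sum -sumEFin [RHS]big_mkcond /=.
  by apply: eq_bigr => h _; rewrite mem_setE.
split.
- by move=> mu bmu /=; rewrite encE //; exact: strictly_decr_pos.
- move=> mu nu /set_mem bmu /set_mem bnu E.
  apply: (pos_inj n); rewrite -(encE _ bmu) -(encE _ bnu); by rewrite E.
- move=> h /= sh; have [mu Emu] := pos_surj n _ sh.
  have bmu : box M.+1 mu by move=> i; rewrite Emu.
  exists mu => //; apply/ffunP => i; apply: val_inj.
  by have := congr1 (fun f => f i) (encE _ bmu); rewrite Emu.
Qed.

Lemma box_sum_cvg la : box_sum la M @[M --> \oo] --> (1 : R).
Proof.
exact: (transition_weight_sum_cvg R q q0 q1 X n w hw hpos hTaylor _ (strictly_decr_pos n la)).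
Qed.

(** The box sums increase with M and tend to 1. *)
Lemma box_sum_le1 la M : box_sum la M.+1 <= 1.
Proof.
have nd : nondecreasing_seq (fun M => box_sum la M.+1).
  apply/nondecreasing_seqP => k; rewrite -lee_fin -!esum_box; apply: esum_subset.
  by move=> mu bmu i; exact: leq_trans (bmu i) _.
have C : (fun M => box_sum la M.+1) @ \oo --> (1 : R).
  by have := box_sum_cvg la; rewrite -(cvg_shiftS (box_sum la)).
have cW : cvgn (fun M => box_sum la M.+1) by apply/cvg_ex; exists 1.
have := nondecreasing_cvgn_le nd cW M.
by rewrite (cvg_lim _ C).
Qed.

(** Every finite set of signatures lies in a box, so the total sum is the limit of the
    box sums. *)
Lemma transition_stochastic : stochastic P.
Proof.
split=> // la.
have P0 mu : (0 <= (P la mu)%:E)%E by rewrite lee_fin.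
have le1 : (\esum_(mu in [set: Splus N]) (P la mu)%:E <= 1)%E.
  apply: ge_ereal_sup => _ [A [finA _] <-].
  have /finite_seqP [r Ar] := finA.
  pose M := (\max_(mu <- r) \max_(i < N) pos n mu i)%N.
  apply: (@le_trans _ _ (\esum_(mu in box M.+1) (P la mu)%:E)%E); last first.
    by rewrite esum_box lee_fin box_sum_le1.
  apply: ereal_sup_ubound; exists A => //; split => // mu Amu i.
  have muA : mu \in r by move: Amu; rewrite Ar.
  rewrite ltnS; apply: leq_trans (leq_bigmax_seq _ muA isT).
  exact: (leq_bigmax i).
have E0 : (0 <= \esum_(mu in [set: Splus N]) (P la mu)%:E)%E by apply: esum_ge0.
have fE : (\esum_(mu in [set: Splus N]) (P la mu)%:E \is a fin_num)%E.
  by rewrite ge0_fin_numE // (le_lt_trans le1) // ltry.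
apply/eqP; rewrite eq_le le1 /= -(fineK fE) lee_fin.
have C : (fun M => box_sum la M.+1) @ \oo --> (1 : R).
  by have := box_sum_cvg la; rewrite -(cvg_shiftS (box_sum la)).
apply: (cvgr_to_le C); apply: nearW => M.
by rewrite -lee_fin fineK // -esum_box; apply: esum_subset.
Qed.

End Stochastic.

Theorem theorem6p1 (R : realType) (q : R) (hq0 : 0 < q) (hq1 : q < 1)
    (X : lie_series) (N : nat) (hN : (1 <= N)%N)
    (w : params R) (hw : in_Omega w)
    (hpos : forall i : 'I_N, 0 < Psi w (q `^ cX R X i.+1)%:C)
    (hTaylor : Taylor_cvg_annulus w (fun i : 'I_N => qX X q i.+1)) :
  exists (Q : R -> Splus N -> Splus N -> R) (L : Splus N -> Splus N -> R),
    [/\ Markov_semigroup Q,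
        is_generator Q L
      & forall la mu : Splus N, (L la mu)%:C = generator_formula X q w la mu].
Proof.
case: N hN hpos hTaylor => // n _ hpos hTaylor.
have sP := transition_stochastic R q hq0 hq1 X n w hw hpos hTaylor.
exists (poissonized R _ (transition R q X n w)), (fun la mu => transition R q X n w la mu - (la == mu)%:R).
split; [exact: poissonized_Markov|exact: poissonized_generator|move=> la mu].
by rewrite (generator_formulaE R q hq0 hq1 X n w hw hpos).
Qed.
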